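(* Let $0<\lambda<e^{-(\log L+L)}$. Then there is a 3-d straight brush $B$ and a homeomorphism of $B$ onto the Julia set $\mathcal{J}(\mathcal{Z}_\lambda)$ of the Zorich map $\mathcal{Z}_\lambda$. Moreover, this homeomorphism extends to a homeomorphism between $B\cup\{\infty\}$ and $\mathcal{J}(\mathcal{Z}_\lambda)\cup\{\infty\}$.
   Context: Zorich maps. Let $Q=\{(x_1,x_2)\in\mathbb{R}^2:|x_1|\le 1,|x_2|\le 1\}$ and let $h=(h_1,h_2,h_3)$ be a sense-preserving $L$-bi-Lipschitz map (i.e. $L^{-1}|u-v|\le|h(u)-h(v)|\le L|u-v|$) from $Q$ onto the upper hemisphere $\{x\in\mathbb{R}^3:|x|=1,\ x_3\ge 0\}$. Define $\mathcal{Z}(x_1,x_2,x_3)=e^{x_3}h(x_1,x_2)$ on $Q\times\mathbb{R}$ and extend $\mathcal{Z}$ to $\mathbb{R}^3$ by repeatedly reflecting across the sides of the square beam in the domain and across the plane $x_3=0$ in the range. Explicitly, if $|x_1-2n|\le1$, $|x_2-2m|\le 1$ with $n,m\in\mathbb{Z}$, and $u=((-1)^n(x_1-2n),(-1)^m(x_2-2m))\in Q$, then $\mathcal{Z}(x)=e^{x_3}(h_1(u),h_2(u),(-1)^{n+m}h_3(u))$. For $\lambda>0$ put $\mathcal{Z}_\lambda=\lambda\mathcal{Z}$; it is a quasiregular map of transcendental type. Julia set. For such a map $f:\mathbb{R}^d\to\mathbb{R}^d$, $\mathcal{J}(f)$ is the set of all $x\in\mathbb{R}^d$ such that $\operatorname{cap}\left(\mathbb{R}^d\setminus\bigcup_{k=1}^\infty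 f^k(U)\right)=0$ for every neighbourhood $U$ of $x$, where $\operatorname{cap}$ is conformal capacity: a compact set $F$ has capacity zero if $\inf\int|\nabla u|^d=0$, the infimum being over $u\in C_0^\infty(A)$ with $u\ge 1$ on $F$, for some (equivalently every) bounded open $A\supset F$; a closed set has capacity zero if all of its compact subsets do. 3-d straight brush. A 3-d straight brush is a subset $B$ of $\{(y,a_1,a_2)\in\mathbb{R}^3:y\ge 0,\ (a_1,a_2)\in(\mathbb{R}\setminus\mathbb{Q})^2\}$ such that: (i) Hairiness: for every $(a_1,a_2)\in\mathbb{R}^2$ there is $t_{(a_1,a_2)}\in[0,\infty]$ such that $(t,a_1,a_2)\in B$ if and only if $t\ge t_{(a_1,a_2)}$ ($t\in\mathbb{R}$). (ii) Density: the set of $(a_1,a_2)$ with $t_{(a_1,a_2)}<\infty$ is dense in $(\mathbb{R}\setminus\mathbb{Q})^2$. Also, for any such $(a_1,a_2)$ there exist sequences $(a_1,a_{n,2})$, $(a_1,b_{n,2})$, $(c_{n,1},a_2)$, $(d_{n,1},a_2)$ such that $a_{n,2}\uparrow a_2$, $b_{n,2}\downarrow a_2$, $c_{n,1}\uparrow a_1$, $d_{n,1}\downarrow a_1$, and $t_{(a_1,a_{n,2})}\to t_{(a_1,a_2)}$, and similarly for the other three sequences. Here $\uparrow$ and $\downarrow$ denote strictly increasing and strictly decreasing convergence. (iii) Compact sections: $B$ is a closed subset of $\mathbb{R}^3$. $B\cup\{\infty\}$ and $\mathcal{J}(\mathcal{Z}_\lambda)\cup\{\infty\}$ denote one-point compactifications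 (subspaces of $\mathbb{R}^3\cup\{\infty\}$). *)

(* Defs.v *)
From HB Require Import structures.
From mathcomp Require Import all_boot all_order all_algebra.
From mathcomp Require Import all_classical all_reals all_analysis.
From mathcomp Require Import lra.

Set Implicit Arguments.
Unset Strict Implicit.
Unset Printing Implicit Defensive.

Import Order.TTheory GRing.Theory Num.Theory.
Import numFieldTopology.Exports numFieldNormedType.Exports.

Local Open Scope classical_set_scope.
Local Open Scope ring_scope.

(* Points of R^n are row vectors.  The norm that the library puts on 'rV[R]_n  *)
(* is the sup norm; it is only used for the topology, metric statements being  *)
(* made with the Euclidean norm below.                                         *)
Section vectors.
Variable R : realType.

Definition enorm n (v : 'rV[R]_n) : R := Num.sqrt (\sum_(i < n) v 0 i ^+ 2).

Definition vec2 (x y : R) : 'rV[R]_2 := \row_(i < 2) [:: x; y]`_i.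

Definition vec3 (x y z : R) : 'rV[R]_3 := \row_(i < 3) [:: x; y; z]`_i.

(* Lebesgue measure lives on R * R and R * R * R, from which the vectors are   *)
(* parametrized by [vec2] and [vec3].                                          *)
Definition leb2 := (@lebesgue_measure R \x @lebesgue_measure R)%E.

Definition leb3 := (leb2 \x @lebesgue_measure R)%E.

End vectors.

Arguments leb2 : clear implicits.
Arguments leb3 : clear implicits.

Section homeomorphism.
Variables T U : topologicalType.

Definition homeo_on (A : set T) (B : set U) (f : T -> U) : Prop :=
  [/\ set_bij A B f, {within A, continuous f} &
      exists2 g : U -> T, {within B, continuous g} & {in A, cancel f g}].

Definition add_infty (A : set T) : set (one_point_compactification T) :=
  (Some @` A) `|` [set None].

End homeomorphism.

Section zorich.
Variable R : realType.

Definition square : set 'rV[R]_2 := [set u | `|u 0 0| <= 1 /\ `|u 0 1| <= 1].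

Definition upper_hemisphere : set 'rV[R]_3 :=
  [set x | enorm x = 1 /\ 0 <= x 0 2].

Definition bilipschitz_on m n (A : set 'rV[R]_m) (L : R)
    (h : 'rV[R]_m -> 'rV[R]_n) : Prop :=
  forall u v, A u -> A v ->
    L^-1 * enorm (u - v) <= enorm (h u - h v) <= L * enorm (u - v).

(* The hemisphere is oriented by its outer normal, which at the point h u is   *)
(* h u itself.  As bi-Lipschitz maps are differentiable almost everywhere,     *)
(* h preserves orientation when the determinant with rows D_1 h, D_2 h, h      *)
(* is positive almost everywhere; up to the factor e^(3 x_3), this is the      *)
(* Jacobian determinant of (x_1, x_2, x_3) |-> e^(x_3) h (x_1, x_2).           *)
Definition sense_preserving (h : 'rV[R]_2 -> 'rV[R]_3) : Prop :=
  {ae leb2 R, forall p : R * R, square° (vec2 p.1 p.2) ->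
    let u := vec2 p.1 p.2 in
    differentiable h u /\ 0 < \det (col_mx ('J h u) (h u) : 'M[R]_(2 + 1))}.

(* An n with |t - 2 n| <= 1, the larger one when t is an odd integer; see      *)
(* [zorichE] for the independence of this choice.                              *)
Definition cell (t : R) : int := Num.floor ((t + 1) / 2).

Definition zorich (h : 'rV[R]_2 -> 'rV[R]_3) (x : 'rV[R]_3) : 'rV[R]_3 :=
  let n := cell (x 0 0) in
  let m := cell (x 0 1) in
  let u := vec2 ((-1) ^ n * (x 0 0 - 2 * n%:~R))
                ((-1) ^ m * (x 0 1 - 2 * m%:~R)) in
  expR (x 0 2) *: vec3 (h u 0 0) (h u 0 1) ((-1) ^ (n + m) * h u 0 2).

Lemma cell_or (t : R) (n : int) : `|t - 2 * n%:~R| <= 1 ->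
  cell t = n \/ cell t = n + 1 /\ t - 2 * n%:~R = 1.
Proof.
rewrite ler_norml => /andP[t1 t2].
have [t3|t3] := eqVneq (t - 2 * n%:~R) 1; [right; split=> // | left];
  apply: Num.Theory.floor_def; rewrite ?intrD.
  by apply/andP; split; lra.
have : t - 2 * n%:~R < 1 by rewrite lt_neqAle t3.
by move=> ?; apply/andP; split; lra.
Qed.

Lemma fold_cell (t : R) (n : int) : `|t - 2 * n%:~R| <= 1 ->
  (-1) ^ (cell t) * (t - 2 * (cell t)%:~R) = (-1) ^ n * (t - 2 * n%:~R).
Proof.
move=> /cell_or[->//|[-> e]].
have -> : t - 2 * (n + 1)%:~R = -1 by rewrite intrD; lra.
by rewrite e exprzDr ?unitrN1// expr1z mulrN1 mulrN1 opprK mulr1.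
Qed.

(* The vanishing of h_3 on the boundary of the square is automatic when h is a *)
(* homeomorphism of the square onto the upper hemisphere.                      *)
Lemma zorichE (h : 'rV[R]_2 -> 'rV[R]_3) (x : 'rV[R]_3) (n m : int) :
  (forall u, square u -> `|u 0 0| = 1 \/ `|u 0 1| = 1 -> h u 0 2 = 0) ->
  `|x 0 0 - 2 * n%:~R| <= 1 -> `|x 0 1 - 2 * m%:~R| <= 1 ->
  let u := vec2 ((-1) ^ n * (x 0 0 - 2 * n%:~R))
                ((-1) ^ m * (x 0 1 - 2 * m%:~R)) in
  zorich h x = expR (x 0 2) *: vec3 (h u 0 0) (h u 0 1) ((-1) ^ (n + m) * h u 0 2).
Proof.
move=> h0 xn xm u; rewrite /zorich (fold_cell xn) (fold_cell xm) -/u.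
have [u0 u1] : u 0 0 = (-1) ^ n * (x 0 0 - 2 * n%:~R) /\
   u 0 1 = (-1) ^ m * (x 0 1 - 2 * m%:~R) by rewrite !mxE.
have nu (k : int) : `|(-1 : R) ^ k| = 1 by case: k => k; rewrite /= ?normfV normrX normrN1 expr1n ?invr1.
have su : square u by rewrite /square /= u0 u1 !normrM !nu !mul1r.
have hu : h u 0 2 = 0 -> forall a b : int, (-1) ^ a * h u 0 2 = (-1) ^ b * h u 0 2.
  by move=> -> a b; rewrite !mulr0.
congr (_ *: vec3 _ _ _).
have [->|[_ e]] := cell_or xn; last first.
  by apply/hu/h0 => //; left; rewrite u0 normrM nu e mul1r normr1.
have [->//|[_ e]] := cell_or xm.
by apply/hu/h0 => //; right; rewrite u1 normrM nu e mul1r normr1.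
Qed.

Definition zorich_scaled (lambda : R) (h : 'rV[R]_2 -> 'rV[R]_3)
  (x : 'rV[R]_3) : 'rV[R]_3 := lambda *: zorich h x.

End zorich.

Section julia.
Variable R : realType.

Fixpoint Ck n (k : nat) (u : 'rV[R]_n -> R) : Prop :=
  if k is k'.+1 then
    forall i : 'I_n, (forall x, derivable u x (delta_mx 0 i)) /\
                     Ck k' (fun x => 'D_(delta_mx 0 i) u x)
  else continuous u.

Definition smooth n (u : 'rV[R]_n -> R) : Prop := forall k, Ck k u.

Definition gradient n (u : 'rV[R]_n -> R) (x : 'rV[R]_n) : 'rV[R]_n :=
  \row_(i < n) 'D_(delta_mx 0 i) u x.

Definition closed_support n (u : 'rV[R]_n -> R) : set 'rV[R]_n :=
  closure [set x | u x != 0].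

(* The functions admissible for the condenser (A, F). *)
Definition admissible n (A F : set 'rV[R]_n) : set ('rV[R]_n -> R) :=
  [set u | [/\ smooth u, compact (closed_support u), closed_support u `<=` A &
               forall x, F x -> 1 <= u x]].

Definition conformal_energy (u : 'rV[R]_3 -> R) : \bar R :=
  (\int[leb3 R]_(p in setT)
     (enorm (gradient u (vec3 p.1.1 p.1.2 p.2)) ^+ 3)%:E)%E.

Definition compact_capacity0 (F : set 'rV[R]_3) : Prop :=
  exists A : set 'rV[R]_3, [/\ open A, bounded_set A, F `<=` A &
    ereal_inf [set conformal_energy u | u in admissible A F] = 0%E].

Definition capacity0 (E : set 'rV[R]_3) : Prop :=
  forall F, compact F -> F `<=` E -> compact_capacity0 F.

Definition julia (f : 'rV[R]_3 -> 'rV[R]_3) : set 'rV[R]_3 :=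
  [set x | forall U, nbhs x U ->
     capacity0 (~` \bigcup_(k in [set k | (1 <= k)%N]) (iter k f @` U))].

End julia.

Section brush.
Variable R : realType.

Definition irrational2 : set (R * R) := @irrational R `*` @irrational R.

(* [increasing_seq] and [decreasing_seq] are the strict notions. *)
Definition increases_to (a : nat -> R) (l : R) : Prop :=
  increasing_seq a /\ a @ \oo --> l.

Definition decreases_to (a : nat -> R) (l : R) : Prop :=
  decreasing_seq a /\ a @ \oo --> l.

Definition hairiness (B : set 'rV[R]_3) (t : R -> R -> \bar R) : Prop :=
  forall a1 a2, (0 <= t a1 a2)%E /\
    forall s : R, B (vec3 s a1 a2) <-> (t a1 a2 <= s%:E)%E.

Definition density (t : R -> R -> \bar R) : Prop :=
  irrational2 `<=` closure [set a | (t a.1 a.2 < +oo)%E] /\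
  forall a1 a2, (t a1 a2 < +oo)%E ->
    [/\ exists2 a, increases_to a a2 & t a1 (a n) @[n --> \oo] --> t a1 a2,
        exists2 b, decreases_to b a2 & t a1 (b n) @[n --> \oo] --> t a1 a2,
        exists2 c, increases_to c a1 & t (c n) a2 @[n --> \oo] --> t a1 a2 &
        exists2 d, decreases_to d a1 & t (d n) a2 @[n --> \oo] --> t a1 a2].

(* Hairiness determines t from B. *)
Definition straight_brush (B : set 'rV[R]_3) : Prop :=
  [/\ forall p, B p -> 0 <= p 0 0 /\ irrational2 (p 0 1, p 0 2),
      exists2 t, hairiness B t & density t &
      closed B].

End brush.

(* Main.v *)
Require Import Defs.
From HB Require Import structures.
From mathcomp Require Import all_boot all_order all_algebra.
From mathcomp Require Import all_classical all_reals all_analysis.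
From mathcomp Require Import measurable_realfun.
From mathcomp Require Import ring lra zify.

Set Implicit Arguments.
Unset Strict Implicit.
Unset Printing Implicit Defensive.

Import Order.TTheory GRing.Theory Num.Theory.
Import numFieldTopology.Exports numFieldNormedType.Exports.
Local Open Scope classical_set_scope.
Local Open Scope ring_scope.

(** The idea is to split the dynamics of [f = zorich_scaled lambda h] at the height
    [M = - ln lambda - ln L], the [level].  The half space below it is mapped into the
    unit ball, which is contained in it, so that all orbits that enter it stay bounded.
    The hypothesis on [lambda] says that [M > L], and this makes [f] expand uniformly,
    by [M / L], the distances between points of a beam whose images are above the level
    ([f_expanding]).  Let the non-escaping set consist of the points whose whole orbit
    is above the level.

    The Julia set is the non-escaping set ([julia_nonescaping]).  By expansion, the
    images of a neighbourhood of a non-escaping point contain balls of any given radius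
    in the upper half space, and two further iterations spread such a ball over the
    whole space without the origin ([iterates_cover]).  A point has capacity zero, as
    is shown by an average of bumps at geometrically decreasing scales
    ([capacity0_origin]).  Around any other point the images of a neighbourhood stay in
    a ball ([iterates_bounded]) and omit a plate, whose capacity is positive, since
    every admissible function climbs from [0] to [1] on each vertical line through it
    ([plate_capacity]).

    The beams that [f] maps onto the upper half space are indexed by pairs of integers,
    and the interiors of these beams contain the non-escaping set.  This uses that [h]
    maps the boundary of the square to the equator ([boundary_to_equator]), which is
    derived from a two-dimensional intermediate value theorem, [poincare_miranda].  A
    non-escaping point has an itinerary, a sequence of pairs of integers.  Sequences of
    integers correspond to irrational numbers by an expansion akin to continued
    fractions, but increasing for the lexicographic order ([code_lt]) and such that
    every sequence occurs ([decode]).  An itinerary is thus a pair of irrational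
    numbers, the position of a hair.

    The position on a hair is measured by comparison with a model in which every point
    is replaced by the point of equal height on the axis of its beam, so that only the
    heights move ([model_branch]).  As the beams have bounded width and all inverse
    branches are contractions, each orbit of the model is shadowed by a unique orbit of
    [f] with the same symbols and conversely ([shadowing_point], [shadowing_orbit]).
    The model is increasing in the height, so that for a given itinerary the possible
    initial heights are those above the supremum of the numbers [first_height]: they
    form a closed half line, or nothing.  These half lines make up the brush
    [model_brush].  Its other properties follow because a symbol at time [n] affects
    the heights by a multiple of [M ^- n] only ([first_height_perturb]), and because
    bounded heights force bounded symbols, which keeps limits irrational
    ([bounded_code_irrational]).  The correspondence is continuous in both directions,
    since closeness at a late time and a common past imply closeness at time zero, and
    it extends by infinity, since it moves the initial beams and heights by bounded
    amounts ([brush_homeomorphism]). *)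

(** * The Euclidean norm *)

Section euclidean_norm.
Variables (R : realType) (n : nat).
Implicit Types u v w : 'rV[R]_n.

Lemma enorm_ge0 v : 0 <= enorm v.
Proof. exact: sqrtr_ge0. Qed.

Lemma sum_sqr_ge0 v : 0 <= \sum_(i < n) v 0 i ^+ 2.
Proof. by apply: sumr_ge0 => i _; exact: sqr_ge0. Qed.

Lemma sqr_enorm v : enorm v ^+ 2 = \sum_(i < n) v 0 i ^+ 2.
Proof. by rewrite sqr_sqrtr// sum_sqr_ge0. Qed.

Lemma enorm_le v a : 0 <= a -> \sum_(i < n) v 0 i ^+ 2 <= a ^+ 2 -> enorm v <= a.
Proof.
move=> a0 va; rewrite -(@ler_pXn2r _ 2) ?nnegrE ?enorm_ge0//.
by rewrite sqr_enorm.
Qed.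

Lemma enormN v : enorm (- v) = enorm v.
Proof.
by congr (Num.sqrt _); apply: eq_bigr => i _; rewrite mxE sqrrN.
Qed.

Lemma edistC u v : enorm (u - v) = enorm (v - u).
Proof. by rewrite -enormN opprB. Qed.

Lemma enormZ a v : enorm (a *: v) = `|a| * enorm v.
Proof.
rewrite /enorm -sqrtr_sqr -sqrtrM ?sqr_ge0// mulr_sumr.
by congr Num.sqrt; apply: eq_bigr => i _; rewrite mxE exprMn.
Qed.

Lemma enorm0 : enorm (0 : 'rV[R]_n) = 0.
Proof. by rewrite -(scale0r 0) enormZ normr0 mul0r. Qed.

Lemma coord_le_enorm v i : `|v 0 i| <= enorm v.
Proof.
rewrite -(@ler_pXn2r _ 2) ?nnegrE ?enorm_ge0// sqr_enorm.
rewrite (bigD1 i)//= -[leLHS]addr0 real_normK ?num_real// lerD2l.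
by apply: sumr_ge0 => j _; exact: sqr_ge0.
Qed.

Lemma enorm0_eq0 v : enorm v = 0 -> v = 0.
Proof.
move=> v0; apply/rowP => i; rewrite !mxE; apply/eqP.
by rewrite -normr_le0 (le_trans (coord_le_enorm v i))// v0.
Qed.

Lemma cauchy_schwarz u v : \sum_(i < n) u 0 i * v 0 i <= enorm u * enorm v.
Proof.
have [u0|u0] := eqVneq (enorm u) 0.
  rewrite big1 ?u0 ?mul0r// => i _.
  by rewrite (enorm0_eq0 u0) mxE mul0r.
have [v0|v0] := eqVneq (enorm v) 0.
  rewrite big1 ?v0 ?mulr0// => i _.
  by rewrite (enorm0_eq0 v0) mxE mulr0.
have uP : 0 < enorm u by rewrite lt_def u0 enorm_ge0.
have vP : 0 < enorm v by rewrite lt_def v0 enorm_ge0.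
have : 0 <= \sum_(i < n) (enorm v * u 0 i - enorm u * v 0 i) ^+ 2.
  by apply: sumr_ge0 => i _; exact: sqr_ge0.
have -> : \sum_(i < n) (enorm v * u 0 i - enorm u * v 0 i) ^+ 2 =
  enorm v ^+ 2 * enorm u ^+ 2 + enorm u ^+ 2 * enorm v ^+ 2 -
  2 * (enorm u * enorm v) * \sum_(i < n) u 0 i * v 0 i.
  rewrite 2!sqr_enorm !mulr_sumr -big_split/= -sumrB.
  by apply: eq_bigr => i _; rewrite -2!sqr_enorm; ring.
have uvP : 0 < enorm u * enorm v by rewrite mulr_gt0.
move=> h; rewrite -(@ler_pM2l _ (2 * (enorm u * enorm v))); last by lra.
nra.
Qed.

Lemma ler_enormD u v : enorm (u + v) <= enorm u + enorm v.
Proof.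
apply: enorm_le; first by rewrite addr_ge0 ?enorm_ge0.
have -> : \sum_(i < n) (u + v) 0 i ^+ 2 =
  enorm u ^+ 2 + enorm v ^+ 2 + 2 * \sum_(i < n) u 0 i * v 0 i.
  rewrite 2!sqr_enorm mulr_sumr -!big_split/=.
  by apply: eq_bigr => i _; rewrite mxE; ring.
have := cauchy_schwarz u v; nra.
Qed.

Lemma ler_edistD v u w : enorm (u - w) <= enorm (u - v) + enorm (v - w).
Proof. by rewrite -[u - w](subrKA v) ler_enormD. Qed.

Lemma ler_enorm_dist u v : `|enorm u - enorm v| <= enorm (u - v).
Proof.
have := ler_enormD (v - u) u; have := ler_enormD (u - v) v.
by rewrite !subrK (edistC v u) ler_norml => ? ?; apply/andP; split; lra.
Qed.

Lemma edist_eq0 u v : enorm (u - v) <= 0 -> u = v.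
Proof.
move=> uv; apply/eqP; rewrite -subr_eq0; apply/eqP/enorm0_eq0/le_anti.
by rewrite uv enorm_ge0.
Qed.

Lemma norm_le_enorm v : `|v| <= enorm v.
Proof.
rewrite /Num.norm/= mx_normrE; apply: bigmax_le; first exact: enorm_ge0.
by move=> [i j] _ /=; rewrite ord1 coord_le_enorm.
Qed.

Lemma coord_le_norm v i : `|v 0 i| <= `|v|.
Proof.
rewrite [leRHS]/Num.norm/= mx_normrE.
exact: (le_bigmax_cond _ (fun ij : 'I_1 * 'I_n => `|v ij.1 ij.2|) (j := (0, i))).
Qed.

Lemma enorm_le_norm v : enorm v <= n%:R * `|v|.
Proof.
apply: enorm_le; first by rewrite mulr_ge0.
apply: (@le_trans _ _ (\sum_(i < n) `|v| ^+ 2)).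
  apply: ler_sum => i _; rewrite -[v 0 i ^+ 2]real_normK ?num_real//.
  by rewrite lerXn2r ?nnegrE// coord_le_norm.
rewrite sumr_const card_ord -[_ *+ n]mulr_natl exprMn ler_wpM2r ?sqr_ge0//.
case: n => [|m]; first by rewrite expr0n.
by rewrite expr2 ler_peMl// ler1n.
Qed.

Lemma nbhs_enorm v (U : set 'rV[R]_n) :
  nbhs v U <-> exists2 e, 0 < e & forall w, enorm (w - v) < e -> U w.
Proof.
split.
  move=> /nbhs_ballP[e /= e0 eU]; exists e => // w wv; apply: eU.
  rewrite -ball_normE /ball_/= (le_lt_trans (norm_le_enorm _))//.
  by rewrite edistC.
move=> [e e0 eU]; apply/nbhs_ballP; exists (e / n.+1%:R) => /=.
  by rewrite divr_gt0.
move=> w; rewrite -ball_normE /ball_/= => wv; apply: eU.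
rewrite edistC; apply: (le_lt_trans (enorm_le_norm _)).
have : n.+1%:R * `|v - w| < e by rewrite mulrC -ltr_pdivlMr.
apply: le_lt_trans; rewrite ler_wpM2r// ler_nat//.
Qed.

End euclidean_norm.

Section coordinates.
Variable R : realType.

Lemma dist_eq0 (x y : R) : `|x - y| <= 0 -> x = y.
Proof. by rewrite normr_le0 subr_eq0 => /eqP. Qed.

Lemma dist_tri (y x z : R) : `|x - z| <= `|x - y| + `|y - z|.
Proof. exact: ler_distD. Qed.

Lemma vec3E (x y z : R) : ((vec3 x y z 0 0 = x) * (vec3 x y z 0 1 = y) *
  (vec3 x y z 0 2 = z))%type.
Proof. by rewrite !mxE. Qed.

Lemma row2P (u v : 'rV[R]_2) : u 0 0 = v 0 0 -> u 0 1 = v 0 1 -> u = v.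
Proof.
move=> e0 e1; apply/rowP => -[[|[|//]]] i.
  by rewrite (_ : Ordinal i = 0)//; exact: val_inj.
by rewrite (_ : Ordinal i = 1)//; exact: val_inj.
Qed.

Lemma row3P (u v : 'rV[R]_3) : u 0 0 = v 0 0 -> u 0 1 = v 0 1 ->
  u 0 2 = v 0 2 -> u = v.
Proof.
move=> e0 e1 e2; apply/rowP => -[[|[|[|//]]]] i.
- by rewrite (_ : Ordinal i = 0)//; exact: val_inj.
- by rewrite (_ : Ordinal i = 1)//; exact: val_inj.
- by rewrite (_ : Ordinal i = 2)//; exact: val_inj.
Qed.

Lemma sqr_enorm2 (v : 'rV[R]_2) : enorm v ^+ 2 = v 0 0 ^+ 2 + v 0 1 ^+ 2.
Proof.
rewrite sqr_enorm !big_ord_recl big_ord0 addr0.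
by congr (v _ _ ^+ _ + v _ _ ^+ _); exact: val_inj.
Qed.

Lemma sqr_enorm3 (v : 'rV[R]_3) :
  enorm v ^+ 2 = v 0 0 ^+ 2 + v 0 1 ^+ 2 + v 0 2 ^+ 2.
Proof.
rewrite sqr_enorm !big_ord_recl big_ord0 addr0 addrA.
by congr (v _ _ ^+ _ + v _ _ ^+ _ + v _ _ ^+ _); exact: val_inj.
Qed.

Lemma enorm3_le (v : 'rV[R]_3) a : 0 <= a ->
  v 0 0 ^+ 2 + v 0 1 ^+ 2 + v 0 2 ^+ 2 <= a ^+ 2 -> enorm v <= a.
Proof.
by move=> a0; rewrite -sqr_enorm3 ler_pXn2r ?nnegrE ?enorm_ge0.
Qed.

Lemma enorm2_le (v : 'rV[R]_2) a : 0 <= a ->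
  v 0 0 ^+ 2 + v 0 1 ^+ 2 <= a ^+ 2 -> enorm v <= a.
Proof.
by move=> a0; rewrite -sqr_enorm2 ler_pXn2r ?nnegrE ?enorm_ge0.
Qed.

Lemma enorm3_sum (v : 'rV[R]_3) : enorm v <= `|v 0 0| + `|v 0 1| + `|v 0 2|.
Proof.
apply: enorm3_le; first by rewrite !addr_ge0.
rewrite -[v 0 0 ^+ 2]real_normK ?num_real// -[v 0 1 ^+ 2]real_normK ?num_real//.
rewrite -[v 0 2 ^+ 2]real_normK ?num_real//.
have := mulr_ge0 (normr_ge0 (v 0 0)) (normr_ge0 (v 0 1)).
have := mulr_ge0 (normr_ge0 (v 0 0)) (normr_ge0 (v 0 2)).
have := mulr_ge0 (normr_ge0 (v 0 1)) (normr_ge0 (v 0 2)); lra.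
Qed.

End coordinates.

(** * Inverse limits of contractions *)

Section geometric_decay.
Variable R : realType.
Implicit Types b C x e : R.

Lemma geometric_lt b C e : 0 <= b < 1 -> 0 < e -> exists k, C * b ^+ k < e.
Proof.
move=> /andP[b0 b1] e0.
have /cvgrPdist_lt/(_ _ e0) : C * b ^+ k @[k --> \oo] --> (0 : R).
  by apply: cvg_geometric; rewrite ger0_norm.
move=> [k _ /(_ k (leqnn k))] /=; rewrite sub0r normrN => h.
by exists k; rewrite (le_lt_trans (ler_norm _)).
Qed.

Lemma le_geometric_le0 b C x : 0 <= b < 1 -> (forall k, x <= C * b ^+ k) -> x <= 0.
Proof.
move=> b01 xC; rewrite leNgt; apply/negP => x0.
by have [k] := geometric_lt C b01 x0; rewrite ltNge xC.
Qed.

(** Telescoping: the intervals of centre [u k] and radius [C b^k / (1 - b)] are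
    nested, so that the supremum of their left ends lies in all of them. *)
Lemma geometric_limit (u : nat -> R) b C : 0 <= b < 1 ->
  (forall k, `|u k - u k.+1| <= C * b ^+ k) ->
  exists l, forall k, `|u k - l| <= C * b ^+ k / (1 - b).
Proof.
move=> /andP[b0 b1] uC; pose e k := C * b ^+ k / (1 - b).
have eS k : e k - e k.+1 = C * b ^+ k.
  by rewrite /e exprS; field; lra.
have C0 : 0 <= C by have := uC 0; rewrite expr0 mulr1; apply: le_trans.
have e0 k : 0 <= e k by rewrite /e !mulr_ge0 ?exprn_ge0 ?invr_ge0//; lra.
have lo : {homo (fun k => u k - e k) : m n / (m <= n)%N >-> m <= n}.
  apply: homo_leq => [x|x y z|k]; [exact: lexx|exact: le_trans|].
  by have := uC k; have := eS k; rewrite ler_norml; lra.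
have up : {homo (fun k => u k + e k) : m n / (m <= n)%N >-> n <= m}.
  apply: homo_leq => [x|x y z|k]; [exact: lexx|move=> a b'; exact: le_trans b' a|].
  by have := uC k; have := eS k; rewrite ler_norml; lra.
have nest j k : u j - e j <= u k + e k.
  have := lo _ _ (leq_maxl j k); have := up _ _ (leq_maxr j k).
  by have := e0 (maxn j k); lra.
have S0 : range (fun k => u k - e k) !=set0 by exists (u 0 - e 0), 0%N.
exists (sup (range (fun k => u k - e k))) => k.
have : sup (range (fun k => u k - e k)) <= u k + e k.
  by apply: ge_sup => // _ [j _ <-].
have : u k - e k <= sup (range (fun k => u k - e k)).
  apply: ub_le_sup; last by exists k.
  by exists (u 0 + e 0) => _ [j _ <-].
by rewrite -/(e k) ler_norml; lra.
Qed.

End geometric_decay.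

Section nested_contractions.
Variables (R : realType) (X : Type) (d : X -> X -> R) (H : set X).

(** Completeness of [H] for the distance [d], in the only form that the
    construction of orbits below uses; the factor [K] leaves room for the
    comparison of equivalent norms. *)
Definition geometrically_complete (K : R) := forall (u : nat -> X) b C,
  0 <= b < 1 -> (forall k, H (u k)) ->
  (forall k, d (u k) (u k.+1) <= C * b ^+ k) ->
  exists2 l, H l & forall k, d (u k) l <= K * (C * b ^+ k / (1 - b)).

Hypothesis d_eq0 : forall x y, d x y <= 0 -> x = y.
Hypothesis d_sym : forall x y, d x y = d y x.
Hypothesis d_tri : forall y x z, d x z <= d x y + d y z.

Variables (K b : R) (T : nat -> X -> X).
Hypothesis b01 : 0 <= b < 1.
Hypothesis TH : forall k x, H x -> H (T k x).
Hypothesis Tb : forall k x y, H x -> H y -> d (T k x) (T k y) <= b * d x y.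

Let b0 : 0 <= b. Proof. by case/andP: b01. Qed.

Fixpoint pullback j k x := if k is k'.+1 then T j (pullback j.+1 k' x) else x.

Lemma pullbackSr j k x : pullback j k.+1 x = pullback j k (T (j + k)%N x).
Proof.
elim: k j => [|k IH] j; first by rewrite addn0.
by rewrite [LHS]/= -[T j.+1 _]/(pullback j.+1 k.+1 x) IH addSnnS.
Qed.

Lemma pullbackH j k x : H x -> H (pullback j k x).
Proof. by elim: k j => // k IH j Hx; apply: TH; exact: IH. Qed.

Lemma pullback_contract j k x y : H x -> H y ->
  d (pullback j k x) (pullback j k y) <= b ^+ k * d x y.
Proof.
move=> Hx Hy; elim: k j => [|k IH] j; first by rewrite expr0 mul1r.
apply: (le_trans (Tb _ _ _)); [exact: pullbackH..|].
by rewrite exprS -mulrA ler_wpM2l.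
Qed.

(** Shadowing: pulling the pseudo-orbit [z] back along the contractions yields
    Cauchy sequences, whose limits form a genuine orbit. *)
Lemma shadowing (z : nat -> X) C : geometrically_complete K ->
  (forall k, H (z k)) -> (forall k, d (z k) (T k (z k.+1)) <= C) ->
  exists w : nat -> X, forall k,
    [/\ H (w k), w k = T k (w k.+1) & d (z k) (w k) <= K * (C / (1 - b))].
Proof.
move=> complH Hz zC.
pose u j k := pullback j k (z (j + k)%N).
have Hu j k : H (u j k) by exact: pullbackH.
have uC j k : d (u j k) (u j k.+1) <= C * b ^+ k.
  rewrite /u pullbackSr addnS mulrC.
  apply: (le_trans (pullback_contract _ _ _ _)) => //; first exact: TH.
  by rewrite ler_wpM2l ?exprn_ge0.
have lim j : exists l, H l /\ forall k, d (u j k) l <= K * (C * b ^+ k / (1 - b)).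
  by have [l Hl ul] := complH _ _ _ b01 (Hu j) (uC j); exists l.
have {lim}[w Hw] := choice lim.
exists w => j; have [Hj wj] := Hw j; have [Hj1 wj1] := Hw j.+1; split => //.
- apply: d_eq0; apply: (@le_geometric_le0 _ b (2 * b * (K * (C / (1 - b))))) => //.
  move=> k; apply: (le_trans (d_tri (u j k.+1) _ _)).
  have -> : u j k.+1 = T j (u j.+1 k) by rewrite /u/= addnS addSn.
  have h1 := wj k.+1; rewrite (_ : u j k.+1 = T j (u j.+1 k)) in h1; last first.
    by rewrite /u/= addnS addSn.
  have h2 := Tb j (Hu j.+1 k) Hj1.
  have h3 : b * d (u j.+1 k) (w j.+1) <= b * (K * (C * b ^+ k / (1 - b))).
    by rewrite ler_wpM2l// wj1.
  rewrite d_sym; apply: (le_trans (lerD h1 (le_trans h2 h3))).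
  by rewrite exprS le_eqVlt; apply/orP; left; apply/eqP; ring.
- by have := wj 0; rewrite /u/= addn0 expr0 mulr1.
Qed.

Lemma orbits_close (w w' : nat -> X) k :
  (forall j, H (w j)) -> (forall j, H (w' j)) ->
  (forall j, (j < k)%N -> w j = T j (w j.+1)) ->
  (forall j, (j < k)%N -> w' j = T j (w' j.+1)) ->
  d (w 0) (w' 0) <= b ^+ k * d (w k) (w' k).
Proof.
move=> Hw Hw'; elim: k => [|k IH] wT w'T; first by rewrite expr0 mul1r.
apply: (le_trans (IH _ _)) => [j jk|j jk|]; [exact/wT/ltnW|exact/w'T/ltnW|].
rewrite exprSr -mulrA ler_wpM2l ?exprn_ge0//.
by rewrite [X in d X _]wT// [X in d _ X]w'T// Tb.
Qed.

(** The bounded distance of the orbits at time [k] is contracted [k] times. *)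
Lemma orbits_eq (w w' : nat -> X) D :
  (forall j, H (w j)) -> (forall j, H (w' j)) ->
  (forall j, w j = T j (w j.+1)) -> (forall j, w' j = T j (w' j.+1)) ->
  (forall j, d (w j) (w' j) <= D) -> w 0 = w' 0.
Proof.
move=> Hw Hw' wT w'T wD; apply: d_eq0; apply: (@le_geometric_le0 _ b D) => // k.
apply: (le_trans (@orbits_close w w' k _ _ _ _)) => //.
by rewrite mulrC ler_wpM2r// exprn_ge0.
Qed.

End nested_contractions.

Section complete_instances.
Variable R : realType.

Lemma complete_ge (M : R) :
  geometrically_complete (fun x y : R => `|x - y|) [set x | M <= x] 1.
Proof.
move=> u b C b01 Hu uC; have [l ul] := geometric_limit b01 uC.
exists l => [/=|k]; last by rewrite mul1r.
rewrite -subr_le0; apply: (@le_geometric_le0 _ b (C / (1 - b))) => // k.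
have := ul k; have := Hu k; rewrite /= ler_norml => ? /andP[? ?].
rewrite mulrAC; lra.
Qed.

Lemma complete_R : geometrically_complete (fun x y : R => `|x - y|) setT 1.
Proof.
move=> u b C b01 Hu uC; have [l ul] := geometric_limit b01 uC.
by exists l => // k; rewrite mul1r.
Qed.

Lemma complete_half_space (M : R) :
  geometrically_complete (fun x y : 'rV[R]_3 => enorm (x - y))
    [set x | M <= x 0 2] 3.
Proof.
move=> u b C b01 Hu uC.
have cC i k : `|u k 0 i - u k.+1 0 i| <= C * b ^+ k.
  by apply: le_trans (uC k); have := coord_le_enorm (u k - u k.+1) i; rewrite !mxE.
have [l ul] := choice (fun i => geometric_limit b01 (cC i)).
exists (\row_i l i) => [/=|k].
  have [l2 Ml2 ul2] := complete_ge b01 Hu (cC 2).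
  suff -> : (\row_i l i) 0 2 = l2 by [].
  rewrite mxE; apply/eqP; rewrite -subr_eq0 -normr_le0.
  apply: (@le_geometric_le0 _ b (2 * (C / (1 - b)))) => // k.
  have -> : 2 * (C / (1 - b)) * b ^+ k =
    C * b ^+ k / (1 - b) + C * b ^+ k / (1 - b) by ring.
  apply: (le_trans (ler_distD (u k 0 2) _ _)).
  by apply: lerD; [rewrite distrC; exact: ul | have := ul2 k; rewrite mul1r].
apply: (le_trans (enorm_le_norm _)); rewrite ler_wpM2l//.
rewrite /Num.norm/= mx_normrE; apply: bigmax_le => [|[i j] _ /=].
  by apply: le_trans (ul 0 k).
by rewrite ord1 !mxE.
Qed.

End complete_instances.

(** * Irrational numbers and sequences of integers *)

Section irrational_coding.
Variable R : realType.
Implicit Types a x y : R.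

Lemma rational_add a b : @rational R a -> rational b -> rational (a + b).
Proof. by move=> [p _ <-] [q _ <-]; exists (p + q) => //; rewrite rmorphD. Qed.

Lemma rational_opp a : @rational R a -> rational (- a).
Proof. by move=> [p _ <-]; exists (- p) => //; rewrite rmorphN. Qed.

Lemma rational_inv a : @rational R a -> rational a^-1.
Proof. by move=> [p _ <-]; exists p^-1 => //; rewrite fmorphV. Qed.

Lemma rational_int (z : int) : @rational R z%:~R.
Proof. by exists z%:~R => //; rewrite ratr_int. Qed.

(** [eta] maps the real line increasingly onto the open unit interval, and
    [theta] is its inverse.  Both preserve rationality, being piecewise
    fractional linear with integral coefficients, and [eta] is a contraction.
    Iterating [gauss] therefore expands an irrational number into a sequence of
    integers, like a continued fraction; but as [eta] is increasing and onto,
    the expansion respects the lexicographic order and every sequence occurs. *)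
Definition eta y := if 0 <= y then 1 - (y + 2)^-1 else (2 - y)^-1.

Definition theta x :=
  2 - (Num.min x 2^-1)^-1 + ((1 - Num.max x 2^-1)^-1 - 2).

Definition gauss a := theta (a - (Num.floor a)%:~R).

Definition code a k : int := Num.floor (iter k gauss a).

Lemma eta_itv y : 0 < eta y < 1.
Proof.
rewrite /eta; have [y0|y0] := leP 0 y.
  have i0 : 0 < (y + 2)^-1 by rewrite invr_gt0; lra.
  have i1 : (y + 2)^-1 < 1 by rewrite invf_lt1; lra.
  by apply/andP; split; lra.
by rewrite invr_gt0 invf_lt1; lra.
Qed.

Lemma theta_le x : x <= 2^-1 -> theta x = 2 - x^-1.
Proof.
move=> x2; rewrite /theta (min_l x2) (max_r x2) (_ : 1 - 2^-1 = 2^-1) ?invrK; lra.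
Qed.

Lemma theta_ge x : 2^-1 <= x -> theta x = (1 - x)^-1 - 2.
Proof. by move=> x2; rewrite /theta (min_r x2) (max_l x2) invrK; lra. Qed.

Lemma etaK y : theta (eta y) = y.
Proof.
rewrite /eta; have [y0|y0] := leP 0 y.
  rewrite theta_ge; first by rewrite subKr invrK addrK.
  have : (y + 2)^-1 <= 2^-1 by rewrite lef_pV2 ?posrE; lra.
  lra.
rewrite theta_le ?invrK; first by lra.
by rewrite lef_pV2 ?posrE; lra.
Qed.

Lemma thetaK x : 0 < x < 1 -> eta (theta x) = x.
Proof.
move=> /andP[x0 x1]; have [x2|x2] := leP x 2^-1.
  rewrite theta_le// /eta.
  have : 2 <= x^-1 by rewrite -(invrK 2) lef_pV2 ?posrE; lra.
  rewrite le_eqVlt => /orP[/eqP x3|x3].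
    by rewrite -x3 subrr lexx add0r -[RHS]invrK -x3; lra.
  by rewrite ifF ?subKr ?invrK// leNgt subr_lt0 x3.
rewrite theta_ge; last exact: ltW.
have : 2 < (1 - x)^-1 by rewrite -(invrK 2) ltf_pV2 ?posrE; lra.
move=> x3; rewrite /eta ifT ?subr_ge0 ?(ltW x3)// subrK invrK; lra.
Qed.

Lemma eta_diff x y : x <= y -> 0 <= eta y - eta x <= 4^-1 * (y - x).
Proof.
have pos (u v : R) : 0 <= u -> u <= v ->
    0 <= (u + 2)^-1 - (v + 2)^-1 <= 4^-1 * (v - u).
  move=> u0 uv.
  have -> : (u + 2)^-1 - (v + 2)^-1 = (v - u) / ((u + 2) * (v + 2)).
    by field; apply/andP; split; apply/eqP; lra.
  apply/andP; split; first by rewrite divr_ge0 ?mulr_ge0//; lra.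
  rewrite mulrC ler_wpM2r//; first by lra.
  by rewrite lef_pV2 ?posrE ?mulr_gt0//; nra.
rewrite /eta => xy; have [y0|y0] := leP 0 y; have [x0|x0] := leP 0 x.
- by have := pos _ _ x0 xy; lra.
- have x0' : 0 <= - x by lra.
  have := pos _ _ (lexx 0) x0'; have := pos _ _ (lexx 0) y0.
  by rewrite add0r (addrC (- x)) => /andP[? ?] /andP[? ?]; apply/andP; split; lra.
- by lra.
- have y0' : 0 <= - y by lra.
  have yx : - y <= - x by lra.
  by have := pos _ _ y0' yx; rewrite !(addrC _ 2) opprK (addrC (- x)).
Qed.

Lemma eta_contract x y : `|eta x - eta y| <= 4^-1 * `|x - y|.
Proof.
wlog xy : x y / x <= y.
  move=> h; have [/h//|/ltW/h] := leP x y.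
  by rewrite distrC (distrC y).
have /andP[e0 e1] := eta_diff xy.
by rewrite distrC ger0_norm// distrC ger0_norm ?subr_ge0.
Qed.

Lemma eta_lt x y : x < y -> eta x < eta y.
Proof.
move=> xy; have /andP[e0 e1] := eta_diff (ltW xy).
rewrite lt_neqAle -subr_ge0 e0 andbT; apply/eqP => e.
by have := etaK x; rewrite e etaK; lra.
Qed.

Lemma eta_le x y : x <= y -> eta x <= eta y.
Proof. by move=> /eta_diff/andP[]; rewrite subr_ge0. Qed.

Definition integral a := exists z : int, a = z%:~R.

Lemma frac_itv a : ~ integral a -> 0 < a - (Num.floor a)%:~R < 1.
Proof.
move=> ai; have /andP[h1 h2] := real_floor_itv (num_real a).
move: h2; rewrite intrD => h2.
apply/andP; split; last by lra.
by rewrite subr_gt0 lt_neqAle h1 andbT; apply/eqP => e; apply: ai; eexists; exact/esym/e.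
Qed.

Lemma irrational_nonintegral a : irrational a -> ~ integral a.
Proof. by move=> ai [z az]; apply: ai; rewrite az; exact: rational_int. Qed.

Lemma gaussE a : ~ integral a -> a = (Num.floor a)%:~R + eta (gauss a).
Proof. by move=> ai; rewrite thetaK ?frac_itv// addrC subrK. Qed.

Lemma rational_eta y : rational y -> rational (eta y).
Proof.
have r2 : @rational R 2 by exact: (rational_int 2).
move=> ry; rewrite /eta; case: ifP => _.
  apply: rational_add; first exact: (rational_int 1).
  by apply/rational_opp/rational_inv/rational_add.
by apply/rational_inv/rational_add => //; exact: rational_opp.
Qed.

Lemma irrational_gauss a : irrational a -> irrational (gauss a).
Proof.
move=> ai /rational_eta rg; apply: (ai); rewrite (gaussE (irrational_nonintegral ai)).
by apply: rational_add => //; exact: rational_int.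
Qed.

Lemma irrational_iter_gauss a k : irrational a -> irrational (iter k gauss a).
Proof. by move=> ai; elim: k => //= k; exact: irrational_gauss. Qed.

Lemma iter_gaussE a k : irrational a ->
  iter k gauss a = (code a k)%:~R + eta (iter k.+1 gauss a).
Proof.
by move=> /(@irrational_iter_gauss _ k)/irrational_nonintegral; exact: gaussE.
Qed.

Lemma code_gauss a k : code (gauss a) k = code a k.+1.
Proof. by rewrite /code iterSr. Qed.

(** On a rational number [gauss] lowers the denominator, so that the expansion
    of a rational number reaches an integer. *)
Lemma rational_iter_gauss_integral a :
  rational a -> exists k, integral (iter k gauss a).
Proof.
suff H d : forall m : int, exists k, integral (iter k gauss (m%:~R / d.+1%:R)).
  move=> [q _ <-].
  have : (0 < denq q)%R by exact: denq_gt0.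
  case dq : (denq q) => [[//|d]|//] _.
  have [k] := H d (numq q); rewrite -[in X in X -> _](ratr_int R).
  have -> : d.+1%:R = ratr (denq q)%:~R :> R by rewrite dq ratr_int.
  by rewrite -fmorph_div/= divq_num_den => ?; exists k.
elim/ltn_ind: d => d IH m.
set x : R := m%:~R / d.+1%:R.
have [i|/frac_itv] := pselect (integral x); first by exists 0%N.
set n := Num.floor x => xn.
pose r := m - n * d.+1%:Z.
have d0 : 0 < d.+1%:R :> R by rewrite ltr0n.
have xE : x - n%:~R = r%:~R / d.+1%:R.
  by rewrite intrB intrM /x mulrBl mulfK// gt_eqF.
have step y : gauss x = y -> (exists k, integral (iter k gauss y)) ->
    exists k, integral (iter k gauss x).
  by move=> <- [k ki]; exists k.+1; rewrite iterSr.
move: xn; rewrite xE => /andP[].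
rewrite pmulr_lgt0 ?invr_gt0// ltr_pdivrMr// mul1r.
rewrite ltr0z -[d.+1%:R]/(d.+1%:Z%:~R) ltr_int => r0 rd.
have [r2|r2] := leP (r%:~R / d.+1%:R) (2^-1 : R).
  case rE : r r0 rd r2 xE => [[//|k]|//] _ kd k2 xE.
  apply: (@step ((2 * k.+1%:Z - d.+1%:Z)%:~R / k.+1%:R)); last by apply: IH.
  rewrite /gauss -/n xE theta_le// intrB intrM invf_div.
  by field; rewrite -?(rwP andP) ?intr_eq0 ?pnatr_eq0.
have [k kE] : exists k : nat, d.+1%:Z - r = k.+1%:Z.
  by exists (absz (d%:Z - r)); lia.
apply: (@step ((d.+1%:Z - 2 * k.+1%:Z)%:~R / k.+1%:R)); last by apply: IH; lia.
rewrite /gauss -/n xE theta_ge; last exact: ltW.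
have -> : 1 - r%:~R / d.+1%:R = k.+1%:R / d.+1%:R :> R.
  rewrite -[k.+1%:R]/(k.+1%:Z%:~R) -kE intrB mulrBl divff// gt_eqF//.
rewrite intrB intrM invf_div.
by field; rewrite -?(rwP andP) ?intr_eq0 ?pnatr_eq0.
Qed.

Lemma nonintegral_irrational a :
  (forall k, ~ integral (iter k gauss a)) -> irrational a.
Proof. by move=> an /rational_iter_gauss_integral[k /an]. Qed.

Let quarter : 0 <= (4^-1 : R) < 1.
Proof. by rewrite invr_ge0 ler0n/= invf_lt1; lra. Qed.

Let digit_map (s : nat -> int) k (y : R) := (s k)%:~R + eta y.

Let digit_map_contract s k (x y : R) : [set: R] x -> [set: R] y ->
  `|digit_map s k x - digit_map s k y| <= 4^-1 * `|x - y|.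
Proof.
by move=> _ _; rewrite /digit_map (addrC _ (eta x)) addrKA; exact: eta_contract.
Qed.

(** The integers [s k] are a pseudo-orbit of the contractions [y |-> s k + eta y].
    In the orbit that shadows it, no point is an integer, because [eta] takes no
    value at the ends of the unit interval. *)
Lemma decode (s : nat -> int) : exists2 a, irrational a & code a =1 s.
Proof.
have [|w Hw] := @shadowing R R (fun x y => `|x - y|) setT (@dist_eq0 R) (@distrC _ _)
  (@dist_tri R) 1 4^-1 (digit_map s) quarter (fun _ _ => id) (@digit_map_contract s)
  (fun k => (s k)%:~R) 1 (@complete_R R) (fun _ => I).
  move=> k; rewrite /digit_map opprD addNKr normrN.
  by have /andP[? ?] := eta_itv (s k.+1)%:~R; rewrite gtr0_norm// ltW.
have wE k : w k = (s k)%:~R + eta (w k.+1) by have [] := Hw k.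
have floor_w k : Num.floor (w k) = s k.
  apply: floor_def; rewrite intrD wE; have /andP[? ?] := eta_itv (w k.+1).
  by apply/andP; split; lra.
have iter_w k : iter k gauss (w 0) = w k.
  elim: k => //= k ->; rewrite /gauss floor_w [w k]wE addrC addKr; exact: etaK.
exists (w 0) => [|k]; last by rewrite /code iter_w floor_w.
apply: nonintegral_irrational => k [z]; rewrite iter_w => wz.
have := floor_w k; rewrite wz intrKfloor => zs.
by have := wE k; have /andP[? ?] := eta_itv (w k.+1); rewrite wz zs; lra.
Qed.

Lemma code_close a a' k : irrational a -> irrational a' ->
  (forall j, (j < k)%N -> code a j = code a' j) ->
  `|a - a'| <= 4^-1 ^+ k * `|iter k gauss a - iter k gauss a'|.
Proof.
move=> ai ai' aa'.
apply: (@orbits_close R R (fun x y => `|x - y|) setT 4^-1 (digit_map (code a))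
  quarter (@digit_map_contract _) (fun k => iter k gauss a)
  (fun k => iter k gauss a')) => // j jk.
- exact: iter_gaussE.
- by rewrite /digit_map (aa' _ jk) -iter_gaussE.
Qed.

Lemma same_floor_dist x y : Num.floor x = Num.floor y -> `|x - y| <= 1.
Proof.
have := real_floor_itv (num_real x); have := real_floor_itv (num_real y).
move=> /andP[h1 h2] /andP[h3 h4] e; move: h1 h2 h3 h4; rewrite e !intrD.
by move=> *; rewrite ler_norml; apply/andP; split; lra.
Qed.

Lemma code_close1 a a' k : irrational a -> irrational a' ->
  (forall j, (j <= k)%N -> code a j = code a' j) -> `|a - a'| <= 4^-1 ^+ k.
Proof.
move=> ai ai' aa'; apply: (le_trans (code_close (k := k) ai ai' _)) => [j jk|].
  exact/aa'/ltnW.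
rewrite -[leRHS]mulr1 ler_wpM2l ?exprn_ge0 ?invr_ge0//.
by apply: same_floor_dist; exact: aa'.
Qed.

Lemma code_inj a a' : irrational a -> irrational a' -> code a =1 code a' -> a = a'.
Proof.
move=> ai ai' aa'; apply: dist_eq0; apply: (@le_geometric_le0 _ 4^-1 1) => // k.
by rewrite mul1r; exact: code_close1.
Qed.

Lemma code_lt a a' k : irrational a -> irrational a' ->
  (forall j, (j < k)%N -> code a j = code a' j) -> code a k < code a' k -> a < a'.
Proof.
elim: k a a' => [|k IH] a a' ai ai' aa' lt.
  have := real_floor_itv (num_real a); have := real_floor_itv (num_real a').
  move: lt; rewrite /code/= => lt /andP[h _] /andP[_ h'].
  by apply: (lt_le_trans h'); apply: le_trans h; rewrite ler_int; lia.
rewrite (gaussE (irrational_nonintegral ai)) (gaussE (irrational_nonintegral ai')).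
rewrite -/(code a 0) -/(code a' 0) aa'// ltrD2l; apply: eta_lt.
apply: IH; rewrite ?code_gauss//; try exact: irrational_gauss.
by move=> j jk; rewrite !code_gauss aa'.
Qed.

Lemma floor_near a : ~ integral a -> exists2 e : R, 0 < e &
  forall a', `|a' - a| < e -> Num.floor a' = Num.floor a.
Proof.
move=> /frac_itv/andP[h0 h1]; set n := Num.floor a in h0 h1 *.
exists (Num.min (a - n%:~R) (1 - (a - n%:~R))).
  by rewrite lt_min; apply/andP; split; lra.
move=> a'; rewrite lt_min ltr_norml ltr_norml => /andP[/andP[? ?] /andP[? ?]].
by apply: floor_def; rewrite intrD; apply/andP; split; lra.
Qed.

Lemma continuous_theta x : 0 < x < 1 -> {for x, continuous theta}.
Proof.
move=> /andP[x0 x1]; rewrite /theta.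
have h0 : Num.min x 2^-1 != 0 by rewrite gt_eqF// lt_min x0 invr_gt0/= ltr0n.
have h1 : 1 - Num.max x 2^-1 != 0.
  by rewrite gt_eqF// subr_gt0 gt_max x1 invf_lt1; lra.
apply: (@continuousD _ R^o _ (fun x => 2 - (Num.min x 2^-1)^-1)
                         (fun x => (1 - Num.max x 2^-1)^-1 - 2)).
  apply: continuousB; first exact: cst_continuous.
  apply: continuousV => //; apply: continuous_min; [exact: cvg_id|exact: cst_continuous].
apply: continuousB; last exact: cst_continuous.
apply: continuousV => //; apply: continuousB; first exact: cst_continuous.
by apply: continuous_max; [exact: cvg_id|exact: cst_continuous].
Qed.

Lemma gauss_near a e : ~ integral a -> 0 < e -> exists2 d : R, 0 < d &
  forall a', `|a' - a| < d -> `|gauss a' - gauss a| < e.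
Proof.
move=> ai e0; have [d0 d0P fl] := floor_near ai.
have /cvgrPdist_lt/(_ _ e0)/nbhs_ballP[d1 /= d1P th] := continuous_theta (frac_itv ai).
exists (Num.min d0 d1); first by rewrite lt_min d0P.
move=> a'; rewrite lt_min => /andP[/fl fa ad].
rewrite distrC; rewrite /gauss fa; apply: th => /=.
by rewrite /ball/= opprB addrA subrK distrC.
Qed.

(** Off the integers the integral part is locally constant and [gauss] is
    continuous, and the iterates of [gauss] at an irrational number are off the
    integers. *)
Lemma code_near a k : irrational a -> exists2 e : R, 0 < e &
  forall a', `|a' - a| < e -> forall j, (j < k)%N -> code a' j = code a j.
Proof.
elim: k a => [|k IH] a ai; first by exists 1.
have [e0 e0P fl] := floor_near (irrational_nonintegral ai).
have [e1 e1P cd] := IH _ (irrational_gauss ai).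
have [e2 e2P gn] := gauss_near (irrational_nonintegral ai) e1P.
exists (Num.min e0 e2); first by rewrite lt_min e0P.
move=> a'; rewrite lt_min => /andP[/fl fa /gn/cd ga] [_|j]; first exact: fa.
by rewrite ltnS -!code_gauss; exact: ga.
Qed.

(** Next to an integer the second digit is large in absolute value, since [theta]
    is unbounded at both ends of the unit interval. *)
Lemma bounded_code_nonintegral (N : R) a :
  (forall e, 0 < e -> exists a', [/\ irrational a', `|a' - a| < e &
     `|(code a' 1)%:~R| <= N]) -> ~ integral a.
Proof.
move=> aN [z az].
have /andP[l0 l1] := eta_itv (- N); have /andP[u0 u1] := eta_itv (N + 1).
have [|a' [ai']] := aN (Num.min (eta (- N)) (1 - eta (N + 1))).
  by rewrite lt_min l0 subr_gt0.
rewrite lt_min az => /andP[d1 d2]; rewrite ler_norml => /andP[c1 c2].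
have := gaussE (irrational_nonintegral ai'); set f := Num.floor a' => a'E.
have := real_floor_itv (num_real (gauss a')); rewrite -/(code (gauss a') 0).
rewrite code_gauss intrD => /andP[g1 g2].
have e1 : eta (- N) <= eta (gauss a') by apply: eta_le; lra.
have e2 : eta (gauss a') <= eta (N + 1) by apply: eta_le; lra.
move: d1 d2; rewrite a'E !ltr_norml => /andP[? ?] /andP[? ?].
have : z%:~R < (f + 1)%:~R :> R by rewrite intrD; lra.
rewrite ltr_int ltzD1 leNgt => /negP; apply.
by rewrite -(ltr_int R); lra.
Qed.

(** Bounds on the digits keep the limit off the integers, and they are inherited by
    its image under the continuous map [gauss].  Along a convergent
    sequence, only digits after the first can be unbounded. *)
Lemma bounded_code_irrational (N : nat -> R) a :
  (forall e, 0 < e -> exists a', [/\ irrational a', `|a' - a| < e &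
     forall k, `|(code a' k.+1)%:~R| <= N k]) -> irrational a.
Proof.
move=> aN; apply: nonintegral_irrational => k.
elim: k a N aN => [|k IH] a N aN.
  apply: (@bounded_code_nonintegral (N 0)) => e /aN[a' [ai' ae aN']].
  by exists a'; split.
have an : ~ integral a.
  apply: (@bounded_code_nonintegral (N 0)) => e /aN[a' [ai' ae aN']].
  by exists a'; split.
rewrite iterSr; apply: (IH _ (fun k => N k.+1)) => e e0.
have [d d0 gd] := gauss_near an e0.
have [a' [ai' ad aN']] := aN _ d0; exists (gauss a').
by split=> [||j]; [exact: irrational_gauss|exact: gd|rewrite code_gauss].
Qed.

End irrational_coding.

(** * A bi-Lipschitz chart maps the boundary of the square to the equator *)

Section sperner_grid.
Variables (A C : nat -> nat -> bool) (N : nat).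
Hypothesis AC : forall i j, ~~ (A i j && C i j).

Let edge i j i' j' := (A i j && C i' j') (+) (C i j && A i' j').

Let corner (P : nat -> nat -> bool) i j :=
  [|| P i j, P i.+1 j, P i j.+1 | P i.+1 j.+1].

Definition rainbow i j :=
  [&& corner A i j, corner C i j & corner (fun i j => ~~ (A i j || C i j)) i j].

(** If every corner of a square is labelled [A] or [C], the label changes an even
    number of times on a tour of the square; if [A] or [C] does not occur, there is
    no edge between them. *)
Lemma edge_square i j : ~~ rainbow i j ->
  edge i j i j.+1 (+) edge i.+1 j i.+1 j.+1 =
  edge i j i.+1 j (+) edge i j.+1 i.+1 j.+1.
Proof.
have := AC i j; have := AC i.+1 j; have := AC i j.+1; have := AC i.+1 j.+1.
rewrite /rainbow /corner /edge.
by case: (A i j); case: (C i j); case: (A i.+1 j); case: (C i.+1 j);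
  case: (A i j.+1); case: (C i j.+1); case: (A i.+1 j.+1); case: (C i.+1 j.+1).
Qed.

Fixpoint column_parity i n :=
  if n is n'.+1 then column_parity i n' (+) edge i n' i n else false.

(** Summing the previous identity over the columns of the grid, the parity of the
    number of vertical [A]-[C] edges is the same on the left, where there is
    none, and on the right, where it is odd. *)
Lemma sperner_grid :
  (forall j, (j <= N)%N -> ~~ A 0 j && ~~ C 0 j) ->
  (forall j, (j <= N)%N -> A N j || C N j) -> C N 0 -> A N N ->
  (forall i, (i <= N)%N -> ~~ A i 0) -> (forall i, (i <= N)%N -> ~~ C i N) ->
  exists i j, [/\ (i < N)%N, (j < N)%N & rainbow i j].
Proof.
move=> left right cN aN bottom top; apply: contrapT => none.
have square i j : (i < N)%N -> (j < N)%N ->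
    edge i j i j.+1 (+) edge i.+1 j i.+1 j.+1 =
    edge i j i.+1 j (+) edge i j.+1 i.+1 j.+1.
  move=> iN jN; apply: edge_square; apply/negP => ij.
  by apply: none; exists i, j; split.
have VS i n : (i < N)%N -> (n <= N)%N ->
    column_parity i n (+) column_parity i.+1 n =
    edge i 0 i.+1 0 (+) edge i n i.+1 n.
  move=> iN; elim: n => [_|n IH nN]; first by rewrite !addbb.
  rewrite [LHS]/= addbACA (IH (ltnW nN)) square// addbA.
  by rewrite -[X in X (+) _]addbA addbb addbF.
have V0 i : (i <= N)%N -> column_parity i N = false.
  elim: i => [_|i IH iN].
    suff : forall n, (n <= N)%N -> column_parity 0 n = false by exact.
    elim=> //= n IH nN; rewrite (IH (ltnW nN))/= /edge.
    by have /andP[/negbTE-> /negbTE->] := left _ (ltnW nN).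
  have := VS i N iN (leqnn _); rewrite (IH (ltnW iN))/= => ->.
  rewrite /edge (negbTE (bottom _ iN)) (negbTE (bottom _ (ltnW iN))).
  by rewrite (negbTE (top _ iN)) (negbTE (top _ (ltnW iN))) !andbF.
have VN n : (n <= N)%N -> column_parity N n = A N n.
  elim: n => [_|n IH nN]; first by rewrite (negbTE (bottom _ (leqnn _))).
  rewrite /= (IH (ltnW nN)) /edge.
  have := right _ (ltnW nN); have := right _ nN; have := AC N n; have := AC N n.+1.
  by case: (A N n); case: (C N n); case: (A N n.+1); case: (C N n.+1).
by have := V0 N (leqnn _); rewrite VN// aN.
Qed.

End sperner_grid.

Section poincare_miranda.
Variables (R : realType) (F1 F2 : R -> R -> R) (K : R).

Let sq (x : R) := -1 <= x <= 1.

Definition lipschitz_on_square (F : R -> R -> R) := forall x y x' y',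
  sq x -> sq y -> sq x' -> sq y' ->
  `|F x y - F x' y'| <= K * (`|x - x'| + `|y - y'|).

Hypotheses (lip1 : lipschitz_on_square F1) (lip2 : lipschitz_on_square F2).
Hypothesis left : forall y, sq y -> F1 (-1) y < 0.
Hypothesis right : forall y, sq y -> 0 < F1 1 y.
Hypothesis bottom : forall x, sq x -> F2 x (-1) < 0.
Hypothesis top : forall x, sq x -> 0 < F2 x 1.

(** The Poincare-Miranda theorem.  Label the points of a fine grid by the signs
    of the two functions: a square carrying all three labels has a corner where
    both functions are non-negative, next to one where the first is negative and
    to one where the second is negative. *)
Lemma poincare_miranda e : 0 < e ->
  exists x y, [/\ sq x, sq y, `|F1 x y| <= e & `|F2 x y| <= e].
Proof.
move=> e0.
have K0 : 0 <= K.
  have : 0 <= K * (`|-1 - 1| + `|-1 - 1|).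
    by apply: le_trans (@lip1 (-1) (-1) 1 1 _ _ _ _) => //; rewrite /sq; lra.
  by rewrite (_ : `|-1 - 1| = 2 :> R); [lra|rewrite ler0_norm; lra].
pose N := (Num.truncn (4 * K / e)).+1.
have N0 : 0 < N%:R :> R by rewrite ltr0n.
have NK : K * (2 / N%:R + 2 / N%:R) <= e.
  have : 4 * K / e < N%:R by exact: truncnS_gt.
  rewrite ltr_pdivrMr// => h.
  have -> : K * (2 / N%:R + 2 / N%:R) = 4 * K / N%:R by field; rewrite gt_eqF.
  by rewrite ler_pdivrMr// mulrC; lra.
pose g i : R := -1 + i%:R * (2 / N%:R).
have g0 : g 0 = -1 by rewrite /g mul0r addr0.
have gN : g N = 1 by rewrite /g mulrC divfK ?gt_eqF//; lra.
have gS i : g i.+1 = g i + 2 / N%:R by rewrite /g -natr1; ring.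
have st0 : 0 < 2 / N%:R :> R by rewrite divr_gt0.
have gsq i : (i <= N)%N -> sq (g i).
  move=> iN; have := gN; rewrite /sq /g.
  have : i%:R * (2 / N%:R) <= N%:R * (2 / N%:R) :> R.
    by rewrite ler_wpM2r ?ler_nat// ltW.
  have : 0 <= i%:R * (2 / N%:R) :> R by rewrite mulr_ge0// ltW.
  by move=> *; apply/andP; split; lra.
pose B i j := F1 (g i) (g j) < 0.
pose C i j := ~~ B i j && (F2 (g i) (g j) < 0).
pose A i j := ~~ B i j && ~~ C i j.
have sq1 : sq 1 by apply/andP; split; lra.
have sqN1 : sq (-1) by apply/andP; split; lra.
have [| | | | | | |i [j [iN jN /and3P[]]]] := @sperner_grid A C N.
- by move=> i j; rewrite /A; case: (C i j); rewrite ?andbF.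
- move=> j jN; have b0 : B 0 j by rewrite /B g0; exact/left/gsq.
  by rewrite /A /C b0.
- move=> j jN; rewrite /A /B gN -leNgt (ltW (right (gsq _ jN))) /=.
  by case: (C _ _).
- by rewrite /C /B gN g0 -leNgt (ltW (right sqN1)) bottom.
- have bN : B N N = false by rewrite /B gN ltNge (ltW (right sq1)).
  by rewrite /A /C bN gN ltNge (ltW (top sq1)).
- move=> i iN; rewrite /A /C g0 (bottom (gsq _ iN)) andbT.
  by case: (B i 0).
- by move=> i iN; rewrite /C gN negb_and -!leNgt (ltW (top (gsq _ iN))) orbT.
have near P : [|| P i j, P i.+1 j, P i j.+1 | P i.+1 j.+1] -> exists i' j',
    [/\ P i' j', sq (g i'), sq (g j') & (g i <= g i' <= g i + 2 / N%:R) /\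
      (g j <= g j' <= g j + 2 / N%:R)].
  have [si si1] := (gsq _ (ltnW iN), gsq _ iN).
  have [sj sj1] := (gsq _ (ltnW jN), gsq _ jN).
  by case/or4P => Pij; [exists i, j|exists i.+1, j|exists i, j.+1|exists i.+1, j.+1];
    split => //; rewrite ?gS; lra.
move=> rA rC rB.
have [ia [ja [PA sia sja [dia dja]]]] := near A rA.
have [ic [jc [PC sic sjc [dic djc]]]] := near C rC.
have [ib [jb [PB sib sjb [dib djb]]]] := near (fun i j => ~~ (A i j || C i j)) rB.
have close (F : R -> R -> R) i' j' : lipschitz_on_square F -> sq (g i') -> sq (g j') ->
    g i <= g i' <= g i + 2 / N%:R -> g j <= g j' <= g j + 2 / N%:R ->
    `|F (g ia) (g ja) - F (g i') (g j')| <= e.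
  move=> lF si' sj' di' dj'; apply: (le_trans (lF _ _ _ _ sia sja si' sj')).
  apply: le_trans NK; rewrite ler_wpM2l// lerD// ler_norml; lra.
have [F1a F2a] : 0 <= F1 (g ia) (g ja) /\ 0 <= F2 (g ia) (g ja).
  by move: PA; rewrite /A /C /B !ltNge; case: (0 <= F1 _ _); case: (0 <= F2 _ _).
have F2c : F2 (g ic) (g jc) < 0 by move: PC => /andP[].
have F1b : F1 (g ib) (g jb) < 0.
  by move: PB; rewrite /A /C /B !ltNge; case: (0 <= F1 _ _); case: (0 <= F2 _ _).
exists (g ia), (g ja); split => //.
- by have := close _ _ _ lip1 sib sjb dib djb; rewrite ler_norml ger0_norm//; lra.
- by have := close _ _ _ lip2 sic sjc dic djc; rewrite ler_norml ger0_norm//; lra.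
Qed.

End poincare_miranda.

Section boundary_to_equator.
Variables (R : realType) (L : R) (h : 'rV[R]_2 -> 'rV[R]_3).
Hypothesis h_bilip : bilipschitz_on (@square R) L h.
Hypothesis h_onto : h @` (@square R) = @upper_hemisphere R.

Lemma hemisphere_h u : square u -> enorm (h u) = 1 /\ 0 <= h u 0 2.
Proof. by move=> su; have : upper_hemisphere (h u) by rewrite -h_onto; exists u. Qed.

Lemma bilipschitz_ge1 : 1 <= L.
Proof.
have sq0 : square (vec2 0 0 : 'rV[R]_2) by rewrite /square/= !mxE/= normr0; lra.
have sq1 : square (vec2 1 0 : 'rV[R]_2) by rewrite /square/= !mxE/= normr0 normr1; lra.
have n1 : enorm (vec2 0 0 - vec2 1 0 : 'rV[R]_2) = 1.
  apply/eqP; rewrite -(@eqrXn2 _ 2) ?enorm_ge0// sqr_enorm2 !mxE/=.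
  by rewrite sub0r subrr sqrrN expr1n expr0n addr0.
have /andP[] := h_bilip sq0 sq1; rewrite n1 !mulr1 => h1 h2.
have L0 : 0 <= L by exact: le_trans (enorm_ge0 _) h2.
(* As the inverse of zero is zero, the inequalities leave room for [L = 0]; then
   [h] would be constant. *)
have [Le|Ln] := eqVneq L 0; last first.
  have Lp : 0 < L by rewrite lt_def Ln.
  have : L^-1 <= L by exact: le_trans h1 h2.
  by rewrite -[X in X <= _]mul1r ler_pdivrMr//; nra.
have : upper_hemisphere (vec3 1 0 0 : 'rV[R]_3).
  split; last by rewrite !mxE.
  apply/eqP; rewrite -(@eqrXn2 _ 2) ?enorm_ge0// sqr_enorm3 !mxE/=.
  by rewrite expr1n expr0n !addr0.
have : upper_hemisphere (vec3 0 1 0 : 'rV[R]_3).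
  split; last by rewrite !mxE.
  apply/eqP; rewrite -(@eqrXn2 _ 2) ?enorm_ge0// sqr_enorm3 !mxE/=.
  by rewrite expr1n expr0n !addr0 add0r.
rewrite -h_onto => -[v sv hv] [u su hu].
have /andP[_] := h_bilip su sv; rewrite Le mul0r hu hv => h3.
have := le_trans (coord_le_enorm _ 0) h3.
by rewrite !mxE/= subr0 normr1 ler10.
Qed.

Let L1 := bilipschitz_ge1.
Let L0 : 0 < L. Proof. by have := L1; lra. Qed.

Lemma hemisphere_section : exists g : 'rV[R]_3 -> 'rV[R]_2,
  forall p, upper_hemisphere p -> square (g p) /\ h (g p) = p.
Proof.
have : forall p, exists u, upper_hemisphere p -> square u /\ h u = p.
  move=> p; have [|np] := pselect (upper_hemisphere p); last by exists 0.
  by rewrite -{1}h_onto => -[u su hu]; exists u.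
by move=> /choice[g hg]; exists g.
Qed.

Lemma expansion u v : square u -> square v ->
  enorm (u - v) <= L * enorm (h u - h v).
Proof.
by move=> su sv; have /andP[h1 _] := h_bilip su sv; rewrite -ler_pdivrMl.
Qed.

Lemma normalize_lipschitz (v w : 'rV[R]_3) : 1 <= enorm v -> 1 <= enorm w ->
  enorm ((enorm v)^-1 *: v - (enorm w)^-1 *: w) <= 2 * enorm (v - w).
Proof.
move=> v1 w1; set a := enorm v in v1 *; set b := enorm w in w1 *.
have a0 : 0 < a by lra.
have b0 : 0 < b by lra.
have -> : a^-1 *: v - b^-1 *: w = a^-1 *: (v - w) + (a^-1 - b^-1) *: w.
  by rewrite scalerBr scalerBl addrA subrK.
apply: (le_trans (ler_enormD _ _)); rewrite !enormZ -/b.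
have ai : a^-1 <= 1 by rewrite invf_le1.
have ai0 : 0 < a^-1 by rewrite invr_gt0.
have -> : a^-1 - b^-1 = a^-1 * (b - a) / b by field; rewrite !gt_eqF.
rewrite !normrM !normfV (gtr0_norm a0) (gtr0_norm b0) mulfVK ?gt_eqF//.
have : `|b - a| <= enorm (v - w) by rewrite distrC ler_enorm_dist.
have := enorm_ge0 (v - w); nra.
Qed.

(** Suppose that a boundary point [u0] of the square had an image [p] off the
    equator.  Shrinking the square slightly towards its centre makes it avoid
    [u0]; conjugated with [h], this gives a continuous map of the hemisphere that
    is close to the identity and whose image avoids [p].  Read in the central
    projection of the open hemisphere onto a plane, it contradicts
    [poincare_miranda] on a square centred at [p]. *)
Lemma boundary_to_equator u0 : square u0 -> `|u0 0 0| = 1 \/ `|u0 0 1| = 1 ->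
  h u0 0 2 = 0.
Proof.
move=> su0 bu0; have [pn pge] := hemisphere_h su0.
apply/eqP; rewrite -[_ == _]negbK; apply/negP => p3n.
set p := h u0 in pn pge p3n *.
have p3 : 0 < p 0 2 by rewrite lt_def p3n.
have [g hg] := hemisphere_section.
pose X := p 0 0 / p 0 2; pose Y := p 0 1 / p 0 2.
pose q s t : 'rV[R]_3 := vec3 (X + s) (Y + t) 1.
have q1 s t : 1 <= enorm (q s t).
  by have := coord_le_enorm (q s t) 2; rewrite !mxE/= normr1.
have q0 s t : 0 < enorm (q s t) by have := q1 s t; lra.
pose chi s t := (enorm (q s t))^-1 *: q s t.
have chiH s t : upper_hemisphere (chi s t).
  split; first by rewrite enormZ normfV gtr0_norm// mulVf ?gt_eqF.
  by rewrite !mxE/= mulr1 invr_ge0 ltW.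
(* [chi] inverts the central projection, in coordinates centred at the projection
   of [p]; [C] bounds the distance of the plane square from the origin. *)
pose C := `|X| + `|Y| + 3.
have C3 : 3 <= C by rewrite /C; have := normr_ge0 X; have := normr_ge0 Y; lra.
have qC s t : -1 <= s <= 1 -> -1 <= t <= 1 -> enorm (q s t) <= C.
  move=> s1 t1; apply: enorm3_le; first by lra.
  have : `|X + s| <= `|X| + 1.
    by rewrite (le_trans (ler_normD _ _))// lerD2l ler_norml.
  have : `|Y + t| <= `|Y| + 1.
    by rewrite (le_trans (ler_normD _ _))// lerD2l ler_norml.
  rewrite !mxE/= -[(X + s) ^+ 2]real_normK ?num_real//.
  rewrite -[(Y + t) ^+ 2]real_normK ?num_real// /C.
  have := normr_ge0 X; have := normr_ge0 Y.
  have := normr_ge0 (X + s); have := normr_ge0 (Y + t).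
  move: `|X + s| `|Y + t| `|X| `|Y| => a b x y *; nra.
(* Shrinking the domain by [de] moves the points of the sphere by at most
   [2 * L * de = (4 * C ^+ 2)^-1].  This changes the functions [F1] and [F2] below by
   at most [(4 * C)^-1], while they are at least [C^-1] in modulus on the sides. *)
pose de := (8 * L * C ^+ 2)^-1.
have C0 : 0 < C by lra.
have de0 : 0 < de by rewrite invr_gt0 !mulr_gt0// exprn_gt0.
have deE : L * de * C ^+ 2 = 8^-1 by rewrite /de; field; rewrite !gt_eqF.
have LC : 1 <= L * C ^+ 2.
  rewrite -[1]mulr1 ler_pM// expr2 -[1]mulr1 ler_pM//; lra.
have de1 : de < 1.
  by rewrite invf_lt1 ?mulr_gt0 ?exprn_gt0// -mulrA; lra.
pose k s t := h ((1 - de) *: g (chi s t)).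
have sqk v : square v -> square ((1 - de) *: v).
  move=> [v0 v1]; rewrite /square/= !mxE !normrM ger0_norm; last by lra.
  by split; apply: mulr_ile1 => //; lra.
have kchi s t : enorm (k s t - chi s t) <= 2 * L * de.
  have [sg gE] := hg _ (chiH s t); rewrite -[X in _ - X]gE.
  have /andP[_] := h_bilip (sqk _ sg) sg; move=> /le_trans; apply.
  rewrite (_ : 2 * L * de = L * (de * 2)); last by ring.
  rewrite ler_pM2l// -[X in _ - X]scale1r -scalerBl addrAC subrr sub0r.
  rewrite scaleNr enormN enormZ gtr0_norm// ler_pM2l//.
  apply: enorm2_le => //; have [? ?] := sg.
  rewrite -[_ 0 0 ^+ 2]real_normK ?num_real// -[_ 0 1 ^+ 2]real_normK ?num_real//.
  have := normr_ge0 (g (chi s t) 0 0); have := normr_ge0 (g (chi s t) 0 1); nra.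
have klip s t s' t' :
    enorm (k s t - k s' t') <= 2 * L ^+ 2 * (`|s - s'| + `|t - t'|).
  have [sg gE] := hg _ (chiH s t); have [sg' gE'] := hg _ (chiH s' t').
  have /andP[_] := h_bilip (sqk _ sg) (sqk _ sg'); move=> /le_trans; apply.
  rewrite -scalerBr enormZ ger0_norm; last by lra.
  have h1 := expansion sg sg'; rewrite gE gE' in h1.
  have h2 := normalize_lipschitz (q1 s t) (q1 s' t').
  have h3 : enorm (q s t - q s' t') <= `|s - s'| + `|t - t'|.
    apply: enorm3_le; first by rewrite addr_ge0.
    rewrite !mxE/= subrr expr0n addr0.
    rewrite (_ : X + s - (X + s') = s - s'); last by ring.
    rewrite (_ : Y + t - (Y + t') = t - t'); last by ring.
    rewrite -[(s - s') ^+ 2]real_normK ?num_real//.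
    rewrite -[(t - t') ^+ 2]real_normK ?num_real//.
    have := normr_ge0 (s - s'); have := normr_ge0 (t - t'); nra.
  rewrite -/(chi s t) -/(chi s' t') in h2.
  have h4 : enorm (chi s t - chi s' t') <= 2 * (`|s - s'| + `|t - t'|) by lra.
  have h5 : enorm (g (chi s t) - g (chi s' t')) <=
    L * (2 * (`|s - s'| + `|t - t'|)) by rewrite (le_trans h1)// ler_pM2l.
  rewrite (_ : 2 * L ^+ 2 * _ = L * (L * (2 * (`|s - s'| + `|t - t'|)))); last by ring.
  by rewrite ler_pM2l//; have := enorm_ge0 (g (chi s t) - g (chi s' t')); nra.
have rB (u v : 'rV[R]_3) i : (u - v) 0 i = u 0 i - v 0 i by rewrite !mxE.
have rZ a (u : 'rV[R]_3) i : (a *: u) 0 i = a * u 0 i by rewrite !mxE.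
pose F1 s t := k s t 0 0 - X * k s t 0 2.
pose F2 s t := k s t 0 1 - Y * k s t 0 2.
pose K := C * (2 * L ^+ 2).
have lip Z i : `|Z| + 1 <= C ->
    lipschitz_on_square K (fun s t => k s t 0 i - Z * k s t 0 2).
  move=> ZC s t s' t' _ _ _ _.
  have := klip s t s' t'.
  have := coord_le_enorm (k s t - k s' t') i.
  have := coord_le_enorm (k s t - k s' t') 2; rewrite !rB.
  set e := enorm _ => e2 ei eK.
  rewrite (_ : _ - _ = (k s t 0 i - k s' t' 0 i) - Z * (k s t 0 2 - k s' t' 0 2));
    last by ring.
  apply: (le_trans (ler_normB _ _)); rewrite normrM /K -mulrA.
  apply: (@le_trans _ _ (C * e)); last by rewrite ler_pM2l.
  have := normr_ge0 Z; have : 0 <= e by exact: enorm_ge0.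
  by move: `|Z| ZC `|_ - _| ei `|_ - _| e2 => z ZC a ei b e2 *; nra.
have XC : `|X| + 1 <= C by rewrite /C; have := normr_ge0 Y; lra.
have YC : `|Y| + 1 <= C by rewrite /C; have := normr_ge0 X; lra.
have dev Z i s t : `|Z| + 1 <= C ->
    `|(k s t 0 i - Z * k s t 0 2) - (chi s t 0 i - Z * chi s t 0 2)| <= (4 * C)^-1.
  move=> ZC; have := kchi s t.
  have := coord_le_enorm (k s t - chi s t) i.
  have := coord_le_enorm (k s t - chi s t) 2; rewrite !rB; set e := enorm _ => e2 ei eK.
  rewrite (_ : _ - _ = (k s t 0 i - chi s t 0 i) - Z * (k s t 0 2 - chi s t 0 2));
    last by ring.
  apply: (le_trans (ler_normB _ _)); rewrite normrM.
  apply: (@le_trans _ _ (C * (2 * L * de))).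
    apply: (@le_trans _ _ (C * e)); last by rewrite ler_pM2l.
    have := normr_ge0 Z; have : 0 <= e by exact: enorm_ge0.
    by move: `|Z| ZC `|_ - _| ei `|_ - _| e2 => z ZC a ei b e2 *; nra.
  rewrite -(ler_pM2r C0) (_ : C * (2 * L * de) * C = 2 * (L * de * C ^+ 2)); last by ring.
  by rewrite deE invfM mulfVK ?gt_eqF//; lra.
have side Z i s t (r : R) : `|Z| + 1 <= C -> -1 <= s <= 1 -> -1 <= t <= 1 ->
    q s t 0 i = Z + r -> (r = 1 -> 0 < k s t 0 i - Z * k s t 0 2) /\
    (r = -1 -> k s t 0 i - Z * k s t 0 2 < 0).
  move=> ZC s1 t1 qi; have := dev Z i s t ZC.
  have -> : chi s t 0 i - Z * chi s t 0 2 = r / enorm (q s t).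
    by rewrite !rZ qi [q s t 0 2]mxE/=; ring.
  have : C^-1 <= (enorm (q s t))^-1 by rewrite lef_pV2 ?posrE ?qC// q0.
  have : 0 < C^-1 by rewrite invr_gt0.
  rewrite invfM; move: (C^-1) (enorm (q s t))^-1 => c iq c0 cq.
  rewrite ler_norml => /andP[h1 h2]; split=> rE; move: h1 h2; rewrite rE ?mulN1r ?mul1r; lra.
have sq1 : -1 <= (1 : R) <= 1 by apply/andP; split; lra.
have sqN1 : -1 <= (-1 : R) <= 1 by apply/andP; split; lra.
(* At a common zero up to [e], the shrunk map would come within [4 * e] of [p], which
   is too close as it omits the image of a neighbourhood of [u0] of size [de]. *)
pose e := de / (8 * L).
have e0 : 0 < e by rewrite divr_gt0// mulr_gt0.
have [||t t1|t t1|s s1|s s1|s [t [s1 t1 F1e F2e]]] := @poincare_miranda R F1 F2 K _ _ _ _ _ _ e e0.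
- exact: lip.
- exact: lip.
- by have [] := side X 0 (-1) t (-1) XC sqN1 t1 (vec3E _ _ _).1.1; auto.
- by have [] := side X 0 1 t 1 XC sq1 t1 (vec3E _ _ _).1.1; auto.
- by have [] := side Y 1 s (-1) (-1) YC s1 sqN1 (vec3E _ _ _).1.2; auto.
- by have [] := side Y 1 s 1 1 YC s1 sq1 (vec3E _ _ _).1.2; auto.
have [sg gE] := hg _ (chiH s t).
have [kn k3] := hemisphere_h (sqk _ sg); rewrite -/(k s t) in kn k3.
set c := k s t 0 2 / p 0 2.
have c0 : 0 <= c by rewrite divr_ge0// ltW.
have kp : enorm (k s t - c *: p) <= 2 * e.
  apply: enorm3_le; first by lra.
  have kE : [/\ (k s t - c *: p) 0 0 = F1 s t, (k s t - c *: p) 0 1 = F2 s t &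
      (k s t - c *: p) 0 2 = 0].
    by rewrite !rB !rZ /F1 /F2 /X /Y /c;
      split; field; rewrite gt_eqF.
  case: kE => -> -> ->; rewrite expr0n addr0.
  rewrite -[F1 s t ^+ 2]real_normK ?num_real// -[F2 s t ^+ 2]real_normK ?num_real//.
  have := normr_ge0 (F1 s t); have := normr_ge0 (F2 s t); nra.
have c1 : `|c - 1| <= 2 * e.
  have := le_trans (ler_enorm_dist (k s t) (c *: p)) kp.
  by rewrite kn enormZ pn mulr1 (ger0_norm c0) distrC.
have far : enorm (k s t - p) <= 4 * e.
  apply: (le_trans (ler_edistD (c *: p) _ _)).
  have : enorm (c *: p - p) <= 2 * e.
    by rewrite -{2}[p]scale1r -scalerBl enormZ pn mulr1.
  by lra.
have := expansion (sqk _ sg) su0; rewrite -/(k s t) -/p => close.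
have dist i : `|u0 0 i| = 1 -> `|g (chi s t) 0 i| <= 1 ->
    de <= enorm ((1 - de) *: g (chi s t) - u0).
  move=> ui gi; apply: le_trans (coord_le_enorm _ i); rewrite !mxE.
  have := ler_normB (u0 0 i - (1 - de) * g (chi s t) 0 i) (- ((1 - de) * g (chi s t) 0 i)).
  rewrite opprK subrK ui normrN normrM distrC gtr0_norm; last by lra.
  nra.
have : de <= enorm ((1 - de) *: g (chi s t) - u0).
  by have [g0 g1] := sg; case: bu0 => [/dist|/dist]; apply.
have : L * (4 * e) = de / 2 by rewrite /e; field; rewrite gt_eqF.
have : L * enorm (k s t - p) <= L * (4 * e) by rewrite ler_pM2l.
by lra.
Qed.

End boundary_to_equator.

(** * Inverse branches of the Zorich map *)

Section sign.
Variable R : realType.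

Definition sgn (n : int) : R := (-1) ^ n.

Lemma sgnD n m : sgn (n + m) = sgn n * sgn m.
Proof. by rewrite /sgn exprzDr// unitrN1. Qed.

Lemma normr_sgn n : `|sgn n| = 1.
Proof.
by rewrite /sgn; case: n => k; rewrite /= ?normfV normrX normrN1 expr1n ?invr1.
Qed.

Lemma sqr_sgn n : sgn n * sgn n = 1.
Proof.
by rewrite -expr2 -[_ ^+ 2]real_normK ?num_real// normr_sgn expr1n.
Qed.

Lemma sgn2 n : sgn (2 * n) = 1.
Proof. by rewrite (_ : 2 * n = n + n) ?sgnD ?sqr_sgn//; lia. Qed.

Lemma sgn_cases n : sgn n = 1 \/ sgn n = -1.
Proof.
have /eqP := normr_sgn n; rewrite eqr_norml ler01 andbT => /orP[]/eqP->;
  by [left|right].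
Qed.

(** The beams that are mapped onto the upper half space are those whose indices have
    an even sum; in this way they are numbered by all pairs of integers. *)
Lemma sgn_even n m : sgn (n + m) = 1 -> exists p q : int, n = p + q /\ m = p - q.
Proof.
have [k [e|e]] : exists k, n + m = 2 * k \/ n + m = 2 * k + 1.
  by exists ((n + m) %/ 2)%Z; lia.
- by move=> _; exists k, (n - k); split; lia.
- by rewrite e sgnD sgn2 mul1r /sgn expr1z; lra.
Qed.

End sign.

Lemma rowB (R : realType) n (u v : 'rV[R]_n) i : (u - v) 0 i = u 0 i - v 0 i.
Proof. by rewrite !mxE. Qed.

Lemma rowZ (R : realType) n a (u : 'rV[R]_n) i : (a *: u) 0 i = a * u 0 i.
Proof. by rewrite !mxE. Qed.

Lemma continuous_enormP (R : realType) m n (F : 'rV[R]_m -> 'rV[R]_n) x :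
  {for x, continuous F} <-> forall e, 0 < e -> exists2 d, 0 < d &
    forall z, enorm (z - x) < d -> enorm (F z - F x) < e.
Proof.
split=> [Fx e e0|Fx U /nbhs_enorm[e /Fx[d d0 dF] eU]].
  have /Fx/nbhs_enorm[d d0 dF] : nbhs (F x) [set y | enorm (y - F x) < e].
    by apply/nbhs_enorm; exists e.
  by exists d.
by apply/nbhs_enorm; exists d => // z /dF; exact: eU.
Qed.

Section zorich_branches.
Variables (R : realType) (L lambda : R) (h : 'rV[R]_2 -> 'rV[R]_3).
Hypothesis h_bilip : bilipschitz_on (@square R) L h.
Hypothesis h_onto : h @` (@square R) = @upper_hemisphere R.
Hypothesis lambda_gt0 : 0 < lambda.
Hypothesis lambda_lt : lambda < expR (- (ln L + L)).

Local Notation f := (zorich_scaled lambda h).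

(** The height [t] at which [lambda * expR t * L = 1].  It exceeds [1], and the half
    space below it is mapped into the unit ball, hence into itself.  On the other
    hand, the map expands the distance of points of the same beam when the moduli of
    their images are at least [level], because [L < level]. *)
Definition level : R := - ln lambda - ln L.
Local Notation M := level.

Let L1 : 1 <= L := bilipschitz_ge1 h_bilip h_onto.
Let L0 : 0 < L. Proof. by move: L1; lra. Qed.

Lemma level_gt : L < M.
Proof.
have : ln lambda < - (ln L + L) by rewrite -[ltRHS]expRK ltr_ln ?posrE ?expR_gt0.
rewrite /level; lra.
Qed.

Let M1 : 1 < M. Proof. by have := level_gt; move: L1; lra. Qed.

Lemma level_exp : lambda * expR M * L = 1.
Proof.
rewrite /level -opprD expRN expRD !lnK ?posrE//.
by field; rewrite !gt_eqF.
Qed.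

Definition in_cell (n m : int) (x : 'rV[R]_3) :=
  `|x 0 0 - 2 * n%:~R| <= 1 /\ `|x 0 1 - 2 * m%:~R| <= 1.

Definition cell_fold (n m : int) (x : 'rV[R]_3) : 'rV[R]_2 :=
  vec2 (sgn R n * (x 0 0 - 2 * n%:~R)) (sgn R m * (x 0 1 - 2 * m%:~R)).

Definition reflect (n m : int) (y : 'rV[R]_3) : 'rV[R]_3 :=
  vec3 (y 0 0) (y 0 1) (sgn R (n + m) * y 0 2).

Lemma reflectK n m y : reflect n m (reflect n m y) = y.
Proof. by apply: row3P; rewrite !mxE//= mulrA sqr_sgn mul1r. Qed.

Lemma reflectB n m y z : reflect n m y - reflect n m z = reflect n m (y - z).
Proof. by apply: row3P; rewrite !mxE//= mulrBr. Qed.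

Lemma reflectZ n m a y : a *: reflect n m y = reflect n m (a *: y).
Proof. by apply: row3P; rewrite !mxE//= mulrCA. Qed.

Lemma enorm_reflect n m y : enorm (reflect n m y) = enorm y.
Proof.
apply/eqP; rewrite -(@eqrXn2 _ 2) ?enorm_ge0// !sqr_enorm3 !mxE/=.
by rewrite exprMn [sgn _ _ ^+ 2]expr2 sqr_sgn mul1r.
Qed.

Lemma square_fold n m x : in_cell n m x -> square (cell_fold n m x).
Proof.
by case=> x0 x1; rewrite /square/= !mxE/= !normrM !normr_sgn !mul1r.
Qed.

Lemma zorich_scaledE n m x : in_cell n m x ->
  f x = (lambda * expR (x 0 2)) *: reflect n m (h (cell_fold n m x)).
Proof.
case=> x0 x1; rewrite /zorich_scaled.
rewrite (@zorichE _ h x n m _ x0 x1) ?scalerA//.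
by move=> u su bu; exact: (boundary_to_equator h_bilip h_onto).
Qed.

Lemma in_cell_cell (x : 'rV[R]_3) : in_cell (cell (x 0 0)) (cell (x 0 1)) x.
Proof.
have cellP (t : R) : `|t - 2 * (cell t)%:~R| <= 1.
  have := real_floor_itv (num_real ((t + 1) / 2)); rewrite -/(cell t) intrD.
  by move=> /andP[? ?]; rewrite ler_norml; apply/andP; split; lra.
by split; exact: cellP.
Qed.

Lemma enorm_f (x : 'rV[R]_3) : enorm (f x) = lambda * expR (x 0 2).
Proof.
have xc := in_cell_cell x; rewrite (zorich_scaledE xc) enormZ enorm_reflect.
have [-> _] := hemisphere_h h_onto (square_fold xc).
by rewrite mulr1 gtr0_norm// mulr_gt0 ?expR_gt0.
Qed.

Lemma fold_dist n m x z :
  enorm (cell_fold n m x - cell_fold n m z) ^+ 2 =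
  (x 0 0 - z 0 0) ^+ 2 + (x 0 1 - z 0 1) ^+ 2.
Proof.
rewrite sqr_enorm2 !mxE/= -!mulrBr !exprMn !(expr2 (sgn _ _)) !sqr_sgn !mul1r.
by congr (_ ^+ _ + _ ^+ _); ring.
Qed.

(** Near an odd integer [cell] takes two values, and both of these cells contain it. *)
Lemma cell_near (t0 : R) : exists2 e : R, 0 < e &
  forall t, `|t - t0| < e -> `|t0 - 2 * (cell t)%:~R| <= 1.
Proof.
have [[z t0z]|tn] := pselect (integral ((t0 + 1) / 2)).
  exists 2 => // t; rewrite ltr_norml => /andP[t1 t2].
  have /andP[] := real_floor_itv (num_real ((t + 1) / 2)); rewrite -/(cell t) intrD.
  move=> c1 c2; have : (cell t)%:~R < (z + 1)%:~R :> R by rewrite intrD; lra.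
  have : z%:~R < (cell t + 1 + 1)%:~R :> R by rewrite !intrD; lra.
  rewrite !ltr_int !ltzD1 -!(ler_int R) intrD => ? ?.
  by rewrite ler_norml; apply/andP; split; lra.
have [e e0 fl] := floor_near tn; exists (2 * e); first by rewrite mulr_gt0.
move=> t tt0; have := in_cell_cell (const_mx t0); rewrite /in_cell !mxE => -[].
rewrite /cell (fl ((t + 1) / 2))//.
rewrite (_ : _ - _ = (t - t0) / 2); last by ring.
by rewrite normrM normfV (ger0_norm (ler0n R 2)) ltr_pdivrMr// mulrC.
Qed.

(** Near a point, only the cells whose closure contains it matter, and on each of
    them the map is given by a single continuous formula. *)
Lemma continuous_f : continuous f.
Proof.
move=> x; apply/continuous_enormP => e e0.
have [e1 e1P c1] := cell_near (x 0 0); have [e2 e2P c2] := cell_near (x 0 1).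
pose b := lambda * expR (x 0 2).
have b0 : 0 < b by rewrite mulr_gt0 ?expR_gt0.
have e3P : 0 < e / (2 * b * L) by rewrite divr_gt0// mulr_gt0// mulr_gt0.
have e40 : 0 < e / (2 * lambda) by rewrite divr_gt0// mulr_gt0.
have /cvgrPdist_lt/(_ _ e40)/nbhs_ballP[e4 /= e4P c4] := @continuous_expR R (x 0 2).
exists (Num.min (Num.min e1 e2) (Num.min (e / (2 * b * L)) e4)).
  by rewrite !lt_min e1P e2P e3P e4P.
move=> z; rewrite !lt_min => /andP[/andP[z1 z2] /andP[z3 z4]].
have d i : `|z 0 i - x 0 i| <= enorm (z - x).
  by have := coord_le_enorm (z - x) i; rewrite !mxE.
have xc : in_cell (cell (z 0 0)) (cell (z 0 1)) x.
  by split; [apply: c1|apply: c2]; apply: le_lt_trans (d _) _.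
have zc := in_cell_cell z.
rewrite edistC (zorich_scaledE xc) (zorich_scaledE zc).
set n := cell _; set m := cell _; set u := cell_fold n m x; set v := cell_fold n m z.
rewrite -/b; set a := lambda * expR (z 0 2).
have -> : b *: reflect n m (h u) - a *: reflect n m (h v) =
    b *: reflect n m (h u - h v) + (b - a) *: reflect n m (h v).
  by rewrite -reflectB scalerBr scalerBl addrA subrK.
apply: (le_lt_trans (ler_enormD _ _)).
rewrite !enormZ !enorm_reflect (hemisphere_h h_onto (square_fold zc)).1 mulr1.
rewrite (gtr0_norm b0).
have uv : enorm (u - v) <= enorm (z - x).
  rewrite -(@ler_pXn2r _ 2) ?nnegrE ?enorm_ge0// fold_dist sqr_enorm3 !mxE.
  by have := sqr_ge0 (z 0 2 - x 0 2); rewrite -[X in X ^+ 2]opprB sqrrN; nra.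
have /andP[_ huv] := h_bilip (square_fold xc) (square_fold zc).
have t1 : b * enorm (h u - h v) < e / 2.
  apply: (@le_lt_trans _ _ (b * (L * enorm (z - x)))).
    by rewrite ler_pM2l// (le_trans huv)// ler_pM2l.
  by move: z3; rewrite ltr_pdivlMr; [lra|rewrite mulr_gt0// mulr_gt0].
have t2 : `|b - a| < e / 2.
  have := c4 (z 0 2); rewrite /ball/= distrC => /(_ (le_lt_trans (d 2) z4)).
  rewrite /b /a -mulrBr normrM (gtr0_norm lambda_gt0) ltr_pdivlMr; [lra|by rewrite mulr_gt0].
lra.
Qed.

(** With [x = (u, log r)] and [z = (v, log s)] in the coordinates of a cell, the
    images are [r p] and [s q] for unit vectors [p] and [q], up to the factor
    [lambda], and [|r p - s q|^2 = (r - s)^2 + r s |p - q|^2]. *)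
Lemma f_expanding n m x z : in_cell n m x -> in_cell n m z ->
  M <= enorm (f x) -> M <= enorm (f z) ->
  M * enorm (x - z) <= L * enorm (f x - f z).
Proof.
move=> xc zc; rewrite !enorm_f => Mr Ms.
set r := lambda * expR (x 0 2) in Mr; set s := lambda * expR (z 0 2) in Ms.
rewrite (zorich_scaledE xc) (zorich_scaledE zc) -/r -/s.
rewrite !reflectZ reflectB enorm_reflect.
set u := cell_fold n m x; set v := cell_fold n m z.
have su := square_fold xc; have sv := square_fold zc.
have [pn _] := hemisphere_h h_onto su; have [qn _] := hemisphere_h h_onto sv.
rewrite -(@ler_pXn2r _ 2) ?nnegrE ?mulr_ge0 ?enorm_ge0 ?(ltW L0)//; last by move: M1; lra.
have uvE := fold_dist n m x z; rewrite -/u -/v in uvE.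
have huv : enorm (u - v) ^+ 2 <= L ^+ 2 * enorm (h u - h v) ^+ 2.
  rewrite -exprMn ler_pXn2r ?nnegrE ?mulr_ge0 ?enorm_ge0 ?(ltW L0)//.
  exact: (expansion h_bilip h_onto).
have polar : enorm (r *: h u - s *: h v) ^+ 2 =
    (r - s) ^+ 2 + r * s * enorm (h u - h v) ^+ 2.
  have := congr1 (fun a => a ^+ 2) pn; have := congr1 (fun a => a ^+ 2) qn.
  rewrite !sqr_enorm3 !mxE expr1n => qE pE.
  rewrite -[(r - s) ^+ 2]mulr1.
  move: (h u 0 0) (h u 0 1) (h u 0 2) (h v 0 0) (h v 0 1) (h v 0 2) pE qE.
  move=> p0 p1 p2 q0 q1 q2 pE qE.
  have -> : (r - s) ^+ 2 * 1 = r ^+ 2 * 1 + s ^+ 2 * 1 - r * s * 1 - r * s * 1 by ring.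
  rewrite -{1}pE -{1}qE -{1}pE -{1}qE; ring.
have r0 : 0 < r by apply: lt_le_trans Mr; move: M1; lra.
have s0 : 0 < s by apply: lt_le_trans Ms; move: M1; lra.
have logE : x 0 2 - z 0 2 = ln r - ln s.
  by rewrite /r /s !lnM ?posrE ?expR_gt0// !expRK; lra.
have log_lip a b : M <= a -> M <= b -> M * (ln a - ln b) <= `|a - b|.
  move=> Ma Mb; have b0 : 0 < b by move: M1; lra.
  have a0 : 0 < a by move: M1; lra.
  have [ba|ab] := leP b a; last first.
    have : ln a < ln b by rewrite ltr_ln ?posrE.
    by have := normr_ge0 (a - b); move: M1; nra.
  rewrite -ln_div ?posrE//.
  have : ln (a / b) <= a / b - 1.
    by rewrite -{1}[a / b](addrNK 1) addrC le_ln1Dx// ltrBrDl addrN divr_gt0.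
  rewrite ger0_norm ?subr_ge0// => h1.
  have h2 : (a / b - 1) * b = a - b by field; rewrite gt_eqF.
  have h3 : 0 <= a / b - 1 by rewrite subr_ge0 ler_pdivlMr// mul1r.
  by move: M1; nra.
have h2 : M ^+ 2 * (x 0 2 - z 0 2) ^+ 2 <= (r - s) ^+ 2.
  rewrite logE -exprMn -[leRHS]real_normK ?num_real// -[leLHS]real_normK ?num_real//.
  rewrite ler_pXn2r ?nnegrE// ler_norml; apply/andP; split; last exact: log_lip.
  by have := log_lip s r Ms Mr; rewrite distrC; lra.
have h1 : M ^+ 2 <= r * s by rewrite expr2 ler_pM//; move: M1; lra.
rewrite exprMn [leRHS]exprMn polar (sqr_enorm3 (x - z)) !rowB -uvE.
have := sqr_ge0 (enorm (h u - h v)); have := sqr_ge0 (r - s).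
move: (enorm (h u - h v) ^+ 2) (enorm (u - v) ^+ 2) huv => a b ba rs0 a0.
have LL : 1 <= L ^+ 2 by exact: exprn_ege1.
have MM : 0 < M ^+ 2 by rewrite exprn_gt0//; move: M1; lra.
move: (L ^+ 2) (M ^+ 2) (r * s) ((r - s) ^+ 2) ((x 0 2 - z 0 2) ^+ 2)
  ba rs0 h1 h2 LL MM => LL MM rs d k *.
have : MM * b <= LL * (rs * a).
  apply: (@le_trans _ _ (MM * (LL * a))); first by rewrite ler_pM2l.
  by rewrite mulrCA ler_wpM2l ?ler_wpM2r//; lra.
nra.
Qed.

Definition sphere_chart : 'rV[R]_3 -> 'rV[R]_2 :=
  sval (cid (hemisphere_section h_onto)).

Lemma sphere_chartP p : upper_hemisphere p ->
  square (sphere_chart p) /\ h (sphere_chart p) = p.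
Proof. exact: (svalP (cid (hemisphere_section h_onto))). Qed.

(** The preimage of [y] in the cell: [h] inverts the direction of [y], folded into
    the upper hemisphere, and the modulus of [y] determines the height. *)
Definition branch (n m : int) (y : 'rV[R]_3) : 'rV[R]_3 :=
  let u := sphere_chart ((enorm y)^-1 *: reflect n m y) in
  vec3 (2 * n%:~R + sgn R n * u 0 0) (2 * m%:~R + sgn R m * u 0 1)
    (ln (enorm y / lambda)).

Lemma branchP n m y : 0 < enorm y -> 0 <= sgn R (n + m) * y 0 2 ->
  in_cell n m (branch n m y) /\ f (branch n m y) = y.
Proof.
move=> y0 y2; have aK (a b : R) : a + b - a = b by rewrite addrAC subrr add0r.
set p := (enorm y)^-1 *: reflect n m y.
have Hp : upper_hemisphere p.
  split; first by rewrite enormZ enorm_reflect normfV gtr0_norm// mulVf ?gt_eqF.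
  by rewrite !mxE/= mulr_ge0// invr_ge0 ltW.
have [[u0 u1] hu] := sphere_chartP Hp.
have c : in_cell n m (branch n m y).
  by rewrite /in_cell !mxE/= -/p !aK !normrM !normr_sgn !mul1r.
split=> //; rewrite (zorich_scaledE c).
have -> : cell_fold n m (branch n m y) = sphere_chart p.
  by apply: row2P; rewrite !mxE/= -/p !aK mulrA sqr_sgn mul1r.
rewrite hu /p -reflectZ reflectK scalerA !mxE/= lnK ?posrE ?divr_gt0//.
rewrite (_ : lambda * (enorm y / lambda) * (enorm y)^-1 = 1) ?scale1r//.
by field; rewrite !gt_eqF.
Qed.

End zorich_branches.

(** * The model dynamics *)

Section model.
Variables (R : realType) (L lambda : R).
Hypothesis L1 : 1 <= L.
Hypothesis lambda_gt0 : 0 < lambda.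
Hypothesis lambda_lt : lambda < expR (- (ln L + L)).

Local Notation M := (level L lambda).

Let LM : L < M := level_gt lambda_gt0 lambda_lt.
Let M1 : 1 < M. Proof. by move: L1 LM; lra. Qed.
Let M0 : 0 < M. Proof. by move: M1; lra. Qed.

Definition upper : set 'rV[R]_3 := [set x | M <= x 0 2].

Definition beam_point (s : int * int) (t : R) : 'rV[R]_3 :=
  vec3 (2 * (s.1 + s.2)%:~R) (2 * (s.1 - s.2)%:~R) t.

(** The common height of all preimages of [y]. *)
Definition log_height (y : 'rV[R]_3) : R := ln (enorm y / lambda).

Definition rate := L / M.

Lemma rate_itv : 0 <= rate < 1.
Proof.
by rewrite /rate divr_ge0 ?(ltW M0)//= ?ltr_pdivrMr ?mul1r//; move: L1; lra.
Qed.

Lemma invM_itv : 0 <= M^-1 < 1.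
Proof. by rewrite invr_ge0 (ltW M0)/= invf_lt1. Qed.

Lemma upper_enorm y : upper y -> M <= enorm y.
Proof.
rewrite /upper/= => yM; apply: (le_trans _ (coord_le_enorm y 2)).
by rewrite (le_trans yM) ?ler_norm.
Qed.

Lemma log_height_ge y : M <= enorm y -> M <= log_height y.
Proof.
move=> My; have y0 : 0 < enorm y by move: M0; lra.
rewrite /log_height ln_div ?posrE// /level.
have : ln M <= ln (enorm y) by rewrite ler_ln ?posrE.
have : 0 <= ln M by rewrite ln_ge0// ltW.
have : 0 <= ln L by rewrite ln_ge0.
by rewrite /level; lra.
Qed.

Lemma log_height_lip y z : M <= enorm y -> M <= enorm z ->
  `|log_height y - log_height z| <= M^-1 * enorm (y - z).
Proof.
wlog yz : y z / enorm z <= enorm y.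
  move=> wl My Mz; have [/wl|/ltW/wl] := leP (enorm z) (enorm y); first exact.
  by rewrite distrC edistC; apply.
move=> My Mz.
have y0 : 0 < enorm y by move: M0; lra.
have z0 : 0 < enorm z by move: M0; lra.
rewrite /log_height !ln_div ?posrE// opprB addrA subrK -ln_div ?posrE//.
have yz1 : 1 <= enorm y / enorm z by rewrite ler_pdivlMr// mul1r.
rewrite ger0_norm ?ln_ge0//.
have : ln (enorm y / enorm z) <= enorm y / enorm z - 1.
  rewrite -{1}[_ / _](addrNK 1) addrC le_ln1Dx// ltrBrDl addrN divr_gt0//.
move=> /le_trans; apply.
apply: (@le_trans _ _ (M^-1 * (enorm y - enorm z))).
  rewrite (_ : _ - 1 = (enorm z)^-1 * (enorm y - enorm z)); last first.
    by field; rewrite gt_eqF.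
  by rewrite ler_wpM2r ?subr_ge0// lef_pV2 ?posrE.
rewrite ler_wpM2l ?invr_ge0 ?(ltW M0)//.
exact: le_trans (ler_norm _) (ler_enorm_dist _ _).
Qed.

Lemma beam_point_upper s t : M <= t -> upper (beam_point s t).
Proof. by rewrite /upper/= vec3E. Qed.

Lemma beam_pointB s t t' : enorm (beam_point s t - beam_point s t') = `|t - t'|.
Proof.
apply/eqP; rewrite -(@eqrXn2 _ 2) ?enorm_ge0// sqr_enorm3 !rowB !vec3E !subrr.
by rewrite !expr0n !add0r real_normK ?num_real.
Qed.

(** The model replaces a point of a beam by its height: it acts as if all points
    were on the axes of their beams.  A height then determines the next one, and a
    symbol sequence determines which heights survive. *)
Definition model_branch (s : int * int) (t : R) := log_height (beam_point s t).

Lemma model_branch_ge s t : M <= t -> M <= model_branch s t.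
Proof. by move=> Mt; exact/log_height_ge/upper_enorm/beam_point_upper. Qed.

Lemma model_branch_contract s t t' : M <= t -> M <= t' ->
  `|model_branch s t - model_branch s t'| <= M^-1 * `|t - t'|.
Proof.
move=> Mt Mt'; rewrite -(beam_pointB s t t').
by apply: log_height_lip; exact/upper_enorm/beam_point_upper.
Qed.

Lemma expR_model_branch s t : M <= t ->
  (lambda * expR (model_branch s t)) ^+ 2 =
  (2 * (s.1 + s.2)%:~R) ^+ 2 + (2 * (s.1 - s.2)%:~R) ^+ 2 + t ^+ 2.
Proof.
move=> Mt; have p0 : 0 < enorm (beam_point s t).
  exact: lt_le_trans M0 (upper_enorm (beam_point_upper s Mt)).
rewrite /model_branch /log_height lnK ?posrE ?divr_gt0// mulrC divfK ?gt_eqF//.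
by rewrite sqr_enorm3 !vec3E.
Qed.

Lemma model_branch_lt s t t' : M <= t -> t < t' ->
  model_branch s t < model_branch s t'.
Proof.
move=> Mt tt'; have Mt' : M <= t' by lra.
rewrite -ltr_expR -(ltr_pM2l lambda_gt0) -(@ltr_pXn2r _ 2) ?nnegrE//; last 2 first.
- by rewrite mulr_ge0 ?expR_ge0// ltW.
- by rewrite mulr_ge0 ?expR_ge0// ltW.
rewrite expR_model_branch// expR_model_branch// ltrD2l.
by rewrite ltr_pXn2r ?nnegrE// ?(le_trans (ltW M0)).
Qed.

Definition model_orbit (s : nat -> int * int) (w : nat -> R) :=
  forall k, M <= w k /\ w k = model_branch (s k.+1) (w k.+1).

(** The lowest height from which an orbit of the model with symbols [s] stays above
    the level for [n] steps. *)
Definition first_height (s : nat -> int * int) n :=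
  pullback (fun k => model_branch (s k.+1)) 0 n M.

Lemma model_pullback_ge s j k t : M <= t ->
  M <= pullback (fun k => model_branch (s k.+1)) j k t.
Proof. by move=> Mt; elim: k j => //= k IH j; apply: model_branch_ge. Qed.

Lemma model_pullback_lt s j k t t' : M <= t -> t < t' ->
  pullback (fun k => model_branch (s k.+1)) j k t <
  pullback (fun k => model_branch (s k.+1)) j k t'.
Proof.
move=> Mt tt'; elim: k j => //= k IH j; apply: model_branch_lt => //.
exact: model_pullback_ge.
Qed.

Lemma model_pullback_le s j k t t' : M <= t -> t <= t' ->
  pullback (fun k => model_branch (s k.+1)) j k t <=
  pullback (fun k => model_branch (s k.+1)) j k t'.
Proof.
move=> Mt; rewrite le_eqVlt => /orP[/eqP->//|]; move=> /(model_pullback_lt s j k Mt).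
exact: ltW.
Qed.

Lemma orbit_pullback s w k : model_orbit s w ->
  pullback (fun k => model_branch (s k.+1)) 0 k (w k) = w 0.
Proof.
by move=> sw; elim: k => // k <-; rewrite pullbackSr add0n -(sw k).2.
Qed.

Lemma orbit_first_height s w n : model_orbit s w -> first_height s n <= w 0.
Proof.
move=> sw; rewrite -(orbit_pullback n sw); apply: model_pullback_le => //.
exact: (sw n).1.
Qed.

(** The forward map of the model: the inverse of [model_branch]. *)
Fixpoint forward (s : nat -> int * int) (y : R) k : R :=
  if k is k'.+1 then
    Num.sqrt ((lambda * expR (forward s y k')) ^+ 2 -
      ((2 * ((s k).1 + (s k).2)%:~R) ^+ 2 + (2 * ((s k).1 - (s k).2)%:~R) ^+ 2))
  else y.

(** The branches are increasing, so that the forward orbit of [y] falls below the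
    level at time [n] only if [y < first_height s n]. *)
Lemma first_height_orbit s y : (forall n, first_height s n <= y) ->
  model_orbit s (forward s y).
Proof.
move=> sy.
suff H k : M <= forward s y k /\
    pullback (fun k => model_branch (s k.+1)) 0 k (forward s y k) = y /\
    (M <= forward s y k.+1 /\ model_branch (s k.+1) (forward s y k.+1) = forward s y k).
  by move=> k; have [? [_ [_ ->]]] := H k.
suff step j : M <= forward s y j ->
    pullback (fun k => model_branch (s k.+1)) 0 j (forward s y j) = y ->
    M <= forward s y j.+1 /\ model_branch (s j.+1) (forward s y j.+1) = forward s y j.
  elim: k => [|k [IH1 [IH2 [IH3 IH4]]]].
    have My : M <= y by exact: (sy 0).
    by split=> //; split=> //; exact: step.
  have eq : pullback (fun k => model_branch (s k.+1)) 0 k.+1 (forward s y k.+1) = y.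
    by rewrite pullbackSr add0n IH4.
  by split=> //; split=> //; exact: step.
move=> Mj yj.
have ge : model_branch (s j.+1) M <= forward s y j.
  rewrite leNgt; apply/negP => /(model_pullback_lt s 0 j Mj).
  by rewrite yj ltNge; have := sy j.+1; rewrite /first_height pullbackSr add0n => ->.
have lge : (lambda * expR (model_branch (s j.+1) M)) ^+ 2 <=
    (lambda * expR (forward s y j)) ^+ 2.
  rewrite ler_pXn2r ?nnegrE ?mulr_ge0 ?expR_ge0 ?(ltW lambda_gt0)//.
  by rewrite ler_pM2l// ler_expR.
rewrite expR_model_branch// in lge.
set c := (2 * ((s j.+1).1 + _)%:~R) ^+ 2 + (2 * ((s j.+1).1 - _)%:~R) ^+ 2 in lge.
have M2 : M ^+ 2 <= (lambda * expR (forward s y j)) ^+ 2 - c by lra.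
have fE : forward s y j.+1 ^+ 2 = (lambda * expR (forward s y j)) ^+ 2 - c.
  by rewrite [forward _ _ _.+1]/= sqr_sqrtr// (le_trans _ M2)// sqr_ge0.
have Mj1 : M <= forward s y j.+1.
  rewrite -(@ler_pXn2r _ 2) ?nnegrE ?(ltW M0) ?fE//.
  exact: sqrtr_ge0.
split=> //; apply: expR_inj; apply: (@mulfI _ lambda); first by rewrite gt_eqF.
apply/eqP; rewrite -(@eqrXn2 _ 2) ?mulr_ge0 ?expR_ge0 ?(ltW lambda_gt0)//.
by rewrite expR_model_branch// fE -/c addrC subrK.
Qed.

Lemma orbit_forward s w k : model_orbit s w -> forward s (w 0) k = w k.
Proof.
move=> sw; elim: k => //= k ->; have [_ ->] := sw k; have [Mk _] := sw k.+1.
by rewrite expR_model_branch// addrC addKr sqrtr_sqr ger0_norm//; move: M0; lra.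
Qed.

Lemma orbits_close_model s s' w w' k : model_orbit s w -> model_orbit s' w' ->
  (forall j, (j <= k)%N -> s j = s' j) -> `|w 0 - w' 0| <= M^-1 ^+ k * `|w k - w' k|.
Proof.
move=> sw sw' ss'.
apply: (@orbits_close R _ (fun x y : R => `|x - y|) [set t | M <= t]
  M^-1 (fun k => model_branch (s k.+1)) invM_itv
  (fun k => @model_branch_contract (s k.+1))) => j.
- exact: (sw j).1.
- exact: (sw' j).1.
- by move=> _; exact: (sw j).2.
- by move=> jk; rewrite ss'//; exact: (sw' j).2.
Qed.

End model.

(** * The conjugacy of the model with the Zorich map *)

Section conjugacy.
Variables (R : realType) (L lambda : R) (h : 'rV[R]_2 -> 'rV[R]_3).
Hypothesis h_bilip : bilipschitz_on (@square R) L h.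
Hypothesis h_onto : h @` (@square R) = @upper_hemisphere R.
Hypothesis lambda_gt0 : 0 < lambda.
Hypothesis lambda_lt : lambda < expR (- (ln L + L)).

Local Notation f := (zorich_scaled lambda h).
Local Notation M := (level L lambda).

Let L1 : 1 <= L := bilipschitz_ge1 h_bilip h_onto.
Let LM : L < M := level_gt lambda_gt0 lambda_lt.
Let M1 : 1 < M. Proof. by move: L1 LM; lra. Qed.
Let M0 : 0 < M. Proof. by move: M1; lra. Qed.

Local Notation upper := (upper L lambda).
Local Notation rate := (rate L lambda).
Local Notation log_height := (log_height lambda).
Local Notation model_branch := (model_branch lambda).
Local Notation model_orbit := (model_orbit L lambda).

Let rate_itv := rate_itv L1 lambda_gt0 lambda_lt.
Let invM_itv := invM_itv L1 lambda_gt0 lambda_lt.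
Let upper_enorm := @upper_enorm R L lambda.
Let log_height_ge := log_height_ge L1 lambda_gt0 lambda_lt.
Let log_height_lip := log_height_lip L1 lambda_gt0 lambda_lt.
Let model_branch_ge := model_branch_ge L1 lambda_gt0 lambda_lt.
Let model_branch_contract := model_branch_contract L1 lambda_gt0 lambda_lt.
Let beam_point_upper := @beam_point_upper R L lambda.

(** The symbol [(p, q)] stands for the beam over the cell [(p + q, p - q)]; these
    are the beams that are mapped onto the upper half space. *)
Definition in_beam (s : int * int) := @in_cell R (s.1 + s.2) (s.1 - s.2).

Definition beam_branch (s : int * int) :=
  branch lambda h_onto (s.1 + s.2) (s.1 - s.2).

Lemma log_height_f x : log_height (f x) = x 0 2.
Proof.
by rewrite /log_height (enorm_f h_bilip h_onto)// mulrAC divff ?gt_eqF// mul1r expRK.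
Qed.

Lemma beam_branchP s y : upper y ->
  in_beam s (beam_branch s y) /\ f (beam_branch s y) = y.
Proof.
move=> yM; apply: (branchP h_bilip h_onto) => //.
  by apply: lt_le_trans M0 (upper_enorm yM).
rewrite (_ : s.1 + s.2 + (s.1 - s.2) = 2 * s.1); last by lia.
by rewrite sgn2 mul1r (le_trans (ltW M0)).
Qed.

Lemma beam_branch_height s y : beam_branch s y 0 2 = log_height y.
Proof. by rewrite /beam_branch /branch vec3E. Qed.

Lemma beam_branch_upper s y : upper y -> upper (beam_branch s y).
Proof.
by move=> yM; rewrite /upper/= beam_branch_height log_height_ge ?upper_enorm.
Qed.

Lemma beam_contract s x z : in_beam s x -> in_beam s z -> upper (f x) ->
  upper (f z) -> enorm (x - z) <= rate * enorm (f x - f z).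
Proof.
move=> xs zs /upper_enorm xM /upper_enorm zM.
have := f_expanding h_bilip h_onto lambda_gt0 lambda_lt xs zs xM zM.
by rewrite /rate mulrAC ler_pdivlMr// mulrC.
Qed.

Lemma beam_branch_contract s y z : upper y -> upper z ->
  enorm (beam_branch s y - beam_branch s z) <= rate * enorm (y - z).
Proof.
move=> yM zM; have [ys fy] := beam_branchP s yM; have [zs fz] := beam_branchP s zM.
by have := beam_contract ys zs; rewrite fy fz; exact.
Qed.

Lemma beam_branchK s x : in_beam s x -> upper (f x) -> beam_branch s (f x) = x.
Proof.
move=> xs xM; have [ys fy] := beam_branchP s xM.
have := beam_contract ys xs; rewrite fy subrr enorm0 mulr0 => /(_ xM xM) h0.
apply/eqP; rewrite -subr_eq0; apply/eqP/enorm0_eq0/le_anti.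
by rewrite h0 enorm_ge0.
Qed.

Definition in_open_beam (s : int * int) (x : 'rV[R]_3) :=
  `|x 0 0 - 2 * (s.1 + s.2)%:~R| < 1 /\ `|x 0 1 - 2 * (s.1 - s.2)%:~R| < 1.

(** Since the third coordinate of [f x] is positive, the cell of [x] is even and
    [x] does not lie on a side of its beam, where [h] takes values in the
    equator. *)
Lemma upper_f_beam x : upper (f x) -> exists s, in_open_beam s x.
Proof.
move=> xM; have xc := in_cell_cell x; have [c0 c1] := xc.
set n := cell _ in xc c0 c1; set m := cell _ in xc c0 c1.
have fx2 : 0 < (f x) 0 2 by apply: lt_le_trans M0 xM.
move: fx2; rewrite (zorich_scaledE lambda h_bilip h_onto xc) rowZ vec3E.
rewrite pmulr_rgt0; last by rewrite mulr_gt0 ?expR_gt0.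
have su := square_fold xc; have [_ h2] := hemisphere_h h_onto su.
set u := cell_fold n m x in su h2 * => pos.
have [nm|nm] := sgn_cases R (n + m); last by move: pos; rewrite nm; lra.
have hn : h u 0 2 != 0 by move: pos; rewrite nm mul1r => /gt_eqF->.
have [p [q [np mq]]] := sgn_even nm; exists (p, q); rewrite /in_open_beam/= -np -mq.
have nb0 : `|u 0 0| != 1 /\ `|u 0 1| != 1.
  by split; apply/eqP => u1; move/eqP: hn; apply;
    apply: (boundary_to_equator h_bilip h_onto su); [left|right].
move: nb0; rewrite /u !mxE/= !normrM !normr_sgn !mul1r => -[n0 n1].
by split; rewrite lt_neqAle ?n0 ?n1.
Qed.

Lemma open_beam s x : in_open_beam s x -> in_beam s x.
Proof. by move=> [x0 x1]; split; exact: ltW. Qed.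

Lemma beam_unique s s' x : in_open_beam s x -> in_beam s' x -> s = s'.
Proof.
have key (t : R) (n n' : int) : `|t - 2 * n%:~R| < 1 -> `|t - 2 * n'%:~R| <= 1 -> n = n'.
  rewrite ltr_norml ler_norml => /andP[? ?] /andP[? ?].
  have a : n%:~R < (n' + 1)%:~R :> R by rewrite intrD; lra.
  have b : n'%:~R < (n + 1)%:~R :> R by rewrite intrD; lra.
  by move: a b; rewrite !ltr_int !ltzD1 => a b; apply/le_anti; rewrite a b.
case: s s' => [p q] [p' q'] [x0 x1] [/= x0' x1'].
have e0 := key _ _ _ x0 x0'; have e1 := key _ _ _ x1 x1'; rewrite /= in e0 e1.
by clear -e0 e1; congr pair; lia.
Qed.

Lemma beam_point_dist s x : in_beam s x -> enorm (beam_point s (x 0 2) - x) <= 2.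
Proof.
move=> [x0 x1]; apply: enorm3_le => //; rewrite !rowB !vec3E subrr expr0n addr0.
rewrite -opprB sqrrN -[X in X + _]real_normK ?num_real//.
rewrite -[X in _ + X ^+ 2]opprB sqrrN -[X in _ + X]real_normK ?num_real//.
have := normr_ge0 (x 0 0 - 2 * (s.1 + s.2)%:~R).
have := normr_ge0 (x 0 1 - 2 * (s.1 - s.2)%:~R); nra.
Qed.

Definition nonescaping : set 'rV[R]_3 := [set x | forall k, upper (iter k f x)].

Definition itinerary (s : nat -> int * int) x := forall k, in_beam (s k) (iter k f x).

Lemma nonescaping_itinerary x : nonescaping x -> exists s, itinerary s x.
Proof.
move=> xK; have [|s sx] := @choice _ _ (fun k s => in_open_beam s (iter k f x)).
  by move=> k; apply: upper_f_beam; exact: (xK k.+1).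
by exists s => k; exact: open_beam.
Qed.

Lemma itinerary_open s x k : nonescaping x -> itinerary s x ->
  in_open_beam (s k) (iter k f x).
Proof.
move=> xK sx; have [s' ox] := upper_f_beam (xK k.+1).
by rewrite -(beam_unique ox (sx k)).
Qed.

(** The summands bound the distance of a point from the point of the same height on
    the axis of its beam, and the distances between an orbit and a pseudo-orbit in
    space and in the model. *)
Definition shadow_radius := 2 + 3 * (2 / (1 - rate)) + 2 * M^-1 / (1 - M^-1).

Let r1 : 0 < 1 - rate. Proof. by have := rate_itv; lra. Qed.
Let r2 : 0 < 1 - M^-1. Proof. by have := invM_itv; lra. Qed.

Definition shadows (s : nat -> int * int) (w : nat -> R) x := forall k,
  enorm (beam_point (s k) (w k) - iter k f x) <= shadow_radius.

(** Beams have bounded width, so that the points on their axes at the heights of a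
    model orbit form a pseudo-orbit of [f]. *)
Lemma shadowing_point s w : model_orbit s w ->
  exists x, [/\ nonescaping x, itinerary s x & shadows s w x].
Proof.
move=> sw.
have [|k|v Hv] := @shadowing R _ (fun x y : 'rV[R]_3 => enorm (x - y)) upper
  (@edist_eq0 _ _) (@edistC _ _) (@ler_edistD _ _) 3 rate (fun k => beam_branch (s k))
  rate_itv (fun k => @beam_branch_upper (s k))
  (fun k => @beam_branch_contract (s k)) (fun k => beam_point (s k) (w k)) 2
  (@complete_half_space R M).
- by move=> k; apply: beam_point_upper; exact: (sw k).1.
- have Mk1 := beam_point_upper (s k.+1) (sw k.+1).1.
  have := beam_point_dist (beam_branchP (s k) Mk1).1.
  by rewrite beam_branch_height -/(model_branch _ _) -(sw k).2.
have vE k : iter k f (v 0) = v k.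
  elim: k => //= k ->; have [_ -> _] := Hv k; have [Hk1 _ _] := Hv k.+1.
  exact: (beam_branchP _ Hk1).2.
exists (v 0); split => k; rewrite vE.
- by have [] := Hv k.
- have [_ -> _] := Hv k; have [Hk1 _ _] := Hv k.+1.
  exact: (beam_branchP _ Hk1).1.
- have [_ _] := Hv k; move=> /le_trans; apply; rewrite /shadow_radius.
  have : 0 <= 2 * M^-1 / (1 - M^-1).
    by rewrite !mulr_ge0// ?invr_ge0 ?(ltW r2) ?(ltW M0).
  lra.
Qed.

(** Conversely the heights along an orbit of [f] are a pseudo-orbit of the model,
    because [log_height] contracts the bounded width of the beams. *)
Lemma shadowing_orbit s x : nonescaping x -> itinerary s x ->
  exists2 w, model_orbit s w & shadows s w x.
Proof.
move=> xK sx; pose z k := iter k f x 0 2.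
have [|k|w Hw] := @shadowing R _ (fun x y : R => `|x - y|) [set t | M <= t]
  (@dist_eq0 R) (@distrC _ _) (@dist_tri R) 1 M^-1 (fun k => model_branch (s k.+1))
  invM_itv (fun k => @model_branch_ge (s k.+1))
  (fun k => @model_branch_contract (s k.+1)) z (2 * M^-1) (@complete_ge R M).
- by move=> k; exact: (xK k).
- have -> : z k = log_height (iter k.+1 f x) by rewrite iterS log_height_f.
  rewrite (le_trans (log_height_lip _ _))//.
  + exact/upper_enorm/xK.
  + exact/upper_enorm/beam_point_upper/(xK k.+1).
  by rewrite mulrC ler_wpM2r ?invr_ge0 ?(ltW M0)// edistC beam_point_dist.
exists w => k; first by have [Hk wk _] := Hw k.
have [_ _] := Hw k; rewrite mul1r => wk.
apply: (le_trans (ler_edistD (beam_point (s k) (z k)) _ _)).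
rewrite beam_pointB distrC; have := beam_point_dist (sx k); rewrite -/(z k).
have : 0 <= 3 * (2 / (1 - rate)).
  by rewrite !mulr_ge0// ?invr_ge0 ?(ltW r1).
by rewrite /shadow_radius; lra.
Qed.

Lemma nonescaping_branch s x k : nonescaping x -> itinerary s x ->
  iter k f x = beam_branch (s k) (iter k.+1 f x).
Proof. by move=> xK sx; rewrite iterS beam_branchK//; exact: (xK k.+1). Qed.

Lemma points_close s s' x x' k : nonescaping x -> nonescaping x' ->
  itinerary s x -> itinerary s' x' -> (forall j, (j < k)%N -> s j = s' j) ->
  enorm (x - x') <= rate ^+ k * enorm (iter k f x - iter k f x').
Proof.
move=> xK x'K sx sx' ss'.
apply: (@orbits_close R _ (fun x y : 'rV[R]_3 => enorm (x - y)) upper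
  rate (fun k => beam_branch (s k)) rate_itv
  (fun k => @beam_branch_contract (s k)) (fun k => iter k f x)
  (fun k => iter k f x')) => // j jk.
- exact: nonescaping_branch.
- by rewrite ss'//; exact: nonescaping_branch.
Qed.

Lemma points_eq s w x x' : nonescaping x -> nonescaping x' ->
  itinerary s x -> itinerary s x' -> shadows s w x -> shadows s w x' -> x = x'.
Proof.
move=> xK x'K sx sx' wx wx'.
apply: (@orbits_eq R _ (fun x y : 'rV[R]_3 => enorm (x - y)) upper (@edist_eq0 _ _)
  rate (fun k => beam_branch (s k)) rate_itv
  (fun k => @beam_branch_contract (s k)) (fun k => iter k f x)
  (fun k => iter k f x') (shadow_radius + shadow_radius)) => // j.
- exact: nonescaping_branch.
- exact: nonescaping_branch.
- apply: (le_trans (ler_edistD (beam_point (s j) (w j)) _ _)).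
  by rewrite edistC lerD.
Qed.

Lemma orbits_eq_model s w w' x : model_orbit s w -> model_orbit s w' ->
  shadows s w x -> shadows s w' x -> w 0 = w' 0.
Proof.
move=> sw sw' wx wx'.
apply: (@orbits_eq R _ (fun x y : R => `|x - y|) [set t | M <= t] (@dist_eq0 R)
  M^-1 (fun k => model_branch (s k.+1)) invM_itv
  (fun k => @model_branch_contract (s k.+1)) _ _ (shadow_radius + shadow_radius)) => j.
- exact: (sw j).1.
- exact: (sw' j).1.
- exact: (sw j).2.
- exact: (sw' j).2.
- rewrite -(beam_pointB (s j)); apply: (le_trans (ler_edistD (iter j f x) _ _)).
  by rewrite lerD// edistC.
Qed.

End conjugacy.

(** * The straight brush *)

Section pullbacks.
Variable X : Type.
Implicit Types T : nat -> X -> X.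

Lemma pullback_eq T T' j k x :
  (forall i, (j <= i)%N -> (i < j + k)%N -> T i =1 T' i) ->
  pullback T j k x = pullback T' j k x.
Proof.
elim: k j => //= k IH j TT'; rewrite IH; last first.
  by move=> i ji ik; apply: TT'; [exact: ltnW | rewrite addnS -addSn].
by apply: TT'; rewrite ?leqnn// addnS ltnS leq_addr.
Qed.

Lemma pullback_add T j k l x :
  pullback T j (k + l) x = pullback T j k (pullback T (j + k) l x).
Proof.
elim: k j => [|k IH] j; first by rewrite addn0.
by rewrite addSn /= IH addSnnS.
Qed.

End pullbacks.

Lemma geometric_cvg (R : realType) (u : nat -> R) l b C : 0 <= b < 1 ->
  (forall n, `|u n - l| <= C * b ^+ n) -> u @ \oo --> l.
Proof.
move=> b01 ul; apply/cvgrPdist_lt => e e0; have [k Ck] := geometric_lt C b01 e0.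
have /andP[b0 b1] := b01.
exists k => // n /= kn; rewrite distrC (le_lt_trans (ul n))// (le_lt_trans _ Ck)//.
have C0 : 0 <= C by have := ul 0; rewrite expr0 mulr1; apply: le_trans.
by rewrite ler_wpM2l// ler_wiXn2l// ltW.
Qed.

Section brush.
Variables (R : realType) (L lambda : R).
Hypothesis L1 : 1 <= L.
Hypothesis lambda_gt0 : 0 < lambda.
Hypothesis lambda_lt : lambda < expR (- (ln L + L)).

Local Notation M := (level L lambda).
Local Notation branches s := (fun k => model_branch lambda (s k.+1)).

Let LM : L < M := level_gt lambda_gt0 lambda_lt.
Let M1 : 1 < M. Proof. by move: L1 LM; lra. Qed.
Let M0 : 0 < M. Proof. by move: M1; lra. Qed.

Definition symbols (a1 a2 : R) k := (code a1 k, code a2 k).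

(** The codes of the last two coordinates are the symbols of an orbit of the model,
    and the first coordinate is its initial height. *)
Definition model_brush : set 'rV[R]_3 := [set b | irrational2 (b 0 1, b 0 2) /\
  forall n, first_height L lambda (symbols (b 0 1) (b 0 2)) n <= b 0 0].

Definition hair_start (a1 a2 : R) : \bar R :=
  if pselect (irrational2 (a1, a2)) is left _
  then ereal_sup (range (fun n => (first_height L lambda (symbols a1 a2) n)%:E))
  else +oo%E.

Lemma hair_start_le a1 a2 (y : R) : (hair_start a1 a2 <= y%:E)%E <->
  irrational2 (a1, a2) /\ forall n, first_height L lambda (symbols a1 a2) n <= y.
Proof.
rewrite /hair_start; case: pselect => ai; last first.
  by split=> [|[]//]; rewrite leye_eq.
split=> [/ereal_supP sy|[_ sy]].
  by split=> // n; rewrite -lee_fin; apply: sy; exists n.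
by apply: ge_ereal_sup => _ [n _ <-]; rewrite lee_fin.
Qed.

Lemma model_brush_hairiness : hairiness model_brush hair_start.
Proof.
move=> a1 a2; split=> [|s].
  rewrite /hair_start; case: pselect => // ai; apply: le_ereal_sup_tmp.
  exists (first_height L lambda (symbols a1 a2) 0)%:E; first by exists 0%N.
  by rewrite lee_fin ltW.
by rewrite hair_start_le /model_brush /= !vec3E.
Qed.

Lemma first_height_eq s s' n : (forall j, (j < n)%N -> s j.+1 = s' j.+1) ->
  first_height L lambda s n = first_height L lambda s' n.
Proof.
move=> ss'; apply: pullback_eq => i _; rewrite add0n => /ss' e t.
by rewrite e.
Qed.

Lemma first_heightS s n :
  first_height L lambda s n <= first_height L lambda s n.+1.
Proof.
rewrite /first_height pullbackSr.
by apply: (model_pullback_le L1) => //; exact: (model_branch_ge L1).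
Qed.

Lemma first_height_le s n m : (n <= m)%N ->
  first_height L lambda s n <= first_height L lambda s m.
Proof.
have H : {homo first_height L lambda s : n m / (n <= m)%N >-> n <= m}.
  by apply: homo_leq => [x|x y z|k]; [exact: lexx|exact: le_trans|exact: first_heightS].
exact: H.
Qed.

(** Each of the [n] branches that are applied after the changed one contracts the
    difference by [M^-1]. *)
Lemma first_height_perturb s s' n N C :
  (forall j, j != n -> s j = s' j) ->
  (forall t, enorm (beam_point (s n) t - beam_point (s' n) t) <= C) ->
  `|first_height L lambda s N - first_height L lambda s' N| <= C * M^-1 ^+ n.
Proof.
move=> ss' sC; have C0 : 0 <= C := le_trans (enorm_ge0 _) (sC 0).
have MC : 0 <= C * M^-1 ^+ n by rewrite mulr_ge0// exprn_ge0// invr_ge0 ltW.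
have [Nn|nN] := ltnP N n.
  rewrite (@first_height_eq s s') ?subrr ?normr0// => j jN.
  by apply: ss'; rewrite ltn_eqF// (leq_ltn_trans jN).
case: n nN ss' sC MC => [|n] nN ss' sC MC.
  by rewrite (@first_height_eq s s') ?subrr ?normr0// => j jN; exact: ss'.
rewrite /first_height -(subnKC nN) addSnnS !pullback_add /= add0n.
set v := pullback _ n.+1 _ _; set v' := pullback _ n.+1 _ _.
have -> : v' = v.
  apply: pullback_eq => i ni _ t; rewrite ss'//.
  by rewrite gt_eqF.
have -> : forall x, pullback (branches s') 0 n x = pullback (branches s) 0 n x.
  move=> x; apply: pullback_eq => i _; rewrite add0n => ni t; rewrite ss'//.
  by rewrite ltn_eqF.
have Mv : M <= v by exact: (model_pullback_ge L1).
apply: (le_trans (@pullback_contract R R (fun x y => `|x - y|) [set t | M <= t]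
  M^-1 (branches s) (invM_itv L1 lambda_gt0 lambda_lt)
  (fun k => @model_branch_ge R L lambda L1 lambda_gt0 lambda_lt (s k.+1))
  (fun k => @model_branch_contract R L lambda L1 lambda_gt0 lambda_lt (s k.+1))
  0 n _ _ _ _)).
- exact: (model_branch_ge L1).
- exact: (model_branch_ge L1).
rewrite exprSr mulrCA ler_wpM2l ?exprn_ge0 ?invr_ge0 ?(ltW M0)// mulrC.
rewrite (le_trans (log_height_lip L1 lambda_gt0 lambda_lt _ _))//.
- exact/upper_enorm/beam_point_upper.
- exact/upper_enorm/beam_point_upper.
by rewrite ler_wpM2l// invr_ge0 ltW.
Qed.

(** In the beam of the origin the model branch is essentially a logarithm. *)
Lemma model_branch0_bound : exists2 t, M <= t & model_branch lambda (0, 0) t <= t.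
Proof.
pose t := M + 4 / lambda; exists t; first by rewrite lerDl divr_ge0// ltW.
have t0 : 0 < t by rewrite addr_gt0// divr_gt0.
have l4 : 4 <= lambda * t.
  by rewrite /t mulrDr mulrC [X in _ + X]mulrC divfK ?gt_eqF//; have := mulr_gt0 M0 lambda_gt0; lra.
have pt : enorm (beam_point (0, 0) t) = t.
  apply/eqP; rewrite -(@eqrXn2 _ 2) ?enorm_ge0 ?(ltW t0)// sqr_enorm3 !vec3E/=.
  by rewrite ?addr0 ?subr0 ?subrr mulr0z mulr0 expr0n !add0r.
rewrite /model_branch /log_height pt -ler_expR lnK ?posrE ?divr_gt0//.
rewrite ler_pdivrMr//.
have e1 : 1 + t / 2 <= expR (t / 2) by exact: expR_ge1Dx.
have -> : expR t = expR (t / 2) ^+ 2 by rewrite expr2 -expRD; congr expR; lra.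
have e2 : t / 2 * (t / 2) <= expR (t / 2) ^+ 2.
  by rewrite expr2; apply: ler_pM => //; lra.
apply: (@le_trans _ _ (t / 2 * (t / 2) * lambda)); last by rewrite ler_pM2r.
have -> : t / 2 * (t / 2) * lambda = t * ((lambda * t) / 4) by field.
by rewrite -[leLHS]mulr1 ler_pM2l// ler_pdivlMr//; lra.
Qed.

(** Pulling back an upper bound instead of the level bounds the heights from which
    a sequence that ends in zeros can be followed. *)
Lemma eventually0_bounded s k : (forall j, (k < j)%N -> s j = (0, 0)) ->
  exists y, forall n, first_height L lambda s n <= y.
Proof.
move=> s0; have [t Mt tt] := model_branch0_bound.
exists (pullback (branches s) 0 k t) => n.
apply: (le_trans (first_height_le s (leq_addl k n))).
rewrite /first_height pullback_add add0n; apply: (model_pullback_le L1) => //.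
  exact: (model_pullback_ge L1).
suff H m j : (k <= j)%N -> pullback (branches s) j m M <= t by exact: H.
elim: m j => //= m IH j kj; apply: le_trans tt.
rewrite s0//; have := IH j.+1 (leqW kj); rewrite le_eqVlt => /orP[/eqP->//|lt].
apply/ltW/(model_branch_lt L1) => //; exact: (model_pullback_ge L1).
Qed.

Lemma hair_start_fin a1 a2 : (hair_start a1 a2 < +oo)%E ->
  irrational2 (a1, a2) /\ exists y : R, hair_start a1 a2 = y%:E.
Proof.
move=> lt; have [ge _] := model_brush_hairiness a1 a2.
have fin : hair_start a1 a2 \is a fin_num.
  by rewrite ge0_fin_numE.
have E : hair_start a1 a2 = (fine (hair_start a1 a2))%:E by rewrite fineK.
split; last by exists (fine (hair_start a1 a2)).
by have /hair_start_le[] : (hair_start a1 a2 <= (fine (hair_start a1 a2))%:E)%E by rewrite -E.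
Qed.

Lemma hair_start_perturb a1 a2 b1 b2 C : irrational2 (b1, b2) ->
  (forall n, first_height L lambda (symbols b1 b2) n <=
             first_height L lambda (symbols a1 a2) n + C) ->
  (hair_start b1 b2 <= hair_start a1 a2 + C%:E)%E.
Proof.
move=> bi ab; have [lt|] := ltP (hair_start a1 a2) +oo%E; last first.
  by rewrite leye_eq => /eqP->; rewrite addye// leey.
have [ai [y yE]] := hair_start_fin lt; rewrite yE -EFinD hair_start_le; split=> // n.
have /hair_start_le[_ /(_ n)] : (hair_start a1 a2 <= y%:E)%E by rewrite yE.
by have := ab n; lra.
Qed.

Lemma hair_start_cvg a1 a2 (b1 b2 : nat -> R) C : (hair_start a1 a2 < +oo)%E ->
  (forall n, irrational2 (b1 n, b2 n)) ->
  (forall n N, `|first_height L lambda (symbols (b1 n) (b2 n)) N -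
             first_height L lambda (symbols a1 a2) N| <= C * M^-1 ^+ n) ->
  hair_start (b1 n) (b2 n) @[n --> \oo] --> hair_start a1 a2.
Proof.
move=> lt bi ab; have [ai [y yE]] := hair_start_fin lt.
have up n : (hair_start (b1 n) (b2 n) <= (y + C * M^-1 ^+ n)%:E)%E.
  rewrite EFinD -yE; apply: hair_start_perturb => // N.
  by have := ab n N; rewrite ler_norml => /andP[_]; lra.
have fin n : exists yn : R, hair_start (b1 n) (b2 n) = yn%:E.
  by apply: (hair_start_fin _).2; apply: (le_lt_trans (up n)); rewrite ltry.
have [yn ynE] := choice fin.
have -> : (fun n => hair_start (b1 n) (b2 n)) = (fun n => (yn n)%:E).
  by apply/funext => n; rewrite ynE.
rewrite yE; apply: cvg_EFin; first exact: nearW.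
apply: (@geometric_cvg _ _ _ M^-1 C); first exact: (invM_itv L1).
move=> n /=; have := up n; rewrite ynE lee_fin => u1.
have : (hair_start a1 a2 <= hair_start (b1 n) (b2 n) + (C * M^-1 ^+ n)%:E)%E.
  apply: hair_start_perturb => // N.
  by have := ab n N; rewrite ler_norml => /andP[+ _]; lra.
by rewrite yE ynE -EFinD lee_fin ler_norml => ?; apply/andP; split; lra.
Qed.

(** The sequences that approach a hair: [u n] shares all digits with [a] but the
    [n]-th.  The coding is lexicographic, so that the sign of [d] decides on which
    side of [a] the sequence runs, and that it is strictly monotone. *)
Lemma change_digit a (d : int) : irrational a -> exists u : nat -> R,
  [/\ forall n, irrational (u n), forall n j, j != n -> code (u n) j = code a j,
      forall n, code (u n) n = code a n + d & u @ \oo --> a].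
Proof.
move=> ai; pose s (n j : nat) := if j == n then code a j + d else code a j.
have dec (n : nat) : exists a' : R, irrational a' /\ code a' =1 s n.
  by have [a' a'i a's] := decode R (s n); exists a'.
have [u Hu] := choice dec; exists u; split => [n|n j jn|n|].
- by have [] := Hu n.
- by have [_ ->] := Hu n; rewrite /s (negbTE jn).
- by have [_ ->] := Hu n; rewrite /s eqxx.
- apply: (@geometric_cvg _ _ _ 4^-1 (`|u 0 - a| + 4)).
    by rewrite invr_ge0 ler0n/= invf_lt1; lra.
  case=> [|n]; first by rewrite expr0 mulr1 lerDl.
  have [ui uc] := Hu n.+1.
  have c : `|u n.+1 - a| <= 4^-1 ^+ n.
    by apply: code_close1 => // j jn; rewrite uc /s ltn_eqF.
  apply: (le_trans c).
  rewrite exprS mulrA -[leLHS]mul1r ler_wpM2r ?exprn_ge0 ?invr_ge0//.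
  by have := normr_ge0 (u 0 - a); lra.
Qed.

Lemma change_digit_increases a : irrational a -> exists u : nat -> R,
  [/\ forall n, irrational (u n), forall n j, j != n -> code (u n) j = code a j,
      forall n, code (u n) n = code a n - 1 & increases_to u a].
Proof.
move=> ai; have [u [ui uj un ua]] := change_digit (-1) ai; exists u; split => //.
split=> //; apply/increasing_seqP => n; apply: (@code_lt _ _ _ n) => //.
- by move=> j jn; rewrite !uj ?ltn_eqF// ltnS ltnW.
- by rewrite un [code (u n.+1) n]uj ?ltn_eqF//; lia.
Qed.

Lemma change_digit_decreases a : irrational a -> exists u : nat -> R,
  [/\ forall n, irrational (u n), forall n j, j != n -> code (u n) j = code a j,
      forall n, code (u n) n = code a n + 1 & decreases_to u a].
Proof.
move=> ai; have [u [ui uj un ua]] := change_digit 1 ai; exists u; split => //.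
split=> //; apply/decreasing_seqP => n; apply: (@code_lt _ _ _ n) => //.
- by move=> j jn; rewrite !uj ?ltn_eqF// ltnS ltnW.
- by rewrite un [code (u n.+1) n]uj ?ltn_eqF//; lia.
Qed.

Lemma beam_point_symbol p q p' q' t : `|p - p'| + `|q - q'| <= 1 ->
  enorm (beam_point (p, q) t - beam_point (p', q') t : 'rV[R]_3) <= 4.
Proof.
move=> pq; apply: enorm3_le => //; rewrite !rowB !vec3E /= subrr expr0n addr0.
rewrite -!mulrBr !exprMn -!intrB.
rewrite (_ : p + q - (p' + q') = (p - p') + (q - q')); last by lia.
rewrite (_ : p - q - (p' - q') = (p - p') - (q - q')); last by lia.
move: pq; move: (p - p') (q - q') => c d.
rewrite -(ler_int R) !intrD ?intrN !intr_norm.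
move: (c%:~R : R) (d%:~R : R) => {}c {}d cd.
have := normr_ge0 c; have := normr_ge0 d; have := real_normK (num_real c).
have := real_normK (num_real d); nra.
Qed.

Lemma hair_start_change_digit a1 a2 (b1 b2 : nat -> R) :
  (hair_start a1 a2 < +oo)%E -> (forall n, irrational2 (b1 n, b2 n)) ->
  (forall n j, j != n -> symbols (b1 n) (b2 n) j = symbols a1 a2 j) ->
  (forall n, `|code (b1 n) n - code a1 n| + `|code (b2 n) n - code a2 n| <= 1) ->
  hair_start (b1 n) (b2 n) @[n --> \oo] --> hair_start a1 a2.
Proof.
move=> lt bi bj bn; apply: (@hair_start_cvg _ _ _ _ 4) => // n N.
apply: first_height_perturb; first exact: bj.
by move=> t; apply: beam_point_symbol.
Qed.

(** Density holds because truncating the expansions gives sequences that end in zeros.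
    For the approximation of a hair by others in the same plane, one digit of one
    coordinate is changed by one: late changes hardly affect the height, by
    [first_height_perturb]. *)
Lemma model_brush_density : density hair_start.
Proof.
split=> [[a1 a2] [/= ai1 ai2] U /nbhs_ballP[e /= e0 eU]|a1 a2 lt].
  have q : 0 <= (4^-1 : R) < 1 by rewrite invr_ge0 ler0n/= invf_lt1; lra.
  have [k] := geometric_lt 1 q e0; rewrite mul1r => ke.
  have trunc a : irrational a -> exists a' : R, [/\ irrational a', `|a - a'| < e &
      forall j, (k < j)%N -> code a' j = 0].
    move=> ai; have [a' ai' ca'] := decode R (fun j => if (j <= k)%N then code a j else 0).
    exists a'; split => // [|j kj]; last by rewrite ca' leqNgt kj.
    by apply: le_lt_trans ke; apply: code_close1 => // j jk; rewrite ca' jk.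
  have [a1' [ai1' ae1 c1]] := trunc _ ai1; have [a2' [ai2' ae2 c2]] := trunc _ ai2.
  exists (a1', a2'); split; last by apply: eU; split.
  have [|y sy] := @eventually0_bounded (symbols a1' a2') k.
    by move=> j kj; rewrite /symbols c1// c2.
  by apply: (@le_lt_trans _ _ y%:E); rewrite ?ltry//= hair_start_le.
have [[ai1 ai2] _] := hair_start_fin lt.
split.
- have [u [ui uj un ua]] := change_digit_increases ai2; exists u => //.
  apply: (@hair_start_change_digit _ _ (fun=> a1) u) => //.
  + by move=> n; split=> /=.
  + by move=> n j jn; rewrite /symbols uj.
  + by move=> n; rewrite un subrr normr0 add0r addrAC subrr add0r normrN1.
- have [u [ui uj un ua]] := change_digit_decreases ai2; exists u => //.
  apply: (@hair_start_change_digit _ _ (fun=> a1) u) => //.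
  + by move=> n; split=> /=.
  + by move=> n j jn; rewrite /symbols uj.
  + by move=> n; rewrite un subrr normr0 add0r addrAC subrr add0r normr1.
- have [u [ui uj un ua]] := change_digit_increases ai1; exists u => //.
  apply: (@hair_start_change_digit _ _ u (fun=> a2)) => //.
  + by move=> n; split=> /=.
  + by move=> n j jn; rewrite /symbols uj.
  + by move=> n; rewrite un subrr normr0 addr0 addrAC subrr add0r normrN1.
- have [u [ui uj un ua]] := change_digit_decreases ai1; exists u => //.
  apply: (@hair_start_change_digit _ _ u (fun=> a2)) => //.
  + by move=> n; split=> /=.
  + by move=> n j jn; rewrite /symbols uj.
  + by move=> n; rewrite un subrr normr0 addr0 addrAC subrr add0r normr1.
Qed.

(** A model orbit that starts at [y] has height at most [growth y k] at time [k],
    so that its symbols are bounded as well. *)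
Fixpoint growth (y : R) k : R :=
  if k is k'.+1 then lambda * expR (growth y k') else y.

Lemma brush_orbit b : model_brush b -> model_orbit L lambda
  (symbols (b 0 1) (b 0 2)) (forward lambda (symbols (b 0 1) (b 0 2)) (b 0 0)).
Proof. by move=> [_]; exact: (first_height_orbit L1). Qed.

Lemma orbit_growth s w y k : model_orbit L lambda s w -> w 0 <= y ->
  w k <= growth y k.
Proof.
move=> sw wy; elim: k => //= k IH; have [Mk1 _] := sw k.+1; have [Mk wk] := sw k.
apply: (@le_trans _ _ (lambda * expR (w k))); last by rewrite ler_pM2l// ler_expR.
rewrite -(@ler_pXn2r _ 2) ?nnegrE//; last 2 first.
- by move: M0; lra.
- by rewrite mulr_ge0 ?expR_ge0 ?(ltW lambda_gt0).
rewrite wk (expR_model_branch L1)//.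
by rewrite lerDr addr_ge0 ?sqr_ge0.
Qed.

Lemma orbit_symbol s w y k : model_orbit L lambda s w -> w 0 <= y ->
  `|((s k.+1).1)%:~R| <= growth y k.+1 /\ `|((s k.+1).2)%:~R| <= growth y k.+1.
Proof.
move=> sw wy; have wk := orbit_growth k sw wy; have [_ wkE] := sw k.
have [Mk1 _] := sw k.+1; have := expR_model_branch L1 lambda_gt0 lambda_lt (s k.+1) Mk1.
rewrite -wkE intrD intrB => E.
have ge : lambda * expR (w k) <= growth y k.+1 by rewrite /= ler_pM2l// ler_expR.
have e0 : 0 <= lambda * expR (w k) by rewrite mulr_ge0 ?expR_ge0 ?(ltW lambda_gt0).
have := sqr_ge0 (w k.+1).
move: E e0 ge; set X := lambda * expR (w k); set G := growth _ _.
move: ((s k.+1).1%:~R) ((s k.+1).2%:~R) (w k.+1 ^+ 2) => p q v E e0 ge v0.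
have pq : p ^+ 2 <= X ^+ 2 /\ q ^+ 2 <= X ^+ 2.
  by have := sqr_ge0 p; have := sqr_ge0 q; split; nra.
by split; apply: le_trans ge; rewrite -(@ler_pXn2r _ 2) ?nnegrE//
  real_normK ?num_real//; case: pq.
Qed.

Lemma closure_enorm n (B : set 'rV[R]_n) b : closure B b ->
  forall e, 0 < e -> exists2 b', B b' & enorm (b' - b) < e.
Proof.
move=> Bb e e0; have [|b' [Bb' b'e]] := Bb [set b' | enorm (b' - b) < e].
  by apply/nbhs_enorm; exists e.
by exists b'.
Qed.

Lemma coord_close n (b b' : 'rV[R]_n) i e : enorm (b' - b) < e ->
  `|b' 0 i - b 0 i| < e.
Proof. by rewrite -rowB; apply: le_lt_trans; exact: coord_le_enorm. Qed.

Lemma symbols_near a1 a2 k : irrational2 (a1, a2) -> exists2 e : R, 0 < e &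
  forall a1' a2', `|a1' - a1| < e -> `|a2' - a2| < e ->
    forall j, (j < k)%N -> symbols a1' a2' j = symbols a1 a2 j.
Proof.
move=> [/= ai1 ai2]; have [e1 e1P c1] := code_near k ai1.
have [e2 e2P c2] := code_near k ai2; exists (Num.min e1 e2).
  by rewrite lt_min e1P.
move=> a1' a2'; rewrite !lt_min => /andP[d1 _] /andP[_ d2] j jk.
by rewrite /symbols (c1 _ d1 _ jk) (c2 _ d2 _ jk).
Qed.

(** Near a limit point the digits other than the first are bounded by [growth], so
    that its coordinates are irrational; the finitely many symbols that enter one
    inequality are then locally constant. *)
Lemma model_brush_closed : closed model_brush.
Proof.
move=> b clb.
have near1 e : 0 < e -> exists b', [/\ model_brush b',
    forall i, `|b' 0 i - b 0 i| < e & forall k,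
    `|(code (b' 0 1) k.+1)%:~R| <= growth (b 0 0 + 1) k.+1 /\
    `|(code (b' 0 2) k.+1)%:~R| <= growth (b 0 0 + 1) k.+1].
  move=> e0; have [|b' Bb' bb'] := closure_enorm clb (_ : 0 < Num.min e 1).
    by rewrite lt_min e0/=.
  have c i : `|b' 0 i - b 0 i| < Num.min e 1 := coord_close i bb'.
  exists b'; split => // [i|k]; first by have := c i; rewrite lt_min => /andP[].
  apply: (orbit_symbol k (brush_orbit Bb')).
  by have := c 0; rewrite /= lt_min ltr_norml ltr_norml => /andP[_ /andP[_]]; lra.
have irr : irrational2 (b 0 1, b 0 2).
  split; apply: (@bounded_code_irrational _ (fun k => growth (b 0 0 + 1) k.+1)) => e
    /near1[b' [[[? ?] _] bb' cb]]; [exists (b' 0 1)|exists (b' 0 2)];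
    by split => // k; have [] := cb k.
split=> // n; apply/ler_addgt0Pr => e e0.
have [e1 e1P se] := symbols_near n.+1 irr.
have [|b' [[bi' sb'] bb' _]] := near1 (Num.min e1 e); first by rewrite lt_min e1P.
have := sb' n; rewrite (@first_height_eq _ (symbols (b 0 1) (b 0 2))) => [h|j jn].
  by have := bb' 0; rewrite lt_min => /andP[_]; rewrite ltr_norml => /andP[_]; lra.
by apply: se => //; have := bb' 1; have := bb' 2; rewrite !lt_min => /andP[? _] /andP[? _].
Qed.

Lemma model_brush_straight : straight_brush model_brush.
Proof.
split; [|by exists hair_start; [exact: model_brush_hairiness|exact: model_brush_density]|
  exact: model_brush_closed].
move=> b [bi sb]; split=> //; apply: le_trans (sb 0%N).
exact: ltW.
Qed.

End brush.

(** * Homeomorphisms of the one-point compactifications *)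

Section compactified_homeomorphism.
Variables (R : realType) (m n : nat).

Lemma enorm_ball_compact r : compact [set x : 'rV[R]_m | `|x| <= r] /\
  closed [set x : 'rV[R]_m | `|x| <= r].
Proof.
have c : closed [set x : 'rV[R]_m | `|x| <= r].
  apply: (@preimage_closed _ _ (fun x : 'rV[R]_m => `|x|) [set t | t <= r]).
    by move=> x _; exact: norm_continuous.
  exact: closed_le.
split=> //; apply: bounded_closed_compact => //.
by exists r; split; [exact: num_real | move=> t rt x /= xr; exact: le_trans xr (ltW rt)].
Qed.

(** The second hypothesis is properness: outside a large ball, [phi] leaves every
    given compact set, which is continuity at infinity. *)
Lemma omap_continuous (A : set 'rV[R]_m) (phi : 'rV[R]_m -> 'rV[R]_n) :
  {within A, continuous phi} ->
  (forall r, exists r', forall b, A b -> enorm (phi b) <= r -> enorm b <= r') ->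
  {within add_infty A, continuous (omap phi :
    one_point_compactification 'rV[R]_m -> one_point_compactification 'rV[R]_n)}.
Proof.
move=> /subspace_continuousP cphi proper; apply/subspace_continuousP.
case=> [x|] Ax U.
  have {}Ax : A x by case: Ax => [[y Ay [<-]]|].
  move=> Ux; have := cphi _ Ax (Some @^-1` U) Ux.
  rewrite /nbhs/= /within/=; apply: filterS => y yU [[z Az [zy]]|//].
  by apply: yU; rewrite -zy.
move=> [C [cC _] CU].
have [r Cr] : exists r, forall x, C x -> enorm x <= r.
  have [r [_ rC]] := compact_bounded cC.
  exists (n%:R * (`|r| + 1)) => x Cx; apply: (le_trans (enorm_le_norm _)).
  rewrite ler_wpM2l//; apply: rC => //.
  by rewrite (le_lt_trans (ler_norm _))// ltrDl.
have [r' rr'] := proper r.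
exists [set x | `|x| <= `|r'|]; first by have [] := enorm_ball_compact `|r'|.
move=> [y|] /=; last by move=> _ _; apply: CU; right.
move=> [[z nz [<-]]|//] [[z' Az' [zz']]|//]; subst z'.
apply: CU; left; exists (phi z) => // /Cr /(rr' _ Az') zr'; apply: nz.
by apply: (le_trans (norm_le_enorm _)); apply: (le_trans zr'); exact: ler_norm.
Qed.

End compactified_homeomorphism.

Section homeomorphism_of_relation.
Variables (R : realType) (m n : nat).
Variables (A : set 'rV[R]_m) (B : set 'rV[R]_n) (E : 'rV[R]_m -> 'rV[R]_n -> Prop).
Hypothesis E_sub : forall a b, E a b -> A a /\ B b.
Hypothesis E_total : forall a, A a -> exists b, E a b.
Hypothesis E_onto : forall b, B b -> exists a, E a b.
Hypothesis E_fun : forall a b b', E a b -> E a b' -> b = b'.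
Hypothesis E_inj : forall a a' b, E a b -> E a' b -> a = a'.
Hypothesis E_cont : forall a b e, E a b -> 0 < e -> exists2 d, 0 < d &
  forall a' b', E a' b' -> enorm (a' - a) < d -> enorm (b' - b) < e.
Hypothesis E_cont_inv : forall a b e, E a b -> 0 < e -> exists2 d, 0 < d &
  forall a' b', E a' b' -> enorm (b' - b) < d -> enorm (a' - a) < e.
Hypothesis E_proper : forall r, exists r', forall a b, E a b ->
  (enorm a <= r -> enorm b <= r') /\ (enorm b <= r -> enorm a <= r').

(** A relation is used because both directions of the correspondence are
    constructed by shadowing, so that neither is a priori a function. *)
Lemma homeomorphism_of_relation : exists2 phi, homeo_on A B phi &
  exists2 Phi : one_point_compactification 'rV[R]_m -> one_point_compactification 'rV[R]_n,
    homeo_on (add_infty A) (add_infty B) Phi &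
    forall a, A a -> Phi (Some a) = Some (phi a).
Proof.
have [phi phiP] : exists phi : 'rV[R]_m -> 'rV[R]_n, forall a, A a -> E a (phi a).
  have [|phi phiP] := @choice _ _ (fun a b => A a -> E a b); last by exists phi.
  move=> a; have [/E_total[b ab]|na] := pselect (A a); first by exists b.
  by exists 0.
have [psi psiP] : exists psi : 'rV[R]_n -> 'rV[R]_m, forall b, B b -> E (psi b) b.
  have [|psi psiP] := @choice _ _ (fun b a => B b -> E a b); last by exists psi.
  move=> b; have [/E_onto[a ab]|nb] := pselect (B b); first by exists a.
  by exists 0.
have phiB a : A a -> B (phi a) by move=> /phiP/E_sub[].
have psiA b : B b -> A (psi b) by move=> /psiP/E_sub[].
have phiK a : A a -> psi (phi a) = a.
  by move=> Aa; have E1 := phiP _ Aa; have E2 := psiP _ (phiB _ Aa); exact: E_inj E2 E1.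
have psiK b : B b -> phi (psi b) = b.
  by move=> Bb; have E1 := psiP _ Bb; have E2 := phiP _ (psiA _ Bb); exact: E_fun E2 E1.
have phic : {within A, continuous phi}.
  apply/subspace_continuousP => a Aa U /nbhs_enorm[e e0 eU].
  have [d d0 dE] := E_cont (phiP _ Aa) e0.
  by apply/nbhs_enorm; exists d => // a' a'd Aa'; apply/eU/(dE a') => //; exact: phiP.
have psic : {within B, continuous psi}.
  apply/subspace_continuousP => b Bb U /nbhs_enorm[e e0 eU].
  have [d d0 dE] := E_cont_inv (psiP _ Bb) e0.
  by apply/nbhs_enorm; exists d => // b' b'd Bb'; apply/eU/(dE _ b') => //; exact: psiP.
exists phi.
  split=> //; last by exists psi => // a /set_mem; exact: phiK.
  split=> [a|a a' /set_mem Aa /set_mem Aa' aa'|b Bb].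
  - exact: phiB.
  - by rewrite -(phiK _ Aa) aa' phiK.
  - by exists (psi b); [exact: psiA | exact: psiK].
exists (omap phi) => //.
have omapK o : add_infty A o -> omap psi (omap phi o) = o.
  by case=> [[a Aa <-]| ->] //=; rewrite phiK.
split.
- split=> [z|z z' /set_mem Az /set_mem Az' zz'|z].
  + by case=> [[a Aa <-]| ->]; [left; exists (phi a) => //; exact: phiB | right].
  + by rewrite -(omapK _ Az) zz' omapK.
  + case=> [[b Bb <-]| ->]; last by exists None => //; right.
    by exists (Some (psi b)); [left; exists (psi b) => //; exact: psiA | rewrite /= psiK].
- apply: omap_continuous => // r; have [r' rE] := E_proper r; exists r' => a Aa.
  by have [_] := rE _ _ (phiP _ Aa).
- exists (omap psi); last by move=> o /set_mem; exact: omapK.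
  apply: omap_continuous => // r; have [r' rE] := E_proper r; exists r' => b Bb.
  by have [+ _] := rE _ _ (psiP _ Bb).
Qed.

End homeomorphism_of_relation.

(** * The brush and the non-escaping set are homeomorphic *)

Section brush_homeomorphism.
Variables (R : realType) (L lambda : R) (h : 'rV[R]_2 -> 'rV[R]_3).
Hypothesis h_bilip : bilipschitz_on (@square R) L h.
Hypothesis h_onto : h @` (@square R) = @upper_hemisphere R.
Hypothesis lambda_gt0 : 0 < lambda.
Hypothesis lambda_lt : lambda < expR (- (ln L + L)).

Local Notation f := (zorich_scaled lambda h).
Local Notation brush := (model_brush L lambda).
Local Notation nonescaping := (nonescaping L lambda h).
Local Notation radius := (shadow_radius L lambda).

Let L1 : 1 <= L := bilipschitz_ge1 h_bilip h_onto.

Definition address (b : 'rV[R]_3) := symbols (b 0 1) (b 0 2).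

Definition heights (b : 'rV[R]_3) := forward lambda (address b) (b 0 0).

(** A point of the brush carries an itinerary and a sequence of heights; its partner
    is the point that follows them at bounded distance. *)
Definition conjugate (b x : 'rV[R]_3) := [/\ brush b, nonescaping x,
  itinerary lambda h (address b) x & shadows L lambda h (address b) (heights b) x].

Lemma conjugate_total b : brush b -> exists x, conjugate b x.
Proof.
move=> Bb; have [x [Kx ix sx]] := shadowing_point h_bilip h_onto lambda_gt0 lambda_lt
  (brush_orbit L1 lambda_gt0 lambda_lt Bb).
by exists x.
Qed.

Lemma conjugate_onto x : nonescaping x -> exists b, conjugate b x.
Proof.
move=> Kx; have [s sx] := nonescaping_itinerary h_bilip h_onto lambda_gt0 lambda_lt Kx.
have [w sw wx] := shadowing_orbit h_bilip h_onto lambda_gt0 lambda_lt Kx sx.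
have [a1 ai1 ca1] := decode R (fun k => (s k).1).
have [a2 ai2 ca2] := decode R (fun k => (s k).2).
have as_ : symbols a1 a2 = s.
  by apply/funext => k; rewrite /symbols ca1 ca2 -surjective_pairing.
exists (vec3 (w 0) a1 a2); rewrite /conjugate /heights /address.
rewrite /model_brush /= !vec3E as_; split => //.
- by split=> // n; exact: (orbit_first_height L1).
- by move=> k; rewrite (orbit_forward L1 lambda_gt0 lambda_lt).
Qed.

Lemma conjugate_fun b x x' : conjugate b x -> conjugate b x' -> x = x'.
Proof.
move=> [Bb Kx ix sx] [_ Kx' ix' sx'].
exact: (points_eq h_bilip h_onto lambda_gt0 lambda_lt Kx Kx' ix ix' sx sx').
Qed.

Lemma conjugate_inj b b' x : conjugate b x -> conjugate b' x -> b = b'.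
Proof.
move=> [Bb Kx ix sx] [Bb' _ ix' sx'].
have ab : address b = address b'.
  apply/funext => k; apply: (beam_unique _ (ix' k)).
  exact: (itinerary_open h_bilip h_onto lambda_gt0 lambda_lt).
have [[bi1 bi2] _] := Bb; have [[bi1' bi2'] _] := Bb'.
apply: row3P.
- have ob := brush_orbit L1 lambda_gt0 lambda_lt Bb.
  have ob' := brush_orbit L1 lambda_gt0 lambda_lt Bb'.
  rewrite -/(address b') -ab in ob' sx'.
  have sx2 : shadows L lambda h (address b) (heights b') x by [].
  have := orbits_eq_model h_bilip h_onto lambda_gt0 lambda_lt ob _ sx sx2.
  by rewrite /heights -ab; exact.
- by apply: code_inj => // k; have := congr1 (fun s => (s k).1) ab.
- by apply: code_inj => // k; have := congr1 (fun s => (s k).2) ab.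
Qed.

Lemma continuous_iter_f k : continuous (iter k f).
Proof.
elim: k => [|k IH] x; first exact: cvg_id.
by apply: continuous_comp; [exact: IH | exact: (continuous_f h_bilip h_onto)].
Qed.

Lemma forward_eq s s' (y : R) k : (forall j, (j < k)%N -> s j.+1 = s' j.+1) ->
  forward lambda s y k = forward lambda s' y k.
Proof.
elim: k => //= k IH ss'; rewrite IH ?ss'// => j jk.
by apply: ss'; rewrite ltnS ltnW.
Qed.

Lemma continuous_forward s k : continuous (fun y : R => forward lambda s y k).
Proof.
elim: k => [|k IH] y; first exact: cvg_id.
have c : {for y, continuous (fun y : R => lambda * expR (forward lambda s y k))}.
  apply: continuousM; first exact: cst_continuous.
  by apply: continuous_comp; [exact: IH | exact: continuous_expR].
apply: (@continuous_comp R R R (fun y : R => (lambda * expR (forward lambda s y k)) ^+ 2 - _)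
  Num.sqrt); last exact: sqrt_continuous.
apply: continuousB; last exact: cst_continuous.
exact: (continuousM c c).
Qed.

Lemma conjugate_close b b' x x' k : conjugate b x -> conjugate b' x' ->
  (forall j, (j <= k)%N -> address b j = address b' j) ->
  enorm (x - x') <= rate L lambda ^+ k * (2 * radius + `|heights b k - heights b' k|).
Proof.
move=> [Bb Kx ix sx] [Bb' Kx' ix' sx'] bb'.
apply: (le_trans (points_close h_bilip h_onto lambda_gt0 lambda_lt (k := k) Kx Kx' ix ix' _)).
  by move=> j /ltnW; exact: bb'.
rewrite ler_wpM2l ?exprn_ge0//.
  by have /andP[] := rate_itv L1 lambda_gt0 lambda_lt.
have h1 := ler_edistD (beam_point (address b k) (heights b k)) (iter k f x) (iter k f x').
have h2 := ler_edistD (beam_point (address b' k) (heights b' k))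
  (beam_point (address b k) (heights b k)) (iter k f x').
have h3 := sx k; have h4 := sx' k.
rewrite (edistC (iter k f x) (beam_point _ _)) in h1; move: h1 h2 h3; rewrite bb'// beam_pointB; lra.
Qed.

(** Close points of the brush have the same symbols for a long time [k], after which
    their heights are still close; going back to time zero contracts the distance of
    the partners [k] times. *)
Lemma conjugate_cont b x e : conjugate b x -> 0 < e -> exists2 d, 0 < d &
  forall b' x', conjugate b' x' -> enorm (b' - b) < d -> enorm (x' - x) < e.
Proof.
move=> bx e0; have [k ke] := geometric_lt (2 * radius + 1) (rate_itv L1 lambda_gt0 lambda_lt) e0.
have [[bi _] _ _ _] := bx.
have [d1 d1P sym] := symbols_near k.+1 bi.
have /cvgrPdist_lt/(_ 1 ltr01)/nbhs_ballP[d2 /= d2P ht] :=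
  @continuous_forward (address b) k (b 0 0).
exists (Num.min d1 d2); first by rewrite lt_min d1P.
move=> b' x' bx' bb'; have c i := coord_close i bb'.
have [c0 [c1 c2]] : `|b' 0 0 - b 0 0| < d2 /\ `|b' 0 1 - b 0 1| < d1 /\ `|b' 0 2 - b 0 2| < d1.
  by have := c 0; have := c 1; have := c 2; rewrite !lt_min =>
    /andP[? _] /andP[? _] /andP[_ ?].
have ab j : (j <= k)%N -> address b j = address b' j.
  by move=> jk; rewrite [RHS](sym _ _ c1 c2).
rewrite edistC; apply: le_lt_trans ke; apply: (le_trans (conjugate_close bx bx' ab)).
have /andP[r0 _] := rate_itv L1 lambda_gt0 lambda_lt.
rewrite mulrC ler_wpM2r ?exprn_ge0// lerD2l.
have -> : heights b' k = forward lambda (address b) (b' 0 0) k.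
  by apply: forward_eq => j jk; rewrite -ab.
by apply/ltW/ht; rewrite /ball/= distrC.
Qed.

(** Orbits run in the interior of the beams, so that close points pass through the same
    beams for a long time; this makes both codes close, and the heights as well, since
    going back to time zero contracts the distance of the model orbits. *)
Lemma conjugate_cont_inv b x e : conjugate b x -> 0 < e -> exists2 d, 0 < d &
  forall b' x', conjugate b' x' -> enorm (x' - x) < d -> enorm (b' - b) < e.
Proof.
move=> bx e0; have [Bb Kx ix sx] := bx.
have q : 0 <= (4^-1 : R) < 1 by rewrite invr_ge0 ler0n/= invf_lt1; lra.
have e3 : 0 < e / 3 by rewrite divr_gt0.
have [k1 k1e] := geometric_lt 1 q e3.
have [k2 k2e] := geometric_lt (2 * radius + 1) (invM_itv L1 lambda_gt0 lambda_lt) e3.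
pose k := maxn k1 k2.
have iter_near j e' : 0 < e' -> exists2 d, 0 < d & forall x', enorm (x' - x) < d ->
    enorm (iter j f x' - iter j f x) < e'.
  by move: e'; apply/continuous_enormP; exact: continuous_iter_f.
have open_near j : exists2 d, 0 < d & forall x', enorm (x' - x) < d ->
    in_open_beam (address b j) (iter j f x').
  have [q0 q1] := itinerary_open h_bilip h_onto lambda_gt0 lambda_lt j Kx ix.
  have [|d d0 dE] := iter_near j (Num.min (1 - `|iter j f x 0 0 - 2 * ((address b j).1 + (address b j).2)%:~R|)
    (1 - `|iter j f x 0 1 - 2 * ((address b j).1 - (address b j).2)%:~R|)).
    by rewrite lt_min !subr_gt0 q0.
  exists d => // x' /dE; rewrite lt_min => /andP[h0 h1].
  have t0 := coord_close 0 h0; have t1 := coord_close 1 h1.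
  split.
  - apply: (le_lt_trans (ler_distD (iter j f x 0 0) _ _)); move: t0; rewrite ltrBrDr; exact.
  - apply: (le_lt_trans (ler_distD (iter j f x 0 1) _ _)); move: t1; rewrite ltrBrDr; exact.
have [d1 d1P sym] : exists2 d, 0 < d & forall x', enorm (x' - x) < d ->
    forall j, (j <= k)%N -> in_open_beam (address b j) (iter j f x').
  elim: k => [|k0 [d d0 dE]].
    have [d d0 dE] := open_near 0; exists d => // x' xd j.
    by rewrite leqn0 => /eqP->; exact: dE.
  have [d' d'0 d'E] := open_near k0.+1; exists (Num.min d d'); first by rewrite lt_min d0.
  move=> x'; rewrite lt_min => /andP[xd xd'] j; rewrite leq_eqVlt => /orP[/eqP->|].
    exact: d'E.
  by rewrite ltnS; exact: dE.
have [d2 d2P ht] := iter_near k 1 ltr01.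
exists (Num.min d1 d2); first by rewrite lt_min d1P.
move=> b' x' bx'; rewrite lt_min => /andP[xd1 xd2]; have [Bb' Kx' ix' sx'] := bx'.
have ab j : (j <= k)%N -> address b j = address b' j.
  by move=> jk; exact: beam_unique (sym _ xd1 _ jk) (ix' j).
have [[bi1 bi2] _] := Bb; have [[bi1' bi2'] _] := Bb'.
have dec r C j : 0 <= r < 1 -> 0 <= C -> (j <= k)%N -> C * r ^+ k <= C * r ^+ j :> R.
  by move=> /andP[r0 r1] C0 jk; rewrite ler_wpM2l// ler_wiXn2l// ltW.
have a1 : `|b' 0 1 - b 0 1| <= e / 3.
  apply: le_trans (ltW k1e); apply: le_trans (dec _ _ k1 q ler01 (leq_maxl _ _)).
  rewrite mul1r distrC; apply: code_close1 => // j jk.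
  exact: (congr1 fst (ab j jk)).
have a2 : `|b' 0 2 - b 0 2| <= e / 3.
  apply: le_trans (ltW k1e); apply: le_trans (dec _ _ k1 q ler01 (leq_maxl _ _)).
  rewrite mul1r distrC; apply: code_close1 => // j jk.
  exact: (congr1 snd (ab j jk)).
have rad0 : 0 <= radius := le_trans (enorm_ge0 _) (sx 0).
have y : `|b' 0 0 - b 0 0| < e / 3.
  apply: le_lt_trans k2e.
  apply: le_trans (dec _ (2 * radius + 1) k2 (invM_itv L1 lambda_gt0 lambda_lt) _ (leq_maxr _ _)); last first.
    by rewrite addr_ge0// mulr_ge0.
  rewrite distrC.
  have := orbits_close_model L1 lambda_gt0 lambda_lt (k := k)
    (brush_orbit L1 lambda_gt0 lambda_lt Bb) (brush_orbit L1 lambda_gt0 lambda_lt Bb') ab.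
  move=> /le_trans; apply; rewrite mulrC ler_wpM2r//.
    by rewrite exprn_ge0//; have /andP[] := invM_itv L1 lambda_gt0 lambda_lt.
  rewrite -/(heights b k) -/(heights b' k) -(beam_pointB (address b k)).
  apply: (le_trans (ler_edistD (iter k f x) _ _)).
  have h1 := sx k; have h2 := ltW (ht _ xd2).
  have : enorm (iter k f x - beam_point (address b k) (heights b' k)) <= 1 + radius.
    apply: (le_trans (ler_edistD (iter k f x') _ _)).
    by rewrite lerD//; [rewrite edistC | rewrite edistC ab//; exact: sx'].
  by lra.
apply: (@le_lt_trans _ _ (`|b' 0 0 - b 0 0| + `|b' 0 1 - b 0 1| + `|b' 0 2 - b 0 2|)); last by lra.
apply: enorm3_le; first by rewrite !addr_ge0.
rewrite !rowB -[(b' 0 0 - _) ^+ 2]real_normK ?num_real//.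
rewrite -[(b' 0 1 - _) ^+ 2]real_normK ?num_real// -[(b' 0 2 - _) ^+ 2]real_normK ?num_real//.
have := normr_ge0 (b' 0 0 - b 0 0); have := normr_ge0 (b' 0 1 - b 0 1).
have := normr_ge0 (b' 0 2 - b 0 2).
move: `|b' 0 0 - b 0 0| `|b' 0 1 - b 0 1| `|b' 0 2 - b 0 2| => u v w *.
have := mulr_ge0 (_ : 0 <= u) (_ : 0 <= v); nra.
Qed.

(** The first digits locate the initial beam: they determine the last two
    coordinates of [b] and the first two of [x] up to bounded errors. *)
Lemma conjugate_proper r : exists r', forall b x, conjugate b x ->
  (enorm b <= r -> enorm x <= r') /\ (enorm x <= r -> enorm b <= r').
Proof.
exists (30 * (`|r| + radius + 1)) => b x [_ _ _ /(_ 0%N)].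
set p := beam_point _ _ => px.
have rad0 : 0 <= radius := le_trans (enorm_ge0 _) px.
have r0 := normr_ge0 r; have rr := ler_norm r.
have xp : `|enorm p - enorm x| <= radius := le_trans (ler_enorm_dist _ _) px.
have fl (t : R) : `|t - (Num.floor t)%:~R| <= 1.
  have := real_floor_itv (num_real t); rewrite intrD => /andP[? ?].
  by rewrite ler_norml; apply/andP; split; lra.
have f1 := fl (b 0 1); have f2 := fl (b 0 2).
have [p0 [p1 p2]] : p 0 0 = 2 * ((Num.floor (b 0 1))%:~R + (Num.floor (b 0 2))%:~R) /\
   p 0 1 = 2 * ((Num.floor (b 0 1))%:~R - (Num.floor (b 0 2))%:~R) /\ p 0 2 = b 0 0.
  by rewrite /p !vec3E intrD intrB.
move: f1 f2 xp; rewrite !ler_norml => /andP[f1 f1'] /andP[f2 f2'] /andP[xp xp'].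
have cb i := coord_le_enorm b i; have cp i := coord_le_enorm p i.
split=> [br|xr].
  have := enorm3_sum p; rewrite p0 p1 p2.
  have : `|2 * ((Num.floor (b 0 1))%:~R + (Num.floor (b 0 2))%:~R)| <= 4 * `|r| + 4.
    have := cb 1; have := cb 2; rewrite !ler_norml => /andP[? ?] /andP[? ?].
    by apply/andP; split; lra.
  have : `|2 * ((Num.floor (b 0 1))%:~R - (Num.floor (b 0 2))%:~R)| <= 4 * `|r| + 4.
    have := cb 1; have := cb 2; rewrite !ler_norml => /andP[? ?] /andP[? ?].
    by apply/andP; split; lra.
  by have := cb 0; lra.
have := enorm3_sum b; have := cp 0; have := cp 1; have := cp 2; rewrite p0 p1 p2.
move=> c2 c1 c0.
have : `|b 0 1| <= enorm p + 1.
  by move: c1 c0; rewrite !ler_norml => /andP[? ?] /andP[? ?]; apply/andP; split; lra.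
have : `|b 0 2| <= enorm p + 1.
  by move: c1 c0; rewrite !ler_norml => /andP[? ?] /andP[? ?]; apply/andP; split; lra.
by lra.
Qed.

Lemma brush_homeomorphism : exists2 phi, homeo_on brush nonescaping phi &
  exists2 Phi : one_point_compactification 'rV[R]_3 -> one_point_compactification 'rV[R]_3,
    homeo_on (add_infty brush) (add_infty nonescaping) Phi &
    forall b, brush b -> Phi (Some b) = Some (phi b).
Proof.
apply: (@homeomorphism_of_relation R 3 3 brush nonescaping conjugate).
- by move=> b x [].
- exact: conjugate_total.
- exact: conjugate_onto.
- exact: conjugate_fun.
- exact: conjugate_inj.
- exact: conjugate_cont.
- exact: conjugate_cont_inv.
- exact: conjugate_proper.
Qed.

End brush_homeomorphism.

(** * Neighbourhoods under iteration *)

Section neighbourhoods.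
Variables (R : realType) (L lambda : R) (h : 'rV[R]_2 -> 'rV[R]_3).
Hypothesis h_bilip : bilipschitz_on (@square R) L h.
Hypothesis h_onto : h @` (@square R) = @upper_hemisphere R.
Hypothesis lambda_gt0 : 0 < lambda.
Hypothesis lambda_lt : lambda < expR (- (ln L + L)).

Local Notation f := (zorich_scaled lambda h).
Local Notation M := (level L lambda).

Let L1 : 1 <= L := bilipschitz_ge1 h_bilip h_onto.
Let LM : L < M := level_gt lambda_gt0 lambda_lt.
Let M1 : 1 < M. Proof. by move: L1 LM; lra. Qed.

(** Of two adjacent beams, one is mapped onto the half space that contains [y]. *)
Lemma preimage_near (y : 'rV[R]_3) X Y : y != 0 -> exists w : 'rV[R]_3,
  [/\ f w = y, `|w 0 0 - X| <= 2, `|w 0 1 - Y| <= 4 & w 0 2 = ln (enorm y / lambda)].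
Proof.
move=> y0; have yP : 0 < enorm y.
  by rewrite lt_def enorm_ge0 andbT; apply: contra_neq y0; exact: enorm0_eq0.
have [cX cY] := in_cell_cell (vec3 X Y 0); rewrite !vec3E in cX cY.
set n := cell X in cX; set m := cell Y in cY.
have [m' [mm' s0]] : exists m' : int, `|Y - 2 * m'%:~R| <= 3 /\ 0 <= sgn R (n + m') * y 0 2.
  have [s0|s0] := leP 0 (sgn R (n + m) * y 0 2); first by exists m; split=> //; lra.
  exists (m + 1); split; last first.
    by rewrite addrA sgnD [sgn R 1]/sgn expr1z mulrN1 mulNr oppr_ge0 ltW.
  by move: cY; rewrite !ler_norml intrD => /andP[? ?]; apply/andP; split; lra.
have [[w0 w1] fw] := branchP h_bilip h_onto lambda_gt0 yP s0.
exists (branch lambda h_onto n m' y); split => //.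
- by move: w0 cX; rewrite !ler_norml => /andP[? ?] /andP[? ?]; apply/andP; split; lra.
- by move: w1 mm'; rewrite !ler_norml => /andP[? ?] /andP[? ?]; apply/andP; split; lra.
- by rewrite /branch vec3E.
Qed.

(** The inverse branches along the orbit of a non-escaping point contract, so that
    the image of a neighbourhood under the [k]-th iterate contains a large part of
    the half space around the [k]-th point of the orbit. *)
Lemma iterate_contains_ball x s r k z : nonescaping L lambda h x ->
  itinerary lambda h s x -> upper L lambda z ->
  enorm (z - iter k f x) * rate L lambda ^+ k < r ->
  exists2 w, enorm (w - x) < r & iter k f w = z.
Proof.
move=> Kx ix uz zr.
pose T k := beam_branch lambda h_onto (s k).
have TU k' z' : upper L lambda z' -> upper L lambda (T k' z').
  exact: (beam_branch_upper h_bilip).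
exists (pullback T 0 k z).
  have {1}-> : x = pullback T 0 k (iter k f x).
    elim: k {zr} => // k IH; rewrite pullbackSr add0n.
    rewrite (_ : T k _ = iter k f x)//; apply/esym.
    exact: (nonescaping_branch h_bilip).
  apply: le_lt_trans zr; rewrite mulrC.
  apply: (@pullback_contract R _ (fun x y : 'rV[R]_3 => enorm (x - y)) (upper L lambda)
    (rate L lambda) T (rate_itv L1 lambda_gt0 lambda_lt) TU) => //.
  by move=> j; exact: (beam_branch_contract h_bilip).
elim: k z uz {zr} => // k IH z uz; rewrite pullbackSr add0n iterS IH; last exact: TU.
by have [] := beam_branchP h_bilip h_onto lambda_gt0 lambda_lt (s k) uz.
Qed.

(** A large ball of the half space contains a high column, whose image is a thick
    spherical shell; the shell contains a high column around a line that avoids the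
    inner ball, and the image of this second column reaches any given point
    other than the origin. *)
Lemma iterates_cover x (U : set 'rV[R]_3) y : nonescaping L lambda h x ->
  nbhs x U -> y != 0 -> exists2 k, (1 <= k)%N & (iter k f @` U) y.
Proof.
move=> Kx /nbhs_enorm[r r0 rU] y0.
have [s ix] := nonescaping_itinerary h_bilip h_onto lambda_gt0 lambda_lt Kx.
pose C := 8 + `|ln (enorm y / lambda)|.
have C0 : 0 <= C by rewrite addr_ge0.
have [k kr] := geometric_lt (C + 6) (rate_itv L1 lambda_gt0 lambda_lt) r0.
pose rho := enorm (iter k.+1 f x).
have rho1 : 1 < rho by apply: lt_le_trans M1 (upper_enorm (Kx k.+1)).
have [w [fw w0 w1 w2]] := preimage_near (rho + 2) 0 y0.
move: w0 w1; rewrite subr0 !ler_norml => /andP[w0 w0'] /andP[w1 w1'].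
have wrho : rho <= enorm w.
  by apply: le_trans (coord_le_enorm w 0); apply: le_trans (ler_norm _); lra.
have wC : enorm w <= rho + C.
  apply: (le_trans (enorm3_sum w)); rewrite w2 /C.
  have : `|w 0 0| <= rho + 4 by rewrite ler_norml; apply/andP; split; lra.
  have : `|w 0 1| <= 4 by rewrite ler_norml; apply/andP; split; lra.
  by lra.
have w_neq0 : w != 0 by apply: contraTneq wrho => ->; rewrite enorm0; lra.
have [z [fz z0 z1 z2]] := preimage_near (iter k f x 0 0) (iter k f x 0 1) w_neq0.
have xk2 : iter k f x 0 2 = ln (rho / lambda).
  rewrite /rho iterS (enorm_f h_bilip h_onto)// mulrAC divff ?gt_eqF// mul1r.
  by rewrite expRK.
have [ge le] : iter k f x 0 2 <= z 0 2 /\ z 0 2 <= iter k f x 0 2 + C.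
  have wP : 0 < enorm w by lra.
  rewrite xk2 z2 !ln_div ?posrE//; last by lra.
  have : ln rho <= ln (enorm w) by rewrite ler_ln ?posrE//; lra.
  have : ln (enorm w) <= ln rho + C.
    rewrite -[C]expRK -lnM ?posrE ?expR_gt0//; last by lra.
    rewrite ler_ln ?posrE ?mulr_gt0 ?expR_gt0//; last by lra.
    by apply: (le_trans wC); have := expR_ge1Dx C; nra.
  by split; lra.
have uz : upper L lambda z by rewrite /upper/=; apply: le_trans ge; exact: (Kx k).
have [|v vx fv] := @iterate_contains_ball x s r k z Kx ix uz.
  apply: le_lt_trans kr; rewrite ler_wpM2r//.
    by rewrite exprn_ge0//; have /andP[] := rate_itv L1 lambda_gt0 lambda_lt.
  apply: (le_trans (enorm3_sum _)); rewrite !rowB.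
  by rewrite [`|z 0 2 - _|]ger0_norm; lra.
exists k.+2 => //; exists v; first exact: rU.
by rewrite !iterS fv fz fw.
Qed.

(** Below the level, [f] maps into the unit ball, which lies below the level. *)
Lemma iterates_bounded x : ~ nonescaping L lambda h x -> exists2 U, nbhs x U &
  exists r, 0 <= r /\ forall k, (1 <= k)%N -> forall z, (iter k f @` U) z -> enorm z <= r.
Proof.
move=> /existsNP[k0 /negP]; rewrite -ltNge => xk0.
have small (z : 'rV[R]_3) : z 0 2 < M -> enorm (f z) < 1.
  move=> zM; rewrite (enorm_f h_bilip h_onto)//.
  have lt : lambda * expR (z 0 2) < lambda * expR M by rewrite ltr_pM2l// ltr_expR.
  apply: (lt_le_trans lt); rewrite -(level_exp h_bilip h_onto lambda_gt0).
  by rewrite ler_peMr// mulr_ge0 ?expR_ge0// ltW.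
pose r := \sum_(j < k0.+1) enorm (iter j f x) + 1.
have rj j : (j <= k0)%N -> enorm (iter j f x) + 1 <= r.
  move=> jk; rewrite /r lerD2r (bigD1 (Ordinal (jk : (j < k0.+1)%N)))//= lerDl.
  by apply: sumr_ge0 => i _; exact: enorm_ge0.
have r1 : 1 <= r by rewrite lerDr sumr_ge0// => i _; exact: enorm_ge0.
have near k : exists2 U, nbhs x U & forall z, U z -> forall j, (j <= k)%N ->
    enorm (iter j f z - iter j f x) < Num.min 1 (M - iter k0 f x 0 2).
  have e0 : 0 < Num.min 1 (M - iter k0 f x 0 2) by rewrite lt_min subr_gt0 xk0 ltr01.
  have one j : exists2 U, nbhs x U & forall z, U z ->
      enorm (iter j f z - iter j f x) < Num.min 1 (M - iter k0 f x 0 2).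
    have fj : {for x, continuous (iter j f)}.
      exact: (continuous_iter_f h_bilip h_onto lambda_gt0).
    have /continuous_enormP/(_ _ e0)[d d0 dE] := fj.
    by exists [set z | enorm (z - x) < d] => //; apply/nbhs_enorm; exists d.
  elim: k => [|k [U Ux UE]].
    have [U Ux UE] := one 0%N; exists U => // z /UE ? j.
    by rewrite leqn0 => /eqP->.
  have [V Vx VE] := one k.+1; exists (U `&` V); first exact: filterI.
  move=> z [Uz Vz] j; rewrite leq_eqVlt => /orP[/eqP->|]; first exact: VE.
  by rewrite ltnS; exact: UE.
have [U Ux UE] := near k0; exists U => //; exists r; split; first by lra.
move=> k k1 _ [z Uz <-]; have [kk0|kk0] := leqP k k0.
  have := UE _ Uz _ kk0; rewrite lt_min => /andP[zx _].
  have := ler_enorm_dist (iter k f z) (iter k f x); rewrite ler_norml => /andP[_].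
  by have := rj _ kk0; lra.
have below : iter k0 f z 0 2 < M.
  have := UE _ Uz _ (leqnn k0); rewrite lt_min => /andP[_].
  by move=> /(coord_close 2); rewrite ltr_norml => /andP[_]; lra.
rewrite -(subnK kk0) iterD iterS; apply/ltW/(lt_le_trans _ r1).
elim: (k - k0.+1)%N => [|i IH]; first exact: small.
rewrite iterS; apply: small; apply: le_lt_trans (ler_norm _) _.
by apply: le_lt_trans (coord_le_enorm _ _) _; move: M1; lra.
Qed.

End neighbourhoods.

(** * A plate has positive conformal capacity *)

Lemma continuous_normP (R : realType) n (g : 'rV[R]_n -> R) x :
  {for x, continuous g} <-> forall e, 0 < e -> exists2 d, 0 < d &
    forall z, enorm (z - x) < d -> `|g z - g x| < e.
Proof.
split=> [gx e e0|gx U /nbhs_ballP[e /= /gx[d d0 dg] eU]].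
  have /gx/nbhs_enorm[d d0 dg] : nbhs (g x) [set y | `|y - g x| < e].
    by apply/nbhs_ballP; exists e => //= y; rewrite /ball/= distrC.
  by exists d.
by apply/nbhs_enorm; exists d => // z /dg gz; apply: eU; rewrite /ball/= distrC.
Qed.

Section measurability.
Variable R : realType.

Definition grid m (t : R) : R := (Num.floor (m.+1%:R * t))%:~R / m.+1%:R.

Lemma grid_close m (t : R) : `|grid m t - t| <= m.+1%:R^-1.
Proof.
have m0 : 0 < m.+1%:R :> R by rewrite ltr0n.
have /andP[] := real_floor_itv (num_real (m.+1%:R * t)).
rewrite intrD /grid; set n := (_)%:~R => n1 n2.
have -> : n / m.+1%:R - t = (n - m.+1%:R * t) / m.+1%:R by field; rewrite gt_eqF.
rewrite normrM normfV (gtr0_norm m0) ler_pdivrMr// mulVf ?gt_eqF//.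
by rewrite ler_norml; apply/andP; split; lra.
Qed.

(** A continuous function of three variables is the pointwise limit of its values at
    the points of finer and finer grids, and these take countably many values. *)
Lemma measurable_continuous3 (g : 'rV[R]_3 -> R) : continuous g ->
  measurable_fun setT (fun p : measurableTypeR R * measurableTypeR R * measurableTypeR R =>
    g (vec3 p.1.1 p.1.2 p.2)).
Proof.
move=> cg.
apply: (@measurable_fun_cvg _ _ _ _
  (fun m p => g (vec3 (grid m p.1.1) (grid m p.1.2) (grid m p.2)))) => [m|p _].
  move=> _ Y mY; rewrite setTI.
  pose F (k : int * int * int) : set (measurableTypeR R * measurableTypeR R * measurableTypeR R) :=
    [set p | [/\ Num.floor (m.+1%:R * p.1.1) = k.1.1, Num.floor (m.+1%:R * p.1.2) = k.1.2 &
      Num.floor (m.+1%:R * p.2) = k.2] /\ Y (g (vec3 (k.1.1%:~R / m.+1%:R) (k.1.2%:~R / m.+1%:R)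
        (k.2%:~R / m.+1%:R)))].
  have -> : (fun p => g (vec3 (grid m p.1.1) (grid m p.1.2) (grid m p.2))) @^-1` Y =
      \bigcup_k F k.
    apply/seteqP; split=> p.
      by exists (Num.floor (m.+1%:R * p.1.1), Num.floor (m.+1%:R * p.1.2), Num.floor (m.+1%:R * p.2)).
    by move=> [k _ [[k1 k2 k3]]]; rewrite -k1 -k2 -k3.
  apply: countable_bigcupT_measurable; first exact: countableP.
  have mfl (z : int) : measurable [set t : measurableTypeR R | Num.floor (m.+1%:R * t) = z].
    have m0 : 0 < m.+1%:R :> R by rewrite ltr0n.
    rewrite (_ : [set t | _] = `[z%:~R / m.+1%:R, (z + 1)%:~R / m.+1%:R[%classic).
      exact: measurable_itv.
    apply/seteqP; split=> t /=; rewrite in_itv/= ler_pdivrMr// ltr_pdivlMr// [t * _]mulrC.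
      by move=> <-; exact: real_floor_itv (num_real _).
    by move=> h; exact: floor_def.
  move=> k; have [Yk|Yk] := pselect (Y (g (vec3 (k.1.1%:~R / m.+1%:R) (k.1.2%:~R / m.+1%:R)
        (k.2%:~R / m.+1%:R)))); last first.
    rewrite (_ : F k = set0); first exact: measurable0.
    by apply/seteqP; split=> // p [].
  rewrite (_ : F k = ([set t | Num.floor (m.+1%:R * t) = k.1.1] `*`
     [set t | Num.floor (m.+1%:R * t) = k.1.2]) `*` [set t | Num.floor (m.+1%:R * t) = k.2]).
    by apply: measurableX; [apply: measurableX|]; exact: mfl.
  by apply/seteqP; split=> p; [move=> [[? ? ?] _]|move=> [[? ?] ?]].
apply/cvgrPdist_lt => e e0.
have /cvgrPdist_lt/(_ _ e0)/nbhs_enorm[d d0 dE] := cg (vec3 p.1.1 p.1.2 p.2).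
exists (Num.truncn (3 / d)).+1 => // m /= dm.
apply: dE; apply: (le_lt_trans (enorm3_sum _)); rewrite !rowB !vec3E.
have h1 := grid_close m p.1.1; have h2 := grid_close m p.1.2; have h3 := grid_close m p.2.
have m0 : 0 < m.+1%:R :> R by rewrite ltr0n.
have h : 3 / d < m.+1%:R.
  by apply: (lt_le_trans (truncnS_gt (3 / d))); rewrite ler_nat (leq_trans dm)// leqnSn.
have : m.+1%:R^-1 + m.+1%:R^-1 + m.+1%:R^-1 < d.
  rewrite (_ : _ + _ = 3 / m.+1%:R); last by ring.
  by rewrite ltr_pdivrMr// mulrC -ltr_pdivrMr.
by apply: le_lt_trans; rewrite !lerD.
Qed.

End measurability.

Section lebesgue_product.
Variable R : realType.
Local Notation mu := (@lebesgue_measure R).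
Local Notation T1 := (measurableTypeR R).

Lemma sigma_finite_leb2 : sigma_finite setT (leb2 R).
Proof.
have /sigma_finiteP[F [TF ndF Foo]] := @sigma_finiteT _ _ _ mu.
exists (fun n => F n `*` F n).
  apply/seteqP; split=> // -[x y] _.
  have : [set: T1] x by [].
  have : [set: T1] y by [].
  rewrite TF => -[n _ Fny] [k _ Fkx].
  exists (maxn n k) => //; split => /=.
    by move: x Fkx; exact/subsetPset/ndF/leq_maxr.
  by move: y Fny; exact/subsetPset/ndF/leq_maxl.
move=> k; have [mF Fk] := Foo k.
split; first exact: measurableX.
by rewrite /leb2 product_measure1E// lte_mul_pinfty// ge0_fin_numE.
Qed.

HB.instance Definition _ := Measure.copy (leb2 R) (mu \x mu)%E.
HB.instance Definition _ := Measure_isSigmaFinite.Build _ _ _ (leb2 R) sigma_finite_leb2.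

Lemma tonelli3 (g : T1 * T1 * T1 -> \bar R) : measurable_fun setT g ->
  (forall p, (0 <= g p)%E) ->
  (\int[leb3 R]_(p in setT) g p = \int[leb2 R]_q \int[mu]_t g (q, t))%E.
Proof. by move=> mg g0; exact: fubini_tonelli1. Qed.

Lemma measurable_tonelli3 (g : T1 * T1 * T1 -> \bar R) : measurable_fun setT g ->
  (forall p, (0 <= g p)%E) ->
  measurable_fun setT ((fun q => \int[mu]_t g (q, t))%E : T1 * T1 -> \bar R).
Proof. by move=> mg g0; exact: measurable_fun_fubini_tonelli_F. Qed.

Lemma lebesgue_itvcc (a b : R) : a <= b -> mu `[a, b]%classic = (b - a)%:E.
Proof.
rewrite le_eqVlt => /orP[/eqP->|ab]; first by rewrite lebesgue_measure_itv/= ltxx subrr.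
by rewrite lebesgue_measure_itv/= lte_fin ab EFinB.
Qed.

Lemma leb2_rectangle (a b c d : R) : a <= b -> c <= d ->
  leb2 R (`[a, b]%classic `*` `[c, d]%classic) = ((b - a) * (d - c))%:E.
Proof.
move=> ab cd; rewrite EFinM -!lebesgue_itvcc//.
exact: product_measure1E.
Qed.

Lemma leb3_box (a b c d e f : R) : a <= b -> c <= d -> e <= f ->
  leb3 R ((`[a, b]%classic `*` `[c, d]%classic) `*` `[e, f]%classic) =
  ((b - a) * (d - c) * (f - e))%:E.
Proof.
move=> ab cd ef; rewrite EFinM -lebesgue_itvcc// -leb2_rectangle//.
by apply: product_measure1E => //; exact: measurableX.
Qed.

HB.instance Definition _ := Measure.copy (leb3 R) (leb2 R \x mu)%E.

End lebesgue_product.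

Section plate.
Variable R : realType.
Local Notation mu := (@lebesgue_measure R).

(** Young's inequality in the form [s <= s^3 / d^2 + d] replaces Hoelder's
    inequality in the estimate of the energy on a line. *)
Lemma young_cube (s d : R) : 0 <= s -> 0 < d -> s <= (d ^+ 2)^-1 * s ^+ 3 + d.
Proof.
move=> s0 d0; have d2 : 0 < d ^+ 2 by rewrite exprn_gt0.
have [sd|ds] := leP s d; first by rewrite (le_trans sd)// lerDr mulr_ge0 ?exprn_ge0// invr_ge0 ltW.
apply: (@le_trans _ _ ((d ^+ 2)^-1 * s ^+ 3)); last by rewrite lerDl ltW.
rewrite mulrC ler_pdivlMr//.
by rewrite [leRHS]exprS ler_wpM2l// ler_pXn2r ?nnegrE// ltW.
Qed.

(** The integral of [v'] over the interval is at least [1], and [young_cube] with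
    [d = (2 * (b - a))^-1] bounds it by [d ^- 2] times the energy plus [1 / 2]. *)
Lemma line_energy (v v' g : R -> R) (a b : R) : a < b ->
  (forall t : R, is_derive t 1 v (v' t)) -> continuous v' -> continuous g ->
  (forall t, `|v' t| <= g t) -> v a = 0 -> 1 <= v b ->
  (((((2 * (b - a))^-1) ^+ 2 / 2)%:E <= \int[mu]_(t in setT) (g t ^+ 3)%:E))%E.
Proof.
move=> ab dv cv' cg vg va vb.
set d := (2 * (b - a))^-1.
have d0 : 0 < d by rewrite invr_gt0 mulr_gt0// subr_gt0.
have g0 t : 0 <= g t := le_trans (normr_ge0 _) (vg t).
have cg3 : continuous (fun t => g t ^+ 3).
  move=> t; exact: (continuousM (cg t) (continuousM (cg t) (cg t))).
have mg3 : measurable_fun setT ((fun t => (g t ^+ 3)%:E) : measurableTypeR R -> \bar R).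
  by apply/measurable_EFinP; exact: continuous_measurable_fun.
have FTC : (\int[mu]_(t in `[a, b]) (v' t)%:E = (v b)%:E - (v a)%:E)%E.
  apply: continuous_FTC2 => //.
  - exact: continuous_subspaceT.
  - split=> [t _||].
    + by have [] := dv t.
    + apply: cvg_at_right_filter; apply: differentiable_continuous.
      by apply/derivable1_diffP; have [] := dv a.
    + apply: cvg_at_left_filter; apply: differentiable_continuous.
      by apply/derivable1_diffP; have [] := dv b.
  - by move=> t _; rewrite derive1E; have [] := dv t.
have int1 : (1%:E <= \int[mu]_(t in `[a, b]) ((d ^+ 2)^-1 * g t ^+ 3 + d)%:E)%E.
  apply: (@le_trans _ _ (\int[mu]_(t in `[a, b]) (v' t)%:E)%E).
    by rewrite FTC va sube0 lee_fin.
  apply: le_integral => //.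
  - apply: continuous_compact_integrable; first exact: segment_compact.
    exact: continuous_subspaceT.
  - apply: continuous_compact_integrable; first exact: segment_compact.
    apply: continuous_subspaceT => t; apply: cvgD; last exact: cvg_cst.
    by apply: cvgM; [exact: cvg_cst | exact: cg3].
  - move=> t _; rewrite lee_fin; apply: (le_trans (ler_norm _)).
    apply: (le_trans (vg t)); exact: young_cube.
pose I := (\int[mu]_(t in `[a, b]) (g t ^+ 3)%:E)%E.
have I0 : (0 <= I)%E by apply: integral_ge0 => t _; rewrite lee_fin exprn_ge0.
have IT : (I <= \int[mu]_(t in setT) (g t ^+ 3)%:E)%E.
  apply: ge0_subset_integral => //.
  by move=> t _; rewrite lee_fin exprn_ge0.
apply: le_trans IT.
have d2 : 0 < d ^+ 2 by rewrite exprn_gt0.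
have mg3' : measurable_fun `[a, b] ((fun t => (g t ^+ 3)%:E) : measurableTypeR R -> \bar R).
  exact: measurable_funS mg3.
have : (1%:E <= ((d ^+ 2)^-1)%:E * I + (2^-1)%:E)%E.
  apply: (le_trans int1).
  under eq_integral do rewrite EFinD EFinM.
  rewrite ge0_integralD//; last 3 first.
  - by move=> t _; rewrite -EFinM lee_fin mulr_ge0 ?invr_ge0 ?exprn_ge0 ?(ltW d0).
  - by apply: emeasurable_funM => //; exact: measurable_cst.
  - by move=> t _; rewrite lee_fin ltW.
  rewrite ge0_integralZl_EFin//; last 2 first.
  - by move=> t _; rewrite lee_fin exprn_ge0.
  - by rewrite invr_ge0 ltW.
  rewrite integral_cst//= lebesgue_measure_itv/= lte_fin ab -EFinD -EFinM.
  rewrite (_ : d * (b - a) = 2^-1)// /d.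
  by field; rewrite subr_eq0 gt_eqF.
move: I0; rewrite -/I; case: I => [r| |] //; last by move=> *; rewrite leey.
rewrite !lee_fin => r0 h.
rewrite -(@ler_pM2l _ (d ^+ 2)^-1) ?invr_gt0// mulrA mulVf ?gt_eqF//; lra.
Qed.

Lemma continuous_gradient_norm (u : 'rV[R]_3 -> R) : smooth u ->
  continuous (fun x => enorm (gradient u x)).
Proof.
move=> su x; have c i : continuous (fun x => 'D_(delta_mx 0 i) u x) by have [] := su 1%N i.
apply/continuous_normP => e e0; have e3 : 0 < e / 3 by rewrite divr_gt0.
have /continuous_normP/(_ _ e3)[d0 d0P c0] := c 0 x.
have /continuous_normP/(_ _ e3)[d1 d1P c1] := c 1 x.
have /continuous_normP/(_ _ e3)[d2 d2P c2] := c 2 x.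
exists (Num.min d0 (Num.min d1 d2)); first by rewrite !lt_min d0P d1P.
move=> y; rewrite !lt_min => /andP[/c0 h0 /andP[/c1 h1 /c2 h2]].
apply: (le_lt_trans (ler_enorm_dist _ _)); apply: (le_lt_trans (enorm3_sum _)).
rewrite !rowB !mxE; apply: (lt_le_trans (ltrD (ltrD h0 h1) h2)).
by rewrite (_ : e / 3 + e / 3 + e / 3 = e); [|field].
Qed.

(** On every vertical line through the plate an admissible function climbs from [0]
    to [1] within a bounded distance, which costs a fixed amount of energy. *)
Lemma plate_capacity (rho : R) : ~ compact_capacity0
  [set x : 'rV[R]_3 | [/\ x 0 2 = rho, 0 <= x 0 0 <= 1 & 0 <= x 0 1 <= 1]].
Proof.
move=> [A [_ [S0 [_ AS]] FA inf0]].
pose S := `|S0| + 1.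
have {}AS x : A x -> `|x| <= S by apply: AS; rewrite (le_lt_trans (ler_norm _))// ltrDl.
pose a := - (S + `|rho| + 1).
have S1 : 0 <= S by rewrite addr_ge0.
have ab : a < rho by have := ler_norm (- rho); rewrite normrN /a; have := normr_ge0 rho; lra.
set c := ((2 * (rho - a))^-1) ^+ 2 / 2.
have c0 : 0 < c by rewrite divr_gt0// exprn_gt0// invr_gt0 mulr_gt0// subr_gt0.
suff : (c%:E <= 0)%E by rewrite lee_fin leNgt c0.
rewrite -inf0; apply/ereal_infP => _ [u [su cu uA uF] <-].
pose g x := enorm (gradient u x).
have cg : continuous g by exact: continuous_gradient_norm.
have cv q1 q2 : continuous (fun t : R => vec3 q1 q2 t).
  move=> t U /nbhs_enorm[e e0 eU]; apply/nbhs_ballP; exists e => //= t' tt'.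
  apply: eU; apply: (le_lt_trans (enorm3_sum _)); rewrite !rowB !vec3E !subrr !normr0 !add0r.
  by rewrite distrC.
rewrite /conformal_energy -/g.
have mg : measurable_fun setT
    (fun p : measurableTypeR R * measurableTypeR R * measurableTypeR R =>
      (enorm (gradient u (vec3 p.1.1 p.1.2 p.2)) ^+ 3)%:E).
  apply/measurable_EFinP; apply: measurable_funX.
  exact: (measurable_continuous3 cg).
have g0 (p : measurableTypeR R * measurableTypeR R * measurableTypeR R) :
    (0 <= (enorm (gradient u (vec3 p.1.1 p.1.2 p.2)) ^+ 3)%:E)%E.
  by rewrite lee_fin exprn_ge0 ?enorm_ge0.
rewrite (tonelli3 mg g0).
pose D : set (measurableTypeR R * measurableTypeR R) := `[0, 1]%classic `*` `[0, 1]%classic.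
have mD : measurable D by apply: measurableX; exact: measurable_itv.
have energy q : D q -> (c%:E <= \int[mu]_(t in setT)
    (enorm (gradient u (vec3 q.1 q.2 t)) ^+ 3)%:E)%E.
  move=> [/= q1 q2].
  have [u1 uc] := su 1%N 2.
  have uvec (t : R) : is_derive t 1 (fun t => u (vec3 q.1 q.2 t))
      ('D_(delta_mx 0 2) u (vec3 q.1 q.2 t)).
    have E : (fun k : R => k^-1 *: (((fun t => u (vec3 q.1 q.2 t)) \o shift t) (k *: 1) -
        u (vec3 q.1 q.2 t))) =
      (fun k : R => k^-1 *: ((u \o shift (vec3 q.1 q.2 t)) (k *: delta_mx 0 2) -
        u (vec3 q.1 q.2 t))).
      apply/funext => k /=; congr (_ *: (u _ - _)).
      by apply: row3P; rewrite !mxE/= ?mulr0 ?add0r// mulr1.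
    by apply: DeriveDef; [rewrite /derivable E; exact: u1 | rewrite /derive E].
  have := @line_energy (fun t => u (vec3 q.1 q.2 t))
    (fun t => 'D_(delta_mx 0 2) u (vec3 q.1 q.2 t))
    (fun t => enorm (gradient u (vec3 q.1 q.2 t))) a rho ab uvec.
  apply.
  - by move=> t; exact: (@continuous_comp _ _ _ (fun t => vec3 q.1 q.2 t)
      (fun x => 'D_(delta_mx 0 2) u x) t (cv _ _ t) (uc _)).
  - by move=> t; exact: (@continuous_comp _ _ _ (fun t => vec3 q.1 q.2 t) g t (cv _ _ t) (cg _)).
  - by move=> t; have := coord_le_enorm (gradient u (vec3 q.1 q.2 t)) 2; rewrite mxE.
  - apply/eqP; apply: contraT => ua.
    have : closed_support u (vec3 q.1 q.2 a) by apply: (@subset_closure _ [set x | u x != 0]).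
    move=> /uA/AS.
    move=> /(le_trans (coord_le_norm _ 2)); rewrite vec3E leNgt.
    by rewrite /a normrN ger0_norm; have := normr_ge0 rho; move: S1; lra.
  - by apply: uF; split; rewrite vec3E.
have mF := measurable_tonelli3 mg g0.
apply: (@le_trans _ _ (\int[leb2 R]_(q in D) c%:E)%E).
  have leD : leb2 R D = 1%E by rewrite /D leb2_rectangle// subr0 mulr1.
  by rewrite integral_cst//= [X in (_ * X)%E]leD mule1.
apply: (@le_trans _ _ (\int[leb2 R]_(q in D) \int[mu]_t (enorm (gradient u
    (vec3 q.1 q.2 t)) ^+ 3)%:E)%E).
  apply: ge0_le_integral => //.
  - by move=> q _; rewrite lee_fin ltW.
  - exact: measurable_funS mF.
apply: ge0_subset_integral => //.
by move=> q _; apply: integral_ge0 => t _; rewrite lee_fin exprn_ge0 ?enorm_ge0.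
Qed.

End plate.

(** * A point has conformal capacity zero *)

Section flat_functions.
Variable R : realType.
Implicit Types t : R.

(** The derivatives of the function [exp (- 1 / t)], extended by zero, are linear
    combinations of these functions. *)
Definition flat n t : R := if 0 < t then t^-1 ^+ n * expR (- t^-1) else 0.

Lemma flat_ge0 n t : 0 <= flat n t.
Proof.
by rewrite /flat; case: ifP => // t0; rewrite mulr_ge0 ?expR_ge0// exprn_ge0// invr_ge0 ltW.
Qed.

Lemma flat_le0 n t : t <= 0 -> flat n t = 0.
Proof. by move=> t0; rewrite /flat ltNge t0. Qed.

Lemma flat_bound n t : flat n t <= n`!%:R.
Proof.
rewrite /flat; case: ifP => [t0|_]; last exact: ler0n.
have s0 : 0 < t^-1 by rewrite invr_gt0.
rewrite expRN ler_pdivrMr ?expR_gt0//.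
case: n => [|n]; first by rewrite expr0 fact0 mul1r; have := expR_ge1Dx t^-1; lra.
have := expR_ge1Dxn n (ltW s0); move: (t^-1) => s h.
have f0 : 0 < (n.+1)`!%:R :> R by rewrite ltr0n fact_gt0.
by rewrite mulrC -ler_pdivrMr//; apply: le_trans h; rewrite lerDr.
Qed.

Lemma flat_quadratic n t : flat n t <= (n.+2)`!%:R * t ^+ 2.
Proof.
have [t0|t0] := leP t 0; first by rewrite flat_le0// mulr_ge0// sqr_ge0.
have := flat_bound n.+2 t; rewrite /flat t0 => h.
have -> : t^-1 ^+ n * expR (- t^-1) = t^-1 ^+ n.+2 * expR (- t^-1) * t ^+ 2.
  by rewrite !exprS; field; rewrite gt_eqF.
by rewrite ler_wpM2r// sqr_ge0.
Qed.

(** At the origin, the derivative vanishes by the quadratic bound. *)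
Lemma is_derive_flat n t :
  is_derive t 1 (flat n) (flat n.+2 t - n%:R * flat n.+1 t).
Proof.
have [t0|t0|->] := ltgtP t 0.
- rewrite !flat_le0 ?ltW// mulr0 subr0.
  apply: (near_eq_is_derive _ (is_derive_cst (0 : R^o) (t : R^o) 1)).
  by near=> s; rewrite flat_le0//; apply: ltW; near: s; exact: lt_nbhsl.
- have tn : t != 0 by rewrite gt_eqF.
  have dinv : is_derive t 1 (fun s : R => s^-1) (- t ^- 2).
    apply: is_derive_eq; first by apply: (is_deriveV (f := id)).
    by rewrite scaleNr; congr (- _); rewrite /GRing.scale/= mulr1.
  have d1 := is_deriveX n dinv.
  have d2 := @is_derive1_comp R expR (- (fun s : R => s^-1)) t _ _ (is_derive_expR _) (is_deriveN dinv).
  have := is_deriveM d1 d2.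
  rewrite (_ : _ + _ = flat n.+2 t - n%:R * flat n.+1 t); last first.
    rewrite /flat t0 !fctE /GRing.scale/= opprK.
    case: n {d1} => [|n]; first by rewrite !expr0 !mul0r subr0 mulr0 addr0; field.
    by rewrite /= !exprS -natr1; field.
  apply: near_eq_is_derive.
  near=> s; rewrite /flat ifT ?fctE//; near: s; exact: lt_nbhsr.
- rewrite !flat_le0// mulr0 subr0.
  have c : (fun h : R => h^-1 *: ((flat n \o shift (0 : R)) (h *: (1 : R)) - flat n 0)) @ 0^' --> (0 : R).
    apply/cvgrPdist_lt => e e0; have C0 : 0 < (n.+2)`!%:R :> R by rewrite ltr0n fact_gt0.
    near=> h; have hn : h != 0 by near: h; exact: nbhs_dnbhs_neq.
    rewrite /= sub0r normrN addr0 (flat_le0 n (lexx 0)) subr0 /GRing.scale/= mulr1.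
    rewrite normrM normfV ger0_norm ?flat_ge0//.
    have h0 : 0 < `|h| by rewrite normr_gt0.
    rewrite mulrC ltr_pdivrMr//; apply: (le_lt_trans (flat_quadratic n h)).
    rewrite -[h ^+ 2]real_normK ?num_real// expr2 mulrA ltr_pM2r// mulrC -ltr_pdivlMr//.
    near: h; apply: dnbhs0_lt; exact: divr_gt0.
  apply: DeriveDef; first by apply/cvg_ex; exists 0.
  exact: cvg_lim c.
Unshelve. all: by end_near.
Qed.

Lemma continuous_flat n : continuous (flat n).
Proof.
move=> t; apply: differentiable_continuous; apply/derivable1_diffP.
by have [] := is_derive_flat n t.
Qed.

End flat_functions.

Section smooth_functions.
Variable R : realType.
Local Notation V := 'rV[R]_3.

(** A family of smooth functions of three variables that is closed under partial
    derivatives, so that its members have partial derivatives of all orders. *)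
Inductive flat_combination : (V -> R) -> Prop :=
| flat_coordinate n i a c : flat_combination (fun x => flat n (a * x 0 i + c))
| flat_const c : flat_combination (fun=> c)
| flat_add u v : flat_combination u -> flat_combination v ->
    flat_combination (fun x => u x + v x)
| flat_mul u v : flat_combination u -> flat_combination v ->
    flat_combination (fun x => u x * v x).

Lemma is_derive_coordinate n (i j : 'I_3) a c (x : V) :
  is_derive x (delta_mx 0 j) (fun x : V => flat n (a * x 0 i + c))
   ((flat n.+2 (a * x 0 i + c) - n%:R * flat n.+1 (a * x 0 i + c)) * (a * (i == j)%:R)).
Proof.
have E : (fun k : R => k^-1 *: (((fun x : V => flat n (a * x 0 i + c)) \o shift x)
     (k *: delta_mx 0 j) - flat n (a * x 0 i + c))) =
   (fun k : R => k^-1 *: (((fun t => flat n (a * (t * (i == j)%:R + x 0 i) + c)) \o shift 0) (k *: (1 : R)) -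
     flat n (a * x 0 i + c))).
  by apply/funext => k /=; congr (_ *: (flat _ (_ * _ + _) - _)); rewrite !mxE/= /GRing.scale/= mulr1 addr0.
have d : is_derive (0 : R) 1 (fun t : R => flat n (a * (t * (i == j)%:R + x 0 i) + c))
   ((flat n.+2 (a * x 0 i + c) - n%:R * flat n.+1 (a * x 0 i + c)) * (a * (i == j)%:R)).
  have dl : is_derive (0 : R) 1 (fun t : R => a * (t * (i == j)%:R + x 0 i) + c) (a * (i == j)%:R).
    have -> : (fun t : R => a * (t * (i == j)%:R + x 0 i) + c) =
        (a * (i == j)%:R) \*: (@id R) + cst (a * x 0 i + c).
      by apply/funext => t; rewrite fctE /= /GRing.scale/=; ring.
    by apply: is_derive_eq; rewrite addr0 /GRing.scale/= mulr1.
  have := @is_derive1_comp R (flat n) _ 0 _ _ (is_derive_flat n _) dl.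
  by rewrite mul0r add0r.
have [d1 d2] := d.
apply: DeriveDef.
  by move: d1; rewrite /derivable E /= mul0r add0r.
by move: d2; rewrite /derive E /= mul0r add0r.
Qed.

Lemma flat_combination_derive u (j : 'I_3) : flat_combination u ->
  exists2 v, flat_combination v & forall x : V, is_derive x (delta_mx 0 j) u (v x).
Proof.
elim=> {u} [n i a c|c|u v _ [u' fu du] _ [v' fv dv]|u v fu0 [u' fu du] fv0 [v' fv dv]].
- exists (fun x => (flat n.+2 (a * x 0 i + c) + - n%:R * flat n.+1 (a * x 0 i + c)) *
    (a * (i == j)%:R)).
    by apply: flat_mul; [apply: flat_add; [|apply: flat_mul]|]; constructor.
  by move=> x; rewrite mulNr; exact: is_derive_coordinate.
- by exists (fun=> 0); [constructor | move=> x; exact: is_derive_cst].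
- by exists (fun x => u' x + v' x); [constructor | move=> x; exact: is_deriveD].
- exists (fun x => u x * v' x + v x * u' x); last by move=> x; exact: is_deriveM.
  by apply: flat_add; apply: flat_mul.
Qed.

Lemma flat_combination_continuous u : flat_combination u -> continuous u.
Proof.
elim=> {u} [n i a c|c|u v _ cu _ cv|u v _ cu _ cv] x.
- apply: (@continuous_comp _ _ _ (fun x : V => a * x 0 i + c) (flat n)); last exact: continuous_flat.
  apply/continuous_normP => e e0; exists (e / (`|a| + 1)).
    by rewrite divr_gt0// ltr_wpDl.
  move=> z; rewrite ltr_pdivlMr ?ltr_wpDl// => zx.
  rewrite (_ : _ - _ = a * (z 0 i - x 0 i)); last by ring.
  rewrite normrM; apply: le_lt_trans zx; rewrite mulrC.
  have := coord_le_enorm (z - x) i; rewrite rowB => h.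
  by apply: ler_pM => //; lra.
- exact: cst_continuous.
- by apply: continuousD; [exact: cu | exact: cv].
- by apply: continuousM; [exact: cu | exact: cv].
Qed.

Lemma flat_combination_smooth u : flat_combination u -> smooth u.
Proof.
move=> fu k; elim: k u fu => [|k IH] u fu; first exact: flat_combination_continuous.
move=> i; have [v fv dv] := flat_combination_derive i fu; split=> [x|].
  by have [] := dv x.
rewrite (_ : (fun x => _) = v); first exact: IH.
by apply/funext => x; have [_ ->] := dv x.
Qed.

Lemma flat_combination_sum (I : Type) (s : seq I) (u : I -> V -> R) :
  (forall i, flat_combination (u i)) -> flat_combination (fun x => \sum_(i <- s) u i x).
Proof.
move=> fu; elim: s => [|i s IH].
  by rewrite (_ : (fun x => _) = (fun=> 0)); [constructor | apply/funext => x; rewrite big_nil].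
rewrite (_ : (fun x => _) = (fun x => u i x + \sum_(i <- s) u i x)).
  by apply: flat_add.
by apply/funext => x; rewrite big_cons.
Qed.

End smooth_functions.

Section capacity_of_a_point.
Variable R : realType.
Local Notation V := 'rV[R]_3.
Local Notation T1 := (measurableTypeR R).

Definition bump k (t : R) := flat 0 (- 2 ^+ k * t + 1) * flat 0 (2 ^+ k * t + 1).

Definition dbump k (t : R) := 2 ^+ k *
  (flat 0 (- 2 ^+ k * t + 1) * flat 2 (2 ^+ k * t + 1) -
   flat 2 (- 2 ^+ k * t + 1) * flat 0 (2 ^+ k * t + 1)).

Let p2 k : 0 < 2 ^+ k :> R. Proof. by rewrite exprn_gt0. Qed.

Let f01 (t : R) : 0 <= flat 0 t <= 1.
Proof. by rewrite flat_ge0/=; have := flat_bound 0 t. Qed.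

Let f22 (t : R) : 0 <= flat 2 t <= 2.
Proof. by rewrite flat_ge0/=; have := flat_bound 2 t. Qed.

Lemma bump_itv k t : 0 <= bump k t <= 1.
Proof.
rewrite /bump; have /andP[a0 a1] := f01 (- 2 ^+ k * t + 1).
have /andP[b0 b1] := f01 (2 ^+ k * t + 1).
by rewrite mulr_ge0//= mulr_ile1.
Qed.

Lemma dbump_bound k t : `|dbump k t| <= 4 * 2 ^+ k.
Proof.
rewrite /dbump normrM (gtr0_norm (p2 k)) mulrC ler_wpM2r ?(ltW (p2 k))//.
have := f01 (- 2 ^+ k * t + 1); have := f01 (2 ^+ k * t + 1).
have := f22 (- 2 ^+ k * t + 1); have := f22 (2 ^+ k * t + 1).
move: (flat 0 _) (flat 0 _) (flat 2 _) (flat 2 _) => a b c d.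
move=> /andP[? ?] /andP[? ?] /andP[? ?] /andP[? ?].
by rewrite ler_norml; apply/andP; split; nra.
Qed.

Lemma bump_support k t : 1 < 2 ^+ k * `|t| -> bump k t = 0 /\ dbump k t = 0.
Proof.
move=> kt; have [t0|t0] := leP 0 t.
  rewrite ger0_norm// in kt; rewrite /bump /dbump !(@flat_le0 _ _ (- 2 ^+ k * t + 1)); last 2 first.
  - by rewrite mulNr; lra.
  - by rewrite mulNr; lra.
  by rewrite !mul0r subrr mulr0.
rewrite ltr0_norm// in kt; rewrite /bump /dbump !(@flat_le0 _ _ (2 ^+ k * t + 1)); last 2 first.
- by rewrite mulrN in kt; lra.
- by rewrite mulrN in kt; lra.
by rewrite !mulr0 subrr mulr0.
Qed.

Lemma is_derive_bump k (i j : 'I_3) (x : V) :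
  is_derive x (delta_mx 0 j) (fun x : V => bump k (x 0 i)) (dbump k (x 0 i) * (i == j)%:R).
Proof.
have := is_deriveM (is_derive_coordinate 0 i j (- 2 ^+ k) 1 x)
  (is_derive_coordinate 0 i j (2 ^+ k) 1 x).
rewrite (_ : _ *: _ + _ *: _ = dbump k (x 0 i) * (i == j)%:R)//.
by rewrite /dbump /GRing.scale/=; ring.
Qed.

(** The constant makes the value at the origin [1], where each of the six factors that
    are hidden in the bumps is [exp (- 1)]. *)
Definition psi k (x : V) := expR 6 * (bump k (x 0 0) * (bump k (x 0 1) * bump k (x 0 2))).

Definition dpsi k (j : 'I_3) (x : V) := expR 6 *
  (bump k (x 0 0) * (bump k (x 0 1) * (dbump k (x 0 2) * (2 == j)%:R) +
    bump k (x 0 2) * (dbump k (x 0 1) * (1 == j)%:R)) +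
   bump k (x 0 1) * bump k (x 0 2) * (dbump k (x 0 0) * (0 == j)%:R)).

Lemma is_derive_psi k j x : is_derive x (delta_mx 0 j) (psi k) (dpsi k j x).
Proof.
have d := is_deriveM (is_derive_cst (expR 6 : R) x (delta_mx 0 j)) (is_deriveM (is_derive_bump k 0 j x)
  (is_deriveM (is_derive_bump k 1 j x) (is_derive_bump k 2 j x))).
move: d; rewrite (_ : _ *: _ + _ *: _ = dpsi k j x)//.
by rewrite /dpsi /GRing.scale/= !fctE; ring.
Qed.

Definition cube k : set (T1 * T1 * T1) :=
  (`[- (2 ^+ k)^-1, (2 ^+ k)^-1]%classic `*` `[- (2 ^+ k)^-1, (2 ^+ k)^-1]%classic) `*`
  `[- (2 ^+ k)^-1, (2 ^+ k)^-1]%classic.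

Lemma dpsi_bound k j p : `|dpsi k j (vec3 p.1.1 p.1.2 p.2)| <= 12 * expR 6 * 2 ^+ k * \1_(cube k) p.
Proof.
have e0 := expR_gt0 (6 : R).
have [pk|pk] := pselect (cube k p); last first.
  rewrite indicE memNset// mulr0 normr_le0; apply/eqP.
  have out t : ~ (- (2 ^+ k)^-1 <= t <= (2 ^+ k)^-1) -> bump k t = 0 /\ dbump k t = 0.
    move=> nt; apply: bump_support; rewrite mulrC -ltr_pdivrMr// mul1r ltNge.
    by apply/negP => tk; apply: nt; rewrite -ler_norml.
  rewrite /dpsi !vec3E.
  have [/andP h0|/out[-> ->]] := pselect (- (2 ^+ k)^-1 <= p.1.1 <= (2 ^+ k)^-1); last first.
    by rewrite !(mul0r, mulr0, addr0).
  have [/andP h1|/out[-> ->]] := pselect (- (2 ^+ k)^-1 <= p.1.2 <= (2 ^+ k)^-1); last first.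
    by rewrite !(mul0r, mulr0, addr0).
  have [/andP h2|/out[-> ->]] := pselect (- (2 ^+ k)^-1 <= p.2 <= (2 ^+ k)^-1); last first.
    by rewrite !(mul0r, mulr0, addr0).
  by case: pk; split; [split|]; rewrite /= in_itv/=; exact/andP.
rewrite indicE mem_set// mulr1 /dpsi normrM (gtr0_norm e0) (mulrC 12) -(mulrA _ 12) ler_pM2l//.
rewrite !vec3E.
have b t := bump_itv k t; have d t := dbump_bound k t.
have bn t : `|bump k t| <= 1 by rewrite ger0_norm; have /andP[] := b t.
have dn t (c : bool) : `|dbump k t * c%:R| <= 4 * 2 ^+ k.
  by case: c; rewrite ?mulr1// mulr0 normr0 mulr_ge0// ltW.
have prod u v w : `|u| <= 1 -> `|v| <= w -> `|u * v| <= w :> R.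
  by move=> u1 vw; rewrite normrM -[w]mul1r ler_pM.
apply: (le_trans (ler_normD _ _)).
rewrite (_ : 12 * 2 ^+ k = (4 * 2 ^+ k + 4 * 2 ^+ k) + 4 * 2 ^+ k); last by ring.
apply: lerD; last by apply: (prod _ _ _ (prod _ _ _ (bn _) (bn _)) (dn _ _)).
apply: (prod _ _ _ (bn _)); apply: (le_trans (ler_normD _ _)).
exact: lerD (prod _ _ _ (bn _) (dn _ _)) (prod _ _ _ (bn _) (dn _ _)).
Qed.

(** The average of the rescaled bumps: a logarithmic cut-off. *)
Definition cutoff N (x : V) := N%:R^-1 * \sum_(0 <= k < N) psi k x.

Lemma flat_combination_cutoff N : flat_combination (cutoff N).
Proof.
apply: flat_mul; first exact: flat_const.
apply: flat_combination_sum => k; apply: flat_mul; first exact: flat_const.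
by apply: flat_mul; [|apply: flat_mul]; apply: flat_mul; exact: flat_coordinate.
Qed.

Lemma is_derive_cutoff N j x : is_derive x (delta_mx 0 j) (cutoff N)
  (N%:R^-1 * \sum_(0 <= k < N) dpsi k j x).
Proof.
have sum (s : seq nat) : is_derive x (delta_mx 0 j) (fun x => \sum_(k <- s) psi k x)
    (\sum_(k <- s) dpsi k j x).
  elim: s => [|k s IH].
    rewrite big_nil (_ : (fun x => _) = cst 0); first exact: is_derive_cst.
    by apply/funext => y; rewrite big_nil.
  rewrite big_cons (_ : (fun x => _) = psi k + (fun x => \sum_(k <- s) psi k x)).
    exact: is_deriveD (is_derive_psi k j x) IH.
  by apply/funext => y; rewrite big_cons.
have := is_deriveM (is_derive_cst (N%:R^-1 : R) x (delta_mx 0 j)) (sum (index_iota 0 N)).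
by rewrite /GRing.scale/= mulr0 addr0 fctE.
Qed.

Lemma cutoff0 N : (0 < N)%N -> cutoff N 0 = 1.
Proof.
move=> N0; rewrite /cutoff (eq_bigr (fun=> 1)) => [|k _].
  by rewrite sumr_const_nat subn0 mulVf// pnatr_eq0 -lt0n.
rewrite /psi /bump !mxE !mulr0 !add0r /flat ltr01 expr0 mul1r invr1.
by rewrite -!expRD -[RHS]expR0; congr expR; ring.
Qed.

Lemma cutoff_support N x : 1 < `|x| -> cutoff N x = 0.
Proof.
move=> x1; rewrite /cutoff big1 ?mulr0// => k _.
have [i xi] : exists i, 1 < `|x 0 i|.
  apply: contrapT => /forallNP h; move: x1; rewrite ltNge => /negP; apply.
  rewrite /Num.norm/= mx_normrE; apply: bigmax_le => // -[a b] _ /=.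
  by rewrite ord1 leNgt; apply/negP; exact: h.
have b0 : bump k (x 0 i) = 0.
  apply: (bump_support _).1; apply: (lt_le_trans xi).
  by rewrite ler_peMl// exprn_ege1// ler1n.
rewrite /psi; case: i {xi} b0 => -[|[|[|//]]] h.
- by rewrite (_ : Ordinal h = 0) => [->|]; [rewrite !(mul0r, mulr0)|exact: val_inj].
- by rewrite (_ : Ordinal h = 1) => [->|]; [rewrite !(mul0r, mulr0)|exact: val_inj].
- by rewrite (_ : Ordinal h = 2) => [->|]; [rewrite !(mul0r, mulr0)|exact: val_inj].
Qed.

Lemma cube_nested k p : cube k.+1 p -> cube k p.
Proof.
have h : (2 ^+ k.+1)^-1 <= (2 ^+ k)^-1 :> R.
  by rewrite lef_pV2 ?posrE// exprS ler_peMl ?ler1n// ltW.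
have w (t : R) : t \in `[- (2 ^+ k.+1)^-1, (2 ^+ k.+1)^-1] -> t \in `[- (2 ^+ k)^-1, (2 ^+ k)^-1].
  by rewrite !in_itv/= => /andP[? ?]; apply/andP; split; lra.
by move=> [[/= /w ? /w ?] /w ?].
Qed.

(** Since the cubes are nested, the sum is dominated by its last nonzero term. *)
Lemma sum_cubes N p : (\sum_(0 <= k < N) 2 ^+ k * \1_(cube k) p) ^+ 3 <=
  \sum_(0 <= k < N) 8 * (8 ^+ k * \1_(cube k) p) :> R.
Proof.
elim: N => [|N IH]; first by rewrite !big_nil expr0n.
rewrite !big_nat_recr//=; have [pN|pN] := pselect (cube N p); last first.
  by rewrite !indicE memNset// !mulr0 !addr0.
rewrite indicE mem_set// !mulr1.
have le : \sum_(0 <= k < N) 2 ^+ k * \1_(cube k) p <= 2 ^+ N :> R.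
  elim: N {IH} pN => [|N IH] pN; first by rewrite big_nil.
  rewrite big_nat_recr//= exprS [2 * _]mulrDl mul1r lerD ?IH//; first exact: cube_nested.
  by rewrite ler_piMr ?(ltW (p2 _))// indicE; case: (_ \in _).
have ge : 0 <= \sum_(0 <= k < N) 2 ^+ k * \1_(cube k) p :> R.
  by apply: sumr_ge0 => k _; rewrite mulr_ge0 ?(ltW (p2 _))// indicE.
have ge8 : 0 <= \sum_(0 <= k < N) 8 * (8 ^+ k * \1_(cube k) p) :> R.
  by apply: sumr_ge0 => k _; rewrite !mulr_ge0 ?exprn_ge0// indicE.
apply: (@le_trans _ _ ((2 * 2 ^+ N) ^+ 3)).
  have sum_le : \sum_(0 <= k < N) 2 ^+ k * \1_(cube k) p + 2 ^+ N <= 2 * 2 ^+ N :> R.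
    by rewrite [2 * _]mulrDl mul1r lerD2r.
  by apply: lerXn2r sum_le; rewrite nnegrE ?mulr_ge0 ?addr_ge0 ?(ltW (p2 N)).
rewrite exprMn -exprM mulnC exprM (_ : 2 ^+ 3 = 8 :> R); last by rewrite -natrX.
by rewrite lerDr.
Qed.

(** The energy integral is invariant under scaling, so that the [N] bumps have the same
    energy.  By [sum_cubes] the energy of their average is at most a constant times
    [N * N ^- 3], while the value at the origin remains [1]. *)
Lemma cutoff_energy N : (0 < N)%N ->
  (conformal_energy (cutoff N) <= (64 * (36 * expR 6) ^+ 3 / N%:R)%:E)%E.
Proof.
move=> N0; have Np : 0 < N%:R :> R by rewrite ltr0n.
pose c : R := 36 * expR 6; have c0 : 0 < c by rewrite mulr_gt0// expR_gt0.
pose F k (p : T1 * T1 * T1) := (8 * (c / N%:R) ^+ 3 * 8 ^+ k * \1_(cube k) p)%:E.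
have cN : 0 <= 8 * (c / N%:R) ^+ 3.
  by rewrite mulr_ge0// exprn_ge0// divr_ge0// ltW.
have F0 k p : (0 <= F k p)%E.
  by rewrite lee_fin !mulr_ge0 ?exprn_ge0 ?divr_ge0 ?(ltW c0) ?(ltW Np)// indicE.
have mcube k : measurable (cube k).
  by apply: measurableX; [apply: measurableX|]; exact: measurable_itv.
have mF k : measurable_fun setT (F k : T1 * T1 * T1 -> \bar R).
  apply/measurable_EFinP; apply: measurable_funM; first exact: measurable_cst.
  exact: measurable_indic.
have smooth_cutoff := flat_combination_smooth (flat_combination_cutoff N).
have pointwise p : ((enorm (gradient (cutoff N) (vec3 p.1.1 p.1.2 p.2)) ^+ 3)%:E <=
    \sum_(0 <= k < N) F k p)%E.
  rewrite sumEFin lee_fin.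
  have -> : \sum_(0 <= k < N) 8 * (c / N%:R) ^+ 3 * 8 ^+ k * \1_(cube k) p =
      (c / N%:R) ^+ 3 * \sum_(0 <= k < N) 8 * (8 ^+ k * \1_(cube k) p).
    by rewrite mulr_sumr; apply: eq_bigr => k _; ring.
  apply: (@le_trans _ _ ((c / N%:R * \sum_(0 <= k < N) 2 ^+ k * \1_(cube k) p) ^+ 3)); last first.
    by rewrite exprMn ler_wpM2l ?sum_cubes// exprn_ge0// divr_ge0// ltW.
  have part (j : 'I_3) : `|gradient (cutoff N) (vec3 p.1.1 p.1.2 p.2) 0 j| <=
      12 * expR 6 / N%:R * \sum_(0 <= k < N) 2 ^+ k * \1_(cube k) p.
    rewrite mxE; have [_ ->] := is_derive_cutoff N j (vec3 p.1.1 p.1.2 p.2).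
    rewrite normrM normfV (gtr0_norm Np) mulrAC mulrC ler_pM2r ?invr_gt0//.
    apply: (le_trans (ler_norm_sum _ _ _)); rewrite mulr_sumr; apply: ler_sum => k _.
    by rewrite mulrA; exact: dpsi_bound.
  have le := enorm3_sum (gradient (cutoff N) (vec3 p.1.1 p.1.2 p.2)).
  have h0 := part 0; have h1 := part 1; have h2 := part 2.
  have tot : enorm (gradient (cutoff N) (vec3 p.1.1 p.1.2 p.2)) <=
      c / N%:R * \sum_(0 <= k < N) 2 ^+ k * \1_(cube k) p.
    rewrite (_ : c / N%:R * _ = 12 * expR 6 / N%:R * \sum_(0 <= k < N) 2 ^+ k * \1_(cube k) p +
      12 * expR 6 / N%:R * \sum_(0 <= k < N) 2 ^+ k * \1_(cube k) p +
      12 * expR 6 / N%:R * \sum_(0 <= k < N) 2 ^+ k * \1_(cube k) p); last by rewrite /c; ring.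
    by apply: (le_trans le); rewrite !lerD.
  by rewrite lerXn2r ?nnegrE ?enorm_ge0// (le_trans _ tot)// enorm_ge0.
rewrite /conformal_energy.
apply: (@le_trans _ _ (\int[leb3 R]_(p in setT) \sum_(0 <= k < N) F k p)%E).
  apply: ge0_le_integral => //.
  - by move=> p _; rewrite lee_fin exprn_ge0 ?enorm_ge0.
  - apply/measurable_EFinP; apply: measurable_funX.
    exact: (measurable_continuous3 (continuous_gradient_norm smooth_cutoff)).
  - exact: emeasurable_sum.
rewrite ge0_integral_sum//.
have intF k : (\int[leb3 R]_(p in setT) F k p = (64 * (c / N%:R) ^+ 3)%:E)%E.
  rewrite /F; under eq_integral do rewrite EFinM.
  have c8 : 0 <= 8 * (c / N%:R) ^+ 3 * 8 ^+ k by rewrite mulr_ge0// exprn_ge0.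
  have m1 : measurable_fun setT (fun p : T1 * T1 * T1 => (\1_(cube k) p)%:E : \bar R).
    by apply/measurable_EFinP; exact: measurable_indic.
  rewrite (ge0_integralZl_EFin _ _ _ m1)//.
  rewrite integral_indic// setIT /cube.
  have k0 : - (2 ^+ k)^-1 <= (2 ^+ k)^-1 :> R.
    by have : 0 < (2 ^+ k)^-1 :> R; [rewrite invr_gt0 | lra].
  transitivity ((8 * (c / N%:R) ^+ 3 * 8 ^+ k)%:E *
      (((2 ^+ k)^-1 - - (2 ^+ k)^-1) * ((2 ^+ k)^-1 - - (2 ^+ k)^-1) *
       ((2 ^+ k)^-1 - - (2 ^+ k)^-1))%:E)%E.
    by congr (_ * _)%E; exact: leb3_box.
  rewrite -EFinM; congr EFin.
  rewrite (_ : 8 = 2 ^+ 3 :> R); last by rewrite -natrX.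
  rewrite -exprM mulnC exprM.
  rewrite (_ : 64 = 2 ^+ 6 :> R); last by rewrite -natrX.
  by field; rewrite !gt_eqF.
rewrite (eq_bigr (fun=> (64 * (c / N%:R) ^+ 3)%:E))// sumEFin lee_fin.
rewrite sumr_const_nat subn0 -[_ *+ N]mulr_natr -/c.
have N1 : 1 <= N%:R :> R by rewrite ler1n.
rewrite (_ : 64 * (c / N%:R) ^+ 3 * N%:R = 64 * c ^+ 3 / N%:R * (N%:R)^-1); last first.
  by field; rewrite gt_eqF.
rewrite ler_piMr//; first by rewrite divr_ge0 ?mulr_ge0 ?exprn_ge0// ltW.
by rewrite invf_le1.
Qed.

Lemma capacity0_origin (F : set V) : F `<=` [set 0] -> compact_capacity0 F.
Proof.
move=> F0; exists [set x | `|x| < 2]; split.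
- apply: (@open_comp _ _ (fun x : V => `|x|) [set t | t < 2]); last exact: open_lt.
  by move=> x _; exact: norm_continuous.
- exists 2; split; first exact: num_real.
  by move=> t t2 x /= x2; exact: ltW (lt_trans x2 t2).
- by move=> x /F0 ->; rewrite /= normr0.
- apply/le_anti/andP; split; last first.
    apply/ereal_infP => _ [u _ <-]; apply: integral_ge0 => p _.
    by rewrite lee_fin exprn_ge0 ?enorm_ge0.
  apply/lee_addgt0Pr => e e0; rewrite add0e.
  pose C : R := 64 * (36 * expR 6) ^+ 3.
  have C0 : 0 < C by rewrite !mulr_gt0// exprn_gt0// mulr_gt0// expR_gt0.
  pose N := (Num.truncn (C / e)).+1.
  have N0 : 0 < N%:R :> R by rewrite ltr0n.
  have CN : C / N%:R <= e.
    by rewrite ler_pdivrMr// mulrC -ler_pdivrMr// ltW// truncnS_gt.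
  apply: ge_ereal_inf; exists (conformal_energy (cutoff N)); last first.
    by apply: (le_trans (cutoff_energy (ltn0Sn _))); rewrite lee_fin.
  exists (cutoff N) => //.
  have [Kc Kcl] := @enorm_ball_compact R 3 1.
  have sup : closed_support (cutoff N) `<=` [set x | `|x| <= 1].
    move: Kcl => /closure_id ->; apply: closureS => x /= xN.
    by rewrite leNgt; apply/negP => /(cutoff_support N) xN0; rewrite xN0 eqxx in xN.
  split.
  + exact/flat_combination_smooth/flat_combination_cutoff.
  + by apply: subclosed_compact Kc sup; exact: closed_closure.
  + by move=> x /sup /= x1; exact: le_lt_trans x1 (ltr1n _ 2).
  + by move=> x /F0 ->; rewrite cutoff0.
Qed.

End capacity_of_a_point.

(** * The Julia set of the Zorich map *)

Section julia_nonescaping.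
Variables (R : realType) (L lambda : R) (h : 'rV[R]_2 -> 'rV[R]_3).
Hypothesis h_bilip : bilipschitz_on (@square R) L h.
Hypothesis h_onto : h @` (@square R) = @upper_hemisphere R.
Hypothesis lambda_gt0 : 0 < lambda.
Hypothesis lambda_lt : lambda < expR (- (ln L + L)).

Local Notation f := (zorich_scaled lambda h).

Lemma plate_compact (rho : R) : compact
  [set x : 'rV[R]_3 | [/\ x 0 2 = rho, 0 <= x 0 0 <= 1 & 0 <= x 0 1 <= 1]].
Proof.
have closed_coordinate (i : 'I_3) (C : set R) : closed C -> closed [set x : 'rV[R]_3 | C (x 0 i)].
  move=> Cc; apply: (@preimage_closed _ _ (fun x : 'rV[R]_3 => x 0 i) C) => // x _.
  exact: coord_continuous.
apply: bounded_closed_compact.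
  exists (`|rho| + 2); split; first exact: num_real.
  move=> t rt x [x2 /andP[x0 x01] /andP[x1 x11]].
  have := enorm3_sum x; rewrite x2 (ger0_norm x0) (ger0_norm x1); have := norm_le_enorm x => /=.
  by lra.
set plate := (X in closed X).
have -> : plate = [set x | [set rho] (x 0 2)] `&`
    ([set x | `[0, 1]%classic (x 0 0)] `&` [set x | `[0, 1]%classic (x 0 1)]).
  by apply/seteqP; split => x /=; rewrite !in_itv/=; [case | case=> ? []].
apply: closedI; [|apply: closedI]; apply: closed_coordinate.
- exact: closed_eq.
- exact: itv_closed.
- exact: itv_closed.
Qed.

(** Around a non-escaping point the images of a neighbourhood omit at most the origin.
    Around any other point the images stay in a ball, and what they omit contains a
    plate. *)
Lemma julia_nonescaping : julia f = nonescaping L lambda h.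
Proof.
apply/seteqP; split=> [x Jx|x Kx U xU F _ FU].
  apply: contrapT => /(iterates_bounded h_bilip h_onto lambda_gt0 lambda_lt)[U xU [r [r0 fU]]].
  apply: (@plate_capacity R (r + 1)); apply: (Jx U xU); first exact: plate_compact.
  move=> y [y2 _ _] [k k1 yk]; have := fU k k1 y yk.
  have := coord_le_enorm y 2; rewrite y2 ger0_norm; lra.
apply: capacity0_origin => y /FU yU; apply: contrapT => /eqP y0; apply: yU.
have [k k1 yk] := iterates_cover h_bilip h_onto lambda_gt0 lambda_lt Kx xU y0.
by exists k.
Qed.

End julia_nonescaping.

Theorem theorem3 (R : realType) (L lambda : R) (h : 'rV[R]_2 -> 'rV[R]_3)
    (h_bilip : bilipschitz_on (@square R) L h)
    (h_onto : h @` (@square R) = @upper_hemisphere R)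
    (h_sense : sense_preserving h)
    (lambda_gt0 : 0 < lambda)
    (lambda_lt : lambda < expR (- (ln L + L))) :
  exists2 B : set 'rV[R]_3, straight_brush B &
  exists2 phi : 'rV[R]_3 -> 'rV[R]_3,
    homeo_on B (julia (zorich_scaled lambda h)) phi &
  exists2 Phi : one_point_compactification 'rV[R]_3 ->
                one_point_compactification 'rV[R]_3,
    homeo_on (add_infty B) (add_infty (julia (zorich_scaled lambda h))) Phi &
    forall x, B x -> Phi (Some x) = Some (phi x).
Proof.
have L1 := bilipschitz_ge1 h_bilip h_onto.
exists (model_brush L lambda); first exact: model_brush_straight.
rewrite (julia_nonescaping h_bilip h_onto lambda_gt0 lambda_lt).
exact: brush_homeomorphism.
Qed.
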